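(* Let $M^1=M|_{x_3=y_3}$ and $M^0=M|_{x_3=0}$, with entries $m^1_{jl}$, $m^0_{jl}$, and define $$\lambda_\pm=(m^1_{33})^{-1}\Big[-i\sum_{j=1}^2m^1_{3j}\xi_j\pm\sqrt{m^1_{33}\Big(\sum_{j,l=1}^2m^1_{jl}\xi_j\xi_l+\tau\Big)-\Big(\sum_{j=1}^2m^1_{3j}\xi_j\Big)^2}\,\Big],$$ $$\mu_\pm=(m^1_{33})^{-1}\Big[-i\sum_{j=1}^2m^1_{3j}\xi_j\pm\sqrt{m^1_{33}\Big(\sum_{j,l=1}^2m^1_{jl}\xi_j\xi_l+\frac{\tau}{k}\Big)-\Big(\sum_{j=1}^2m^1_{3j}\xi_j\Big)^2}\,\Big],$$ where the real parts of the square roots are positive. Then for $\ell=1,2$ the amplitudes determined by the hierarchy (H) described in the context are $$\mathbf a_\ell=\sum_{L=0}^\infty\mathbf a_{\ell,-1-L},\quad \mathbf b_\ell=\sum_{L=0}^\infty\mathbf b_{\ell,-1-L},\quad \mathbf d_\ell=\sum_{L=0}^\infty\mathbf d_{\ell,-1-L},\quad \mathbf e_\ell=\sum_{L=0}^\infty\mathbf e_{\ell,-1-L},$$ where, for every $L\ge1$, writing $z=x_3-y_3$ and $\mathcal E(\beta,\delta)=\exp(\beta x_3-\delta y_3-\tau s-iy'\cdot\xi')$, $$\mathbf a_{\ell,-L}=(2-\ell)\sum_{l=0}^{2L-2}f^L_{l,1}z^l\,\mathcal E(\lambda_+,\lambda_-)+(\ell-1)\sum_{l=0}^{2L-2}f^L_{l,2}z^l\,\mathcal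 E(\lambda_+,\mu_-)+(2-\ell)\sum_{l=0}^{2L-2}f^L_{l,3}z^l\,\mathcal E(\lambda_-,\lambda_-),$$ $$\mathbf b_{\ell,-L}=(2-\ell)\sum_{l=0}^{2L-2}f^L_{l,1}z^l\,\mathcal E(\lambda_+,\lambda_-)+(\ell-1)\sum_{l=0}^{2L-2}f^L_{l,2}z^l\,\mathcal E(\lambda_+,\mu_-)+(2-\ell)\sum_{l=0}^{2L-2}f^L_{l,4}z^l\,\mathcal E(\lambda_+,\lambda_+),$$ $$\mathbf d_{\ell,-L}=(2-\ell)\sum_{l=0}^{2L-2}f^L_{l,5}z^l\,\mathcal E(\mu_+,\lambda_-)+(\ell-1)\sum_{l=0}^{2L-2}f^L_{l,6}z^l\,\mathcal E(\mu_+,\mu_-)+(\ell-1)\sum_{l=0}^{2L-2}f^L_{l,7}z^l\,\mathcal E(\mu_-,\mu_-),$$ $$\mathbf e_{\ell,-L}=(2-\ell)\sum_{l=0}^{2L-2}f^L_{l,5}z^l\,\mathcal E(\mu_+,\lambda_-)+(\ell-1)\sum_{l=0}^{2L-2}f^L_{l,6}z^l\,\mathcal E(\mu_+,\mu_-)+(\ell-1)\sum_{l=0}^{2L-2}f^L_{l,8}z^l\,\mathcal E(\mu_+,\mu_+),$$ with coefficients $f^L_{l,j}$ independent of $x_3$, $s$ and $\ell$ and with $\mathrm{ord}\,f^L_{l,j}=l-L$ for $j=1,\dots,8$. They are given explicitly as follows. Put $$R_0=\sum_{j=1}^2m^0_{3j}\xi_j,\quad R_1=\sum_{j=1}^2m^1_{3j}\xi_j,\quad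 \Delta_0=k(iR_0+\mu_+m^0_{33})-(iR_0+\lambda_+m^0_{33}).$$ (i) For $L=1$: $$f^1_{0,1}=-A_1+A_2,\quad f^1_{0,2}=B_1+B_2,\quad f^1_{0,3}=f^1_{0,4}=A_1,\quad f^1_{0,5}=A_2,\quad f^1_{0,6}=B_2,\quad f^1_{0,7}=f^1_{0,8}=B_1,$$ where $$A_1=\frac{\mathcal J^{-1}(y)}{m^1_{33}(\lambda_+-\lambda_-)},\qquad B_1=\frac{\mathcal J^{-1}(y)}{k\,m^1_{33}(\mu_+-\mu_-)},$$ $$A_2=\Delta_0^{-1}(\lambda_--\lambda_+)m^0_{33}A_1,\qquad B_2=\Delta_0^{-1}\big\{(iR_0+\lambda_+m^0_{33})-k(iR_0+\mu_-m^0_{33})\big\}B_1.$$ (ii) For $L+1$ with $L\ge1$: $f^{L+1}_{l,j}=F_{l,j}$ for $1\le l\le 2L$, $1\le j\le 8$, where (with $E_{l,j}$, $\beta_j$, $\gamma_j$ as in the context) $$F_{2L,j}=\frac{E_{2L-1,j}}{4L\gamma_j(\beta_jm^1_{33}+iR_1)},\qquad F_{l+1,j}=\frac{E_{l,j}-(l+2)(l+1)\gamma_jm^1_{33}F_{l+2,j}}{2(l+1)\gamma_j(\beta_jm^1_{33}+iR_1)}\quad(0\le l\le 2L-2),$$ and $$f^{L+1}_{0,3}=f^{L+1}_{0,4}=C_3:=\frac{F_{1,3}-F_{1,4}}{\lambda_+-\lambda_-},\qquad f^{L+1}_{0,7}=f^{L+1}_{0,8}=C_9:=\frac{F_{1,7}-F_{1,8}}{\mu_+-\mu_-},$$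 $$f^{L+1}_{0,1}=A_5+A_7,\qquad f^{L+1}_{0,2}=B_5+B_7,\qquad f^{L+1}_{0,5}=A_7,\qquad f^{L+1}_{0,6}=B_7,$$ where $A_5=A_3-C_3$, $B_5=B_3+C_9$, $$A_7=\Delta_0^{-1}\{(iR_0+\lambda_+m^0_{33})A_5-A_6\},\qquad B_7=\Delta_0^{-1}\{(iR_0+\lambda_+m^0_{33})B_5-B_6\},$$ $$A_6=A_4-(iR_0+\lambda_-m^0_{33})C_3,\qquad B_6=B_4+k(iR_0+\mu_-m^0_{33})C_9,$$ and, with all sums over $l=1,\dots,2L$, $$A_3=-\sum_l(F_{l,1}+F_{l,3}-F_{l,5})(-y_3)^l,\qquad B_3=-\sum_l(F_{l,2}-F_{l,6}-F_{l,7})(-y_3)^l,$$ $$A_4=-iR_0\sum_l(F_{l,1}+F_{l,3})(-y_3)^l-m^0_{33}\sum_l\big[l(F_{l,1}+F_{l,3})(-y_3)^{l-1}+(\lambda_+F_{l,1}+\lambda_-F_{l,3})(-y_3)^l\big]+ikR_0\sum_lF_{l,5}(-y_3)^l+km^0_{33}\sum_l\big[lF_{l,5}(-y_3)^{l-1}+\mu_+F_{l,5}(-y_3)^l\big],$$ $$B_4=-iR_0\sum_lF_{l,2}(-y_3)^l-m^0_{33}\sum_l\big[lF_{l,2}(-y_3)^{l-1}+\lambda_+F_{l,2}(-y_3)^l\big]+ikR_0\sum_l(F_{l,6}+F_{l,7})(-y_3)^l+km^0_{33}\sum_l\big[l(F_{l,6}+F_{l,7})(-y_3)^{l-1}+(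\mu_+F_{l,6}+\mu_-F_{l,7})(-y_3)^l\big].$$
   Context: Setting. $k>1$ is a constant. $M=(m_{jl})_{3\times3}$ is a smooth real symmetric, uniformly positive definite matrix function and $\mathcal J$ a smooth positive function on $\overline{\mathbb R^3_-}$, where $\mathbb R^3_-=\{x_3<0\}$. (They come from flattening a smooth boundary by a local diffeomorphism with Jacobian $J$: $M=JJ^T$, and $\mathcal J$ is the Jacobian determinant of the inverse map.) Write $x=(x',x_3)$, $x'=(x_1,x_2)$, and $y=(y',y_3)\in\mathbb R^3_-$ with $y_3$ near $0$; $\xi'=(\xi_1,\xi_2)\in\mathbb R^2$; $s\in(0,T)$; $\tau\in\mathbb C$ is the Laplace variable, ranging over a sector $\Sigma(\xi')=\{\sigma+re^{i\theta}:r>0,\ \theta_1<\theta<\theta_2\}$, with constants possibly depending on $\xi'$, on which the square roots defining $\lambda_\pm,\mu_\pm$ can be chosen with positive real part and $\Delta_0\neq0$. $e_3=(0,0,1)$, $D=-i\nabla=(D_{x'},D_3)$. Let $$\mathcal P=\tau-\mathcal J^{-1}\nabla\cdot(\mathcal JM\nabla),\qquad \mathcal Q=\tau-k\mathcal J^{-1}\nabla\cdot(\mathcal JM\nabla).$$ With $W=(w_1,w_2,w_3)^T=\mathcal J^{-1}M\nabla\mathcal J$, write $\mathcal P=p_2+p_1$, where (replacing $D_{x'}$ by $\xi'$ and keeping $D_3$ as an operator) $$p_2=m_{33}D_3^2+2\sum_{j=1}^2m_{3j}\xi_jD_3+\sum_{j,l=1}^2m_{jl}\xi_j\xi_l+\tau,$$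 $$p_1=-\Big(i\sum_{j=1}^3\partial_{x_j}m_{j3}+iw_3\Big)D_3-\Big(i\sum_{j=1}^3\sum_{l=1}^2\partial_{x_j}m_{jl}\,\xi_l+i\sum_{j=1}^2w_j\xi_j\Big).$$ Similarly $\mathcal Q=q_2+q_1$ with $q_2=k(p_2-\tau)+\tau$, $q_1=kp_1$. For $r=1,2$, $n\in\mathbb Z_+=\{0,1,2,\dots\}$, $\alpha\in\mathbb Z_+^2$, let $p^{(\alpha)}_{r,n}$ (resp. $q^{(\alpha)}_{r,n}$) be the operator in $x_3$ obtained by applying $\partial_{x_3}^n\partial_{\xi'}^\alpha$ to the coefficients of $p_r$ (resp. $q_r$) and evaluating them at $x_3=y_3$. Amplitudes. $\mathbf a_\ell,\mathbf b_\ell$ are the amplitudes, in $G_\ell^\pm(x,y)=(2\pi)^{-2}\int_{\mathbb R^2}e^{ix'\cdot\xi'}(\cdot)\,d\xi'$, of the Schwartz kernels $G^+_\ell$ (for $y_3<x_3\le 0$) and $G^-_\ell$ (for $x_3<y_3$). Likewise $\mathbf d_\ell,\mathbf e_\ell$ are the amplitudes of $H^+_\ell$ and $H^-_\ell$. Formally these kernels solve $\mathcal PG_\ell=(2-\ell)e^{-\tau s}\mathcal J^{-1}(y)\delta(x-y)$, $\mathcal QH_\ell=(\ell-1)e^{-\tau s}\mathcal J^{-1}(y)\delta(x-y)$ in $\mathbb R^3_-$, with $G_\ell=H_\ell$ and $e_3\cdot M\nabla G_\ell=ke_3\cdot M\nabla H_\ell$ on $x_3=0$. Hierarchy (H). The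 formal series are required to satisfy, for every $L\ge0$, the following. For $\mathbf m_\ell\in\{\mathbf a_\ell,\mathbf b_\ell\}$, $$p^{(0)}_{2,0}\mathbf m_{\ell,-1-L}=-\Theta_L(\mathbf m_\ell),$$ $$\Theta_L(\mathbf m_\ell)=\sum_{\substack{n+h+|\alpha|=L\\ h\le L-1}}\frac{(x_3-y_3)^n}{\alpha!\,n!}p^{(\alpha)}_{2,n}D_{x'}^\alpha\mathbf m_{\ell,-1-h}+\sum_{n+h+|\alpha|=L-1}\frac{(x_3-y_3)^n}{\alpha!\,n!}p^{(\alpha)}_{1,n}D_{x'}^\alpha\mathbf m_{\ell,-1-h}$$ ($n,h\in\mathbb Z_+$, $\alpha\in\mathbb Z_+^2$; empty sums are $0$). For $\mathbf m_\ell\in\{\mathbf d_\ell,\mathbf e_\ell\}$ the same holds with $p$ replaced by $q$. Moreover $\mathbf b_{\ell,-1-L},\mathbf e_{\ell,-1-L}\to0$ as $x_3\to-\infty$. On $x_3=y_3$, $$\mathbf a_{\ell,-1-L}=\mathbf b_{\ell,-1-L},\qquad \mathbf d_{\ell,-1-L}=\mathbf e_{\ell,-1-L},$$ $$ie_3\cdot M^1\begin{pmatrix}\xi'\\ D_3\end{pmatrix}(\mathbf a_{\ell,-1-L}-\mathbf b_{\ell,-1-L})=-\kappa_L(2-\ell)\mathcal J^{-1}(y)e^{-\tau s-iy'\cdot\xi'},$$ $$ike_3\cdot M^1\begin{pmatrix}\xi'\\ D_3\end{pmatrix}(\mathbf d_{\ell,-1-L}-\mathbf e_{\ell,-1-L})=-\kappa_L(\ell-1)\mathcal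 J^{-1}(y)e^{-\tau s-iy'\cdot\xi'},$$ with $\kappa_0=1$ and $\kappa_L=0$ for $L\ge1$. On $x_3=0$, $$\mathbf a_{\ell,-1-L}=\mathbf d_{\ell,-1-L},\qquad ie_3\cdot M^0\begin{pmatrix}\xi'\\ D_3\end{pmatrix}\mathbf a_{\ell,-1-L}=ike_3\cdot M^0\begin{pmatrix}\xi'\\ D_3\end{pmatrix}\mathbf d_{\ell,-1-L}.$$ Coefficients in (ii). Index the exponentials by $j=1,\dots,8$ with $(\beta_1,\dots,\beta_8)=(\lambda_+,\lambda_+,\lambda_-,\lambda_+,\mu_+,\mu_+,\mu_-,\mu_+)$, $(\delta_1,\dots,\delta_8)=(\lambda_-,\mu_-,\lambda_-,\lambda_+,\lambda_-,\mu_-,\mu_-,\mu_+)$, $\alpha_j=2-\ell$ for $j=1,3,4,5$, $\alpha_j=\ell-1$ for $j=2,6,7,8$, $\gamma_j=1$ for $j\le4$ and $\gamma_j=k$ for $j\ge5$. For $L\ge1$ the $E_{l,j}$ (depending on $L$, independent of $x_3$) are the coefficients in $$\Theta_L(\mathbf m_\ell)=\sum_{j\in S(\mathbf m)}\alpha_j\sum_{l=0}^{2L-1}E_{l,j}(x_3-y_3)^l\exp(\beta_jx_3-\delta_jy_3-\tau s-iy'\cdot\xi'),$$ where $S(\mathbf a)=\{1,2,3\}$, $S(\mathbf b)=\{1,2,4\}$, $S(\mathbf d)=\{5,6,7\}$, $S(\mathbf e)=\{5,6,8\}$. Order. Let $\langle\xi',\tau\rangle^2=1+|\xi'|^2+|\tau|$.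 A symbol $\mathbf a(x',\xi',\tau)$ (smooth, possibly depending on the parameters $x_3,y,s$) is of order $m$ if $|D_{x'}^\alpha D_{\xi'}^\beta\mathbf a|\le C_{\alpha,\beta}\langle\xi',\tau\rangle^{m-|\beta|}$ for all multi-indices $\alpha,\beta\in\mathbb Z_+^2$, $x',\xi'\in\mathbb R^2$, $\tau\in\Sigma(\xi')$, $|\tau|>1$, uniformly in the parameters. The order ''ord'' of expressions is counted by the following convention: multiplications by $\xi_1,\xi_2,\tau^{1/2}$ and the operator $D_3$ have order $1$; multiplication by $x_3-y_3$ (hence also by $-y_3$, its value at $x_3=0$) has order $-1$; $D_{x'}$ has order $0$. This convention reflects that the factors multiply exponentials bounded by $e^{-\delta\langle\xi',\tau\rangle|x_3-y_3|}$ (and, for terms arising from the boundary, decaying also in $|y_3|$). *)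

(* Defs.v *)
(* Matrix entries, components and coordinate directions are numbered 1, 2, 3
   as in the usual notation; other indices never matter. *)
From Stdlib Require Import Reals ZArith List.
From Coquelicot Require Import Coquelicot.
Import ListNotations.

Definition R2 : Type := (R * R)%type.

Definition co (v : R2) (j : nat) : R :=
  match j with 1%nat => fst v | _ => snd v end.

Definition Cexp (z : C) : C :=
  (exp (Re z) * cos (Im z), exp (Re z) * sin (Im z))%R.

(* On the plane cut along (-oo, 0] this is the square root with positive real
   part: if w = u + iv, w^2 = z and u > 0, then 2u^2 = |z| + Re z and
   2uv = Im z.  It is only used there. *)
Definition csqrt (z : C) : C :=
  let u := sqrt ((Cmod z + Re z) / 2) in (u, Im z / (2 * u))%R.

Definition CDerive_n (f : R -> C) (n : nat) (t : R) : C :=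
  (Derive_n (fun u => Re (f u)) n t, Derive_n (fun u => Im (f u)) n t).

Definition line (i : nat) (g : R2 -> R -> R) (x : R2) (x3 : R) : R -> R :=
  match i with
  | 1%nat => fun t => g (t, snd x) x3
  | 2%nat => fun t => g (fst x, t) x3
  | _ => fun t => g x t
  end.

Definition pt (i : nat) (x : R2) (x3 : R) : R :=
  match i with 1%nat => fst x | 2%nat => snd x | _ => x3 end.

Definition pd (i : nat) (g : R2 -> R -> R) (x : R2) (x3 : R) : R :=
  Derive (line i g x x3) (pt i x x3).

Definition pds (w : list nat) (g : R2 -> R -> R) : R2 -> R -> R :=
  fold_right pd g w.

Definition smooth (g : R2 -> R -> R) : Prop :=
  forall (w : list nat) (x : R2) (x3 : R),
    continuous (fun p : R2 * R => pds w g (fst p) (snd p)) (x, x3) /\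
    forall i : nat, ex_derive (line i (pds w g) x x3) (pt i x x3).

(* Smooth up to the boundary of the half space x_3 <= 0. *)
Definition smooth_closed (g : R2 -> R -> R) : Prop :=
  exists G, smooth G /\ forall x x3, (x3 <= 0)%R -> G x x3 = g x x3.

Definition Csmooth (u : R2 -> R -> C) : Prop :=
  smooth (fun x x3 => Re (u x x3)) /\ smooth (fun x x3 => Im (u x x3)).

(* [mm D j l] and [JJ D] are the entries of M and the function J of the
   coordinate change; only their values on x_3 <= 0 matter. *)
Record medium := Medium {
  kk : R;
  mm : nat -> nat -> R2 -> R -> R;
  JJ : R2 -> R -> R
}.

Definition admissible (D : medium) : Prop :=
  (1 < kk D)%R /\
  (forall j l, (1 <= j <= 3)%nat -> (1 <= l <= 3)%nat ->
     smooth_closed (mm D j l) /\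
     forall x x3, (x3 <= 0)%R -> mm D j l x x3 = mm D l j x x3) /\
  (exists c, (0 < c)%R /\
     forall x x3, (x3 <= 0)%R -> forall v : nat -> R,
       (c * sum_n_m (fun j => v j ^ 2) 1 3 <=
        sum_n_m (fun j =>
          sum_n_m (fun l => mm D j l x x3 * v j * v l) 1 3) 1 3)%R) /\
  smooth_closed (JJ D) /\
  (forall x x3, (x3 <= 0)%R -> (0 < JJ D x x3)%R).

(* The components of J^{-1} M grad J *)
Definition ww (D : medium) (j : nat) (x : R2) (x3 : R) : R :=
  (/ JJ D x x3 * sum_n_m (fun l => mm D j l x x3 * pd l (JJ D) x x3) 1 3)%R.

(* The arguments of the amplitudes other than x, s and l: the medium,
   y = (ypr, y3), xi' and tau. *)
Record par := Par {
  med : medium;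
  ypr : R2;
  y3 : R;
  xi : R2;
  tau : C
}.

Definition symbol : Type := par -> R2 -> C.

Definition m0 (j l : nat) : symbol := fun q x => RtoC (mm (med q) j l x 0).
Definition m1 (j l : nat) : symbol := fun q x => RtoC (mm (med q) j l x (y3 q)).

Local Open Scope C_scope.

Definition xij (q : par) (j : nat) : C := RtoC (co (xi q) j).

Definition invJy (q : par) : C := / RtoC (JJ (med q) (ypr q) (y3 q)).

Definition R0 : symbol := fun q x => sum_n_m (fun j => m0 3 j q x * xij q j) 1 2.
Definition R1 : symbol := fun q x => sum_n_m (fun j => m1 3 j q x * xij q j) 1 2.

Definition radicand (t : C) : symbol := fun q x =>
  m1 3 3 q x *
    (sum_n_m (fun j => sum_n_m (fun l => m1 j l q x * xij q j * xij q l) 1 2) 1 2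
     + t)
  - R1 q x ^ 2.

Definition lamp : symbol := fun q x =>
  / m1 3 3 q x * (- (Ci * R1 q x) + csqrt (radicand (tau q) q x)).
Definition lamm : symbol := fun q x =>
  / m1 3 3 q x * (- (Ci * R1 q x) - csqrt (radicand (tau q) q x)).
Definition mup : symbol := fun q x =>
  / m1 3 3 q x * (- (Ci * R1 q x) + csqrt (radicand (tau q / kk (med q)) q x)).
Definition mum : symbol := fun q x =>
  / m1 3 3 q x * (- (Ci * R1 q x) - csqrt (radicand (tau q / kk (med q)) q x)).

Definition Delta0 : symbol := fun q x =>
  kk (med q) * (Ci * R0 q x + mup q x * m0 3 3 q x)
  - (Ci * R0 q x + lamp q x * m0 3 3 q x).

Definition in_sector (sigma th1 th2 : R) (t : C) : Prop :=
  exists r th : R, (0 < r)%R /\ (th1 < th < th2)%R /\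
    t = (sigma + r * cos th, r * sin th)%R.

Definition has_root_pos (z : C) : Prop := exists w : C, (0 < Re w)%R /\ w * w = z.

(* The vertex and the opening of the sector may depend on xi'; "y_3 near 0"
   is -eps < y_3 < 0. *)
Definition sector_ok (D : medium) (eps : R) (sigma th1 th2 : R2 -> R) : Prop :=
  forall q, med q = D -> (- eps < y3 q < 0)%R ->
    in_sector (sigma (xi q)) (th1 (xi q)) (th2 (xi q)) (tau q) ->
    forall x,
      has_root_pos (radicand (tau q) q x) /\
      has_root_pos (radicand (tau q / kk (med q)) q x) /\
      Delta0 q x <> 0.

(* A differential operator in x_3 with parameters: [c i x x3 xi] is the
   coefficient of D_3^i, i = 0, 1, 2. *)
Definition oper : Type := nat -> R2 -> R -> R2 -> C.

Definition p2 (D : medium) (t : C) : oper := fun i x x3 xi =>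
  match i with
  | 0%nat =>
      sum_n_m (fun j => sum_n_m (fun l =>
        RtoC (mm D j l x x3 * co xi j * co xi l)) 1 2) 1 2 + t
  | 1%nat => 2 * sum_n_m (fun j => RtoC (mm D 3 j x x3 * co xi j)) 1 2
  | 2%nat => RtoC (mm D 3 3 x x3)
  | _ => 0
  end.

Definition p1 (D : medium) : oper := fun i x x3 xi =>
  match i with
  | 0%nat =>
      - (Ci * sum_n_m (fun j => sum_n_m (fun l =>
           RtoC (pd j (mm D j l) x x3 * co xi l)) 1 2) 1 3
         + Ci * sum_n_m (fun j => RtoC (ww D j x x3 * co xi j)) 1 2)
  | 1%nat =>
      - (Ci * sum_n_m (fun j => RtoC (pd j (mm D j 3) x x3)) 1 3
         + Ci * RtoC (ww D 3 x x3))
  | _ => 0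
  end.

Definition q2 (D : medium) (t : C) : oper := fun i x x3 xi =>
  match i with
  | 0%nat => kk D * (p2 D t 0%nat x x3 xi - t) + t
  | _ => kk D * p2 D t i x x3 xi
  end.

Definition q1 (D : medium) : oper := fun i x x3 xi => kk D * p1 D i x x3 xi.

Definition D3 (i : nat) (u : R2 -> R -> C) (x : R2) (x3 : R) : C :=
  (- Ci) ^ i * CDerive_n (fun t => u x t) i x3.

Definition Dx (a1 a2 : nat) (u : R2 -> R -> C) (x : R2) (x3 : R) : C :=
  (- Ci) ^ (a1 + a2) *
  CDerive_n (fun t1 => CDerive_n (fun t2 => u (t1, t2) x3) a2 (snd x)) a1 (fst x).

(* p^{(alpha)}_n u, where d_{x_3}^n d_{xi'}^alpha falls on the coefficients of
   the operator, which are then evaluated at x_3 = y_3. *)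
Definition frozen (c : oper) (n a1 a2 : nat) (q : par)
    (u : R2 -> R -> C) (x : R2) (x3 : R) : C :=
  sum_n (fun i =>
    CDerive_n (fun t =>
      CDerive_n (fun u1 =>
        CDerive_n (fun u2 => c i x t (u1, u2)) a2 (snd (xi q))) a1 (fst (xi q)))
      n (y3 q)
    * D3 i u x x3) 2.

(* The sum over n + |alpha| = N of
   (x_3 - y_3)^n / (alpha! n!) p^{(alpha)}_n D_{x'}^alpha u. *)
Definition taylor (c : oper) (N : nat) (q : par)
    (u : R2 -> R -> C) (x : R2) (x3 : R) : C :=
  sum_n (fun a1 => sum_n (fun a2 =>
    let n := (N - a1 - a2)%nat in
    RtoC ((x3 - y3 q) ^ n / (INR (fact a1) * INR (fact a2) * INR (fact n)))
    * frozen c n a1 a2 q (Dx a1 a2 u) x x3) (N - a1)) N.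

(* A formal series m_{-1} + m_{-2} + ... is the family of its terms, with
   [m N] standing for m_{-N}, N >= 1; [m 0] is not used. *)
Definition series : Type := nat -> R2 -> R -> C.

(* Theta_L.  With N = 1 + h, the condition h <= L-1 is 1 <= N <= L in both sums
   (in the second one it is implied), and n + |alpha| is L + 1 - N in the first
   sum and L - N in the second. *)
Definition Theta (c2 c1 : oper) (q : par) (L : nat) (m : series)
    (x : R2) (x3 : R) : C :=
  sum_n_m (fun N => taylor c2 (L + 1 - N) q (m N) x x3) 1 L
  + sum_n_m (fun N => taylor c1 (L - N) q (m N) x x3) 1 L.

(* i e_3 . M|_{x_3 = t} (xi', D_3) u *)
Definition flux (t : R) (q : par) (u : R2 -> R -> C) (x : R2) (x3 : R) : C :=
  Ci * (sum_n_m (fun j => RtoC (mm (med q) 3 j x t) * xij q j) 1 2 * u x x3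
        + RtoC (mm (med q) 3 3 x t) * D3 1 u x x3).

Definition source (q : par) (s : R) : C :=
  invJy q * Cexp (- (tau q * s)
                  - Ci * sum_n_m (fun j => co (ypr q) j * xij q j) 1 2).

(* The terms are smooth functions on all of R^3; they are constrained only for
   y_3 <= x_3 <= 0 (a and d) and for x_3 <= y_3 (b and e). *)
Definition hierarchy (q : par) (ell : nat) (s : R) (a b d e : series) : Prop :=
  let k := RtoC (kk (med q)) in
  forall L : nat,
  let N := S L in
  let kappa := RtoC (if Nat.eqb L 0 then 1 else 0) in
  (Csmooth (a N) /\ Csmooth (b N) /\ Csmooth (d N) /\ Csmooth (e N)) /\
  (forall x x3, (y3 q < x3 < 0)%R ->
     frozen (p2 (med q) (tau q)) 0 0 0 q (a N) x x3
       = - Theta (p2 (med q) (tau q)) (p1 (med q)) q L a x x3 /\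
     frozen (q2 (med q) (tau q)) 0 0 0 q (d N) x x3
       = - Theta (q2 (med q) (tau q)) (q1 (med q)) q L d x x3) /\
  (forall x x3, (x3 < y3 q)%R ->
     frozen (p2 (med q) (tau q)) 0 0 0 q (b N) x x3
       = - Theta (p2 (med q) (tau q)) (p1 (med q)) q L b x x3 /\
     frozen (q2 (med q) (tau q)) 0 0 0 q (e N) x x3
       = - Theta (q2 (med q) (tau q)) (q1 (med q)) q L e x x3) /\
  (forall x,
     filterlim (b N x) (Rbar_locally m_infty) (locally (RtoC 0)) /\
     filterlim (e N x) (Rbar_locally m_infty) (locally (RtoC 0))) /\
  (forall x,
     a N x (y3 q) = b N x (y3 q) /\
     d N x (y3 q) = e N x (y3 q) /\
     flux (y3 q) q (fun x x3 => a N x x3 - b N x x3) x (y3 q)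
       = - (kappa * (2 - INR ell) * source q s) /\
     k * flux (y3 q) q (fun x x3 => d N x x3 - e N x x3) x (y3 q)
       = - (kappa * (INR ell - 1) * source q s)) /\
  (forall x,
     a N x 0 = d N x 0 /\
     flux 0 q (a N) x 0 = k * flux 0 q (d N) x 0).

Definition expo (beta delta : symbol) (q : par) (s : R) (x : R2) (x3 : R) : C :=
  Cexp (beta q x * x3 - delta q x * y3 q - tau q * s
        - Ci * sum_n_m (fun j => co (ypr q) j * xij q j) 1 2).

Definition beta_ (j : nat) : symbol :=
  match j with
  | 1%nat | 2%nat | 4%nat => lamp
  | 3%nat => lamm
  | 7%nat => mum
  | _ => mup
  end.

Definition delta_ (j : nat) : symbol :=
  match j with
  | 1%nat | 3%nat | 5%nat => lamm
  | 2%nat | 6%nat | 7%nat => mum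
  | 4%nat => lamp
  | _ => mup
  end.

Definition alpha_ (ell j : nat) : C :=
  match j with
  | 1%nat | 3%nat | 4%nat | 5%nat => 2 - INR ell
  | _ => INR ell - 1
  end.

Definition gamma_ (D : medium) (j : nat) : C :=
  if Nat.leb j 4 then 1 else RtoC (kk D).

Definition Sa : list nat := [1; 2; 3]%nat.
Definition Sb : list nat := [1; 2; 4]%nat.
Definition Sd : list nat := [5; 6; 7]%nat.
Definition Se : list nat := [5; 6; 8]%nat.

(* sum over j in S of
   alpha_j sum_{l <= N} c_{l,j} (x_3 - y_3)^l E(beta_j, delta_j) *)
Definition expansion (S : list nat) (N : nat) (c : nat -> nat -> R2 -> C)
    (q : par) (ell : nat) (s : R) (x : R2) (x3 : R) : C :=
  fold_right Cplus 0
    (map (fun j =>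
       alpha_ ell j
       * sum_n (fun l => c l j x * RtoC ((x3 - y3 q) ^ l)
                         * expo (beta_ j) (delta_ j) q s x x3) N) S).

(* The series with the terms of the theorem, built from f^L_{l,j} = f L l j. *)
Definition ansatz (S : list nat) (f : nat -> nat -> nat -> symbol)
    (q : par) (ell : nat) (s : R) : series := fun L =>
  expansion S (2 * L - 2) (fun l j => f L l j q) q ell s.

(* f l j stands for f^1_{l,j} *)
Definition first_coefficients (q : par) (x : R2) (f : nat -> nat -> C) : Prop :=
  let k := RtoC (kk (med q)) in
  let r0 := Ci * R0 q x in
  let m033 := m0 3 3 q x in
  let lp := lamp q x in let lm := lamm q x in
  let mp := mup q x in let mn := mum q x in
  let A1 := invJy q / (m1 3 3 q x * (lp - lm)) in
  let B1 := invJy q / (k * m1 3 3 q x * (mp - mn)) in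
  let A2 := / Delta0 q x * (lm - lp) * m033 * A1 in
  let B2 := / Delta0 q x * ((r0 + lp * m033) - k * (r0 + mn * m033)) * B1 in
  f 0%nat 1%nat = - A1 + A2 /\
  f 0%nat 2%nat = B1 + B2 /\
  f 0%nat 3%nat = A1 /\
  f 0%nat 4%nat = A1 /\
  f 0%nat 5%nat = A2 /\
  f 0%nat 6%nat = B2 /\
  f 0%nat 7%nat = B1 /\
  f 0%nat 8%nat = B1.

(* F l j stands for f^{L+1}_{l,j}, which is F_{l,j} when l >= 1, and E l j for
   the coefficients of Theta_L. *)
Definition next_coefficients (q : par) (x : R2) (L : nat)
    (E F : nat -> nat -> C) : Prop :=
  let k := RtoC (kk (med q)) in
  let r0 := Ci * R0 q x in
  let r1 := Ci * R1 q x in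
  let m033 := m0 3 3 q x in
  let m133 := m1 3 3 q x in
  let lp := lamp q x in let lm := lamm q x in
  let mp := mup q x in let mn := mum q x in
  let g := gamma_ (med q) in
  let sum := fun h : nat -> C => sum_n_m h 1 (2 * L) in
  let Y := fun l : nat => RtoC ((- y3 q) ^ l) in
  (forall j, (1 <= j <= 8)%nat ->
     F (2 * L)%nat j
       = E (2 * L - 1)%nat j
         / (4 * INR L * g j * (beta_ j q x * m133 + r1))) /\
  (forall l j, (l <= 2 * L - 2)%nat -> (1 <= j <= 8)%nat ->
     F (l + 1)%nat j
       = (E l j - INR (l + 2) * INR (l + 1) * g j * m133 * F (l + 2)%nat j)
         / (2 * INR (l + 1) * g j * (beta_ j q x * m133 + r1))) /\
  let C3 := (F 1%nat 3%nat - F 1%nat 4%nat) / (lp - lm) in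
  let C9 := (F 1%nat 7%nat - F 1%nat 8%nat) / (mp - mn) in
  let A3 := - sum (fun l => (F l 1%nat + F l 3%nat - F l 5%nat) * Y l) in
  let B3 := - sum (fun l => (F l 2%nat - F l 6%nat - F l 7%nat) * Y l) in
  let A4 :=
    - (r0 * sum (fun l => (F l 1%nat + F l 3%nat) * Y l))
    - m033 * sum (fun l =>
        INR l * (F l 1%nat + F l 3%nat) * Y (l - 1)%nat
        + (lp * F l 1%nat + lm * F l 3%nat) * Y l)
    + k * r0 * sum (fun l => F l 5%nat * Y l)
    + k * m033 * sum (fun l =>
        INR l * F l 5%nat * Y (l - 1)%nat + mp * F l 5%nat * Y l) in
  let B4 :=
    - (r0 * sum (fun l => F l 2%nat * Y l))
    - m033 * sum (fun l =>
        INR l * F l 2%nat * Y (l - 1)%nat + lp * F l 2%nat * Y l)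
    + k * r0 * sum (fun l => (F l 6%nat + F l 7%nat) * Y l)
    + k * m033 * sum (fun l =>
        INR l * (F l 6%nat + F l 7%nat) * Y (l - 1)%nat
        + (mp * F l 6%nat + mn * F l 7%nat) * Y l) in
  let A5 := A3 - C3 in
  let B5 := B3 + C9 in
  let A6 := A4 - (r0 + lm * m033) * C3 in
  let B6 := B4 + k * (r0 + mn * m033) * C9 in
  let A7 := / Delta0 q x * ((r0 + lp * m033) * A5 - A6) in
  let B7 := / Delta0 q x * ((r0 + lp * m033) * B5 - B6) in
  F 0%nat 1%nat = A5 + A7 /\
  F 0%nat 2%nat = B5 + B7 /\
  F 0%nat 3%nat = C3 /\
  F 0%nat 4%nat = C3 /\
  F 0%nat 5%nat = A7 /\
  F 0%nat 6%nat = B7 /\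
  F 0%nat 7%nat = C9 /\
  F 0%nat 8%nat = C9.

(* The order is a count on expressions, not an intrinsic property of the
   functions they denote: -y_3 counts as -1 although it is a smooth function
   of the parameters.  Expressions are built from the coefficients of the
   problem (order 0), xi_j, tau and -y_3.  The operator D_3 and the factor
   x_3 - y_3 do not appear because x_3 does not. *)
Inductive expr : Type :=
  | Ecst (c : C)
  | Ek
  | EinvJ                              (* J^{-1}(y) *)
  | Em0 (j l : nat)                    (* m_{jl} at x_3 = 0 *)
  | Em1 (w : list nat) (j l : nat)     (* d^w m_{jl} at x_3 = y_3 *)
  | Ew1 (w : list nat) (j : nat)       (* d^w w_j at x_3 = y_3 *)
  | Exi (j : nat)
  | Etau
  | Emy3                               (* - y_3 *)
  | Eadd (e1 e2 : expr)
  | Emul (e1 e2 : expr)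
  | Einv (e : expr)
  | Esqrt (e : expr)
  | EDx (a1 a2 : nat) (e : expr).      (* D_{x'}^{(a1, a2)} *)

Fixpoint eval (e : expr) : symbol := fun q x =>
  match e with
  | Ecst c => c
  | Ek => RtoC (kk (med q))
  | EinvJ => invJy q
  | Em0 j l => m0 j l q x
  | Em1 w j l => RtoC (pds w (mm (med q) j l) x (y3 q))
  | Ew1 w j => RtoC (pds w (ww (med q) j) x (y3 q))
  | Exi j => xij q j
  | Etau => tau q
  | Emy3 => RtoC (- y3 q)
  | Eadd e1 e2 => eval e1 q x + eval e2 q x
  | Emul e1 e2 => eval e1 q x * eval e2 q x
  | Einv e1 => / eval e1 q x
  | Esqrt e1 => csqrt (eval e1 q x)
  | EDx a1 a2 e1 => Dx a1 a2 (fun x' _ => eval e1 q x') x 0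
  end.

(* tau has order 2, so that tau^{1/2} has order 1. *)
Inductive has_ord : expr -> Z -> Prop :=
  | ord_cst c : has_ord (Ecst c) 0
  | ord_k : has_ord Ek 0
  | ord_invJ : has_ord EinvJ 0
  | ord_m0 j l : has_ord (Em0 j l) 0
  | ord_m1 w j l : has_ord (Em1 w j l) 0
  | ord_w1 w j : has_ord (Ew1 w j) 0
  | ord_xi j : has_ord (Exi j) 1
  | ord_tau : has_ord Etau 2
  | ord_my3 : has_ord Emy3 (-1)
  | ord_add e1 e2 m : has_ord e1 m -> has_ord e2 m -> has_ord (Eadd e1 e2) m
  | ord_mul e1 e2 m n :
      has_ord e1 m -> has_ord e2 n -> has_ord (Emul e1 e2) (m + n)
  | ord_inv e m : has_ord e m -> has_ord (Einv e) (- m)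
  | ord_sqrt e m : has_ord e (2 * m) -> has_ord (Esqrt e) m
  | ord_Dx a1 a2 e m : has_ord e m -> has_ord (EDx a1 a2 e) m.

(* The expression is the same for all media.  For one particular medium a
   coefficient may happen to coincide with a term of another order (for
   instance m_{33} - 1 = - x_3), and the count would lose its meaning. *)
Definition of_order (f : symbol) (m : Z) : Prop :=
  exists e, has_ord e m /\ forall q x, f q x = eval e q x.

(* Main.v *)
From Stdlib Require Import Reals ZArith List Lra Lia FunctionalExtensionality.
From Coquelicot Require Import Coquelicot.
Require Import Defs.
Import ListNotations.
Local Open Scope C_scope.

(** The equations of the hierarchy are ordinary differential equations in x_3,
    with parameters x', xi', tau. Frozen at x_3 = y_3, p_2 and q_2 have constant
    coefficients; their characteristic roots are lambda_+- and mu_+-, with real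
    parts of opposite signs because the square roots have positive real part.
    Hence the solutions are polynomials in z = x_3 - y_3 times exponentials, and
    everything can be computed on the coefficients of the polynomials.

    Existence. A sum of terms c_l z^l exp(beta x_3 - delta y_3 - ..) is mapped to
    a sum of the same kind by d/dx_3 ([cpd3_expansion]), by d/dx_i
    ([cpd_expansion], where beta x_3 - delta y_3 contributes one power of z and a
    factor y_3) and by multiplication by z. So Theta_L of the first L amplitudes
    has coefficients E_l of degree at most 2L - 1 ([Theta_expansion],
    [degree_theta]). Since beta is a characteristic root, p_2 lowers the degree in
    z, and p_2 m = - Theta_L becomes the descending recursion for F_l, l >= 1
    ([frozen_coef_gamma], [descent_solves]). The coefficients l = 0 are those of
    the homogeneous solutions; the transmission conditions at x_3 = y_3 fix the
    ones of lambda_- and mu_- in the layer ([amp_coef_jump_lam],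
    [amp_coef_jump_mu]), and those at x_3 = 0 leave a linear system with
    determinant Delta_0 ([matched_first], [matched_next]). Decay holds because
    only lambda_+ and mu_+ occur below y_3.

    Orders. The coefficients are built by sums, products, quotients, square roots
    and derivatives in x' from symbols whose order is known, and every operation
    of the recursion respects the count: d/dx_3 adds 1, z^n subtracts n, D_{x'} is
    neutral because a derivative of beta, of order 1, always comes with z or y_3
    ([order_theta], [order_next]). All these operations are explicit, so that one
    expression serves all media; smoothness in x' is proved separately, for
    admissible media only.

    Uniqueness. By induction on L two solutions have the same source Theta_L, so
    their difference solves the homogeneous problem. It factors as
    (d - lambda_+)(d - lambda_-) u = 0, so (u' - mu u) exp(- lambda x_3) is
    constant when lambda and mu are the two roots. Decay, then the conditions at
    y_3, then those at 0 and Delta_0 <> 0 remove every component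
    ([homogeneous_zero]). *)

(** * Smooth functions on a slab *)

(** The notion is relative to a slab x_3 in P because the functions w_j contain
    1 / J, which is controlled for x_3 <= 0 only. *)
Definition smooth_on (P : R -> Prop) (g : R2 -> R -> R) : Prop :=
  forall (w : list nat) (x : R2) (x3 : R), P x3 ->
    continuous (fun p : R2 * R => pds w g (fst p) (snd p)) (x, x3) /\
    forall i : nat, ex_derive (line i (pds w g) x x3) (pt i x x3).

Definition open_set (P : R -> Prop) : Prop := forall t, P t -> locally t P.
Definition everywhere : R -> Prop := fun _ => True.

Lemma open_everywhere : open_set everywhere.
Proof. intros t _. now apply filter_forall. Qed.

Lemma open_neg : open_set (fun t => t < 0)%R.
Proof. intros t H. now apply (open_lt 0). Qed.

Lemma smooth_everywhere g : smooth g <-> smooth_on everywhere g.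
Proof. split; intros H w x x3; [intros _ | ]; now apply H. Qed.

Lemma pds_app w i g : pds (w ++ [i]) g = pds w (pd i g).
Proof. unfold pds. now rewrite fold_right_app. Qed.

Lemma line_pt i g x x3 : line i g x x3 (pt i x x3) = g x x3.
Proof. destruct x as [x1 x2]; destruct i as [|[|[|i]]]; reflexivity. Qed.

Lemma line_comp (h : R -> R) i f x x3 t :
  line i (fun y y3 => h (f y y3)) x x3 t = h (line i f x x3 t).
Proof. destruct i as [|[|[|i]]]; reflexivity. Qed.

Lemma line_comp2 (h : R -> R -> R) i f g x x3 t :
  line i (fun y y3 => h (f y y3) (g y y3)) x x3 t
  = h (line i f x x3 t) (line i g x x3 t).
Proof. destruct i as [|[|[|i]]]; reflexivity. Qed.

Definition eq_on (P : R -> Prop) (f g : R2 -> R -> R) : Prop :=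
  forall x x3, P x3 -> f x x3 = g x x3.

Lemma line_eq_on P f g i x x3 : open_set P -> eq_on P f g -> P x3 ->
  locally (pt i x x3) (fun t => line i f x x3 t = line i g x x3 t).
Proof.
  intros HP E Hx. destruct i as [|[|[|i]]]; simpl.
  2,3: apply filter_forall; intros; now apply E.
  all: apply (filter_imp P); [intros; now apply E | now apply HP].
Qed.

Lemma pds_eq_on P w f g : open_set P -> eq_on P f g -> eq_on P (pds w f) (pds w g).
Proof.
  intros HP E. induction w as [|i w IH]; [exact E|].
  intros x x3 Hx. apply Derive_ext_loc. now apply (line_eq_on P).
Qed.

Definition regular_at (g : R2 -> R -> R) (x : R2) (x3 : R) : Prop :=
  continuous (fun p : R2 * R => g (fst p) (snd p)) (x, x3) /\
  forall i : nat, ex_derive (line i g x x3) (pt i x x3).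

Lemma regular_at_eq P f g x x3 : open_set P -> eq_on P f g -> P x3 ->
  regular_at f x x3 -> regular_at g x x3.
Proof.
  intros HP E Hx [Hc Hd]. split.
  - apply (continuous_ext_loc _ (fun p : R2 * R => f (fst p) (snd p)));
      [|exact Hc].
    destruct (HP x3 Hx) as [eps Heps]. exists eps.
    intros p [_ Hp]. apply E, Heps, Hp.
  - intros i. apply (ex_derive_ext_loc (line i f x x3)); [|apply Hd].
    now apply (line_eq_on P).
Qed.

Lemma smooth_on_eq P f g : open_set P -> eq_on P f g -> smooth_on P f ->
  smooth_on P g.
Proof.
  intros HP E Hf w x x3 Hx.
  apply (regular_at_eq P (pds w f)); [exact HP | now apply pds_eq_on | exact Hx|].
  now apply Hf.
Qed.

Definition has_pd (P : R -> Prop) (i : nat) (g g' : R2 -> R -> R) : Prop :=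
  forall x x3, P x3 -> is_derive (line i g x x3) (pt i x x3) (g' x x3).

Lemma has_pd_eq_on P i g g' : has_pd P i g g' -> eq_on P (pd i g) g'.
Proof. intros H x x3 Hx. now apply is_derive_unique, H. Qed.

Lemma smooth_has_pd P i g : smooth_on P g -> has_pd P i g (pd i g).
Proof. intros H x x3 Hx. apply Derive_correct. now apply (H [] x x3). Qed.

Lemma smooth_pd P i g : smooth_on P g -> smooth_on P (pd i g).
Proof. intros H w x x3. rewrite <- pds_app. apply H. Qed.

Lemma smooth_pds P w g : smooth_on P g -> smooth_on P (pds w g).
Proof. intros H. induction w as [|i w IH]; [exact H | now apply smooth_pd]. Qed.

Lemma has_pd_plus P i f g f' g' : has_pd P i f f' -> has_pd P i g g' ->
  has_pd P i (fun x x3 => f x x3 + g x x3)%R (fun x x3 => f' x x3 + g' x x3)%R.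
Proof.
  intros Hf Hg x x3 Hx.
  eapply is_derive_ext; [intros t; symmetry; apply (line_comp2 Rplus)|].
  apply @is_derive_plus; [now apply Hf | now apply Hg].
Qed.

Lemma has_pd_mult P i f g f' g' : has_pd P i f f' -> has_pd P i g g' ->
  has_pd P i (fun x x3 => f x x3 * g x x3)%R
    (fun x x3 => f' x x3 * g x x3 + f x x3 * g' x x3)%R.
Proof.
  intros Hf Hg x x3 Hx.
  eapply is_derive_ext; [intros t; symmetry; apply (line_comp2 Rmult)|].
  rewrite <- (line_pt i f x x3). rewrite <- (line_pt i g x x3).
  apply (is_derive_mult (line i f x x3) (line i g x x3));
    [now apply Hf | now apply Hg | intros; apply Rmult_comm].
Qed.

Lemma has_pd_comp P (h h' : R -> R) i f f' : has_pd P i f f' ->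
  (forall x x3, P x3 -> is_derive h (f x x3) (h' (f x x3))) ->
  has_pd P i (fun x x3 => h (f x x3)) (fun x x3 => f' x x3 * h' (f x x3))%R.
Proof.
  intros Hf Hh x x3 Hx.
  eapply is_derive_ext; [intros t; symmetry; apply (line_comp h)|].
  apply (is_derive_comp h (line i f x x3)).
  - rewrite line_pt. now apply Hh.
  - now apply Hf.
Qed.

Lemma has_pd_const P i c : has_pd P i (fun _ _ => c) (fun _ _ => 0%R).
Proof. intros x x3 _. destruct i as [|[|[|i]]]; apply @is_derive_const. Qed.

(** A family of functions closed under partial derivatives. In [sc_slice] the
    value t of x_3 may lie in another slab, as x_3 = 0 or y_3 do. *)
Inductive smooth_closure (P : R -> Prop) : (R2 -> R -> R) -> Prop :=
  | sc_smooth g : smooth_on P g -> smooth_closure P g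
  | sc_slice Q g t : smooth_on Q g -> Q t -> smooth_closure P (fun x _ => g x t)
  | sc_const c : smooth_closure P (fun _ _ => c)
  | sc_pt i : smooth_closure P (pt i)
  | sc_plus f g : smooth_closure P f -> smooth_closure P g ->
      smooth_closure P (fun x x3 => f x x3 + g x x3)%R
  | sc_mult f g : smooth_closure P f -> smooth_closure P g ->
      smooth_closure P (fun x x3 => f x x3 * g x x3)%R
  | sc_inv f : smooth_closure P f -> (forall x x3, P x3 -> f x x3 <> 0%R) ->
      smooth_closure P (fun x x3 => / f x x3)%R
  | sc_sqrt f : smooth_closure P f -> (forall x x3, P x3 -> (0 < f x x3)%R) ->
      smooth_closure P (fun x x3 => sqrt (f x x3))
  | sc_exp f : smooth_closure P f -> smooth_closure P (fun x x3 => exp (f x x3))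
  | sc_cos f : smooth_closure P f -> smooth_closure P (fun x x3 => cos (f x x3))
  | sc_sin f : smooth_closure P f -> smooth_closure P (fun x x3 => sin (f x x3)).

(** The derivative of each generator is again a combination of generators; for
    the inverse and the square root this uses their own values. *)
Lemma smooth_closure_step P g : smooth_closure P g ->
  (forall x x3, P x3 -> continuous (fun p : R2 * R => g (fst p) (snd p)) (x, x3)) /\
  forall i, exists g', smooth_closure P g' /\ has_pd P i g g'.
Proof.
  assert (comp : forall (h h' : R -> R) f,
    ((forall x x3, P x3 ->
       continuous (fun p : R2 * R => f (fst p) (snd p)) (x, x3)) /\
      forall i, exists g', smooth_closure P g' /\ has_pd P i f g') ->
    (forall x x3, P x3 -> is_derive h (f x x3) (h' (f x x3))) ->
    smooth_closure P (fun x x3 => h' (f x x3)) ->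
    (forall x x3, P x3 ->
       continuous (fun p : R2 * R => h (f (fst p) (snd p))) (x, x3)) /\
    forall i, exists g', smooth_closure P g' /\
      has_pd P i (fun x x3 => h (f x x3)) g').
  { intros h h' f [Hc Hd] Hh Hs. split.
    - intros x x3 Hx. apply (continuous_comp (fun p : R2 * R => f (fst p) (snd p)) h).
      + now apply Hc.
      + apply (@ex_derive_continuous R_AbsRing R_NormedModule).
        eexists; now apply (Hh x x3).
    - intros i. destruct (Hd i) as (f' & Sf' & Hf').
      eexists; split; [|apply (has_pd_comp P h h' _ _ _ Hf' Hh)].
      now apply (sc_mult P f' (fun x x3 => h' (f x x3))). }
  intros H. induction H as
    [g Hg|Q g t Hg Ht|c|i|f g Sf [Cf IHf] Sg [Cg IHg]|f g Sf [Cf IHf] Sg [Cg IHg]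
    |f Sf IH N|f Sf IH N|f Sf IH|f Sf IH|f Sf IH].
  - split; [intros x x3 Hx; now apply (Hg [] x x3)|].
    intros i. exists (pd i g). split.
    + now apply sc_smooth, smooth_pd.
    + now apply smooth_has_pd.
  - split.
    + intros x x3 _.
      apply (continuous_comp_2 (fun p : R2 * R => fst p) (fun _ => t) g).
      * apply continuous_fst.
      * apply continuous_const.
      * now apply (Hg [] x t).
    + assert (Hz : forall i, (forall f x x3, line i f x x3 = f x) ->
        has_pd P i (fun x _ => g x t) (fun _ _ => 0%R)).
      { intros i E x x3 _. rewrite E. apply @is_derive_const. }
      intros [|[|[|i]]].
      * exists (fun _ _ => 0%R). split; [apply sc_const | now apply Hz].
      * exists (fun x _ => pd 1 g x t). split.
        { now apply (sc_slice P Q (pd 1 g)); [apply smooth_pd|]. }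
        intros x x3 _. now apply (smooth_has_pd Q 1 g Hg x t).
      * exists (fun x _ => pd 2 g x t). split.
        { now apply (sc_slice P Q (pd 2 g)); [apply smooth_pd|]. }
        intros x x3 _. now apply (smooth_has_pd Q 2 g Hg x t).
      * exists (fun _ _ => 0%R). split; [apply sc_const | now apply Hz].
  - split; [intros; apply continuous_const|].
    intros i. exists (fun _ _ => 0%R). split; [apply sc_const | apply has_pd_const].
  - split.
    + intros x x3 _. unfold pt. destruct i as [|[|[|i]]].
      * apply continuous_snd.
      * apply (continuous_comp (fun p : R2 * R => fst p) (fun p : R2 => fst p)).
        apply continuous_fst. destruct x; apply continuous_fst.
      * apply (continuous_comp (fun p : R2 * R => fst p) (fun p : R2 => snd p)).
        apply continuous_fst. destruct x; apply continuous_snd.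
      * apply continuous_snd.
    + intros j.
      assert (E : exists c : R, has_pd P j (pt i) (fun _ _ => c)).
      { destruct i as [|[|[|i]]]; destruct j as [|[|[|j]]];
          (exists 1%R; intros x x3 _; apply @is_derive_id) ||
          (exists 0%R; intros x x3 _; apply @is_derive_const). }
      destruct E as [c E]. exists (fun _ _ => c). split; [apply sc_const | exact E].
  - split; [intros x x3 Hx; apply @continuous_plus; auto|].
    intros i. destruct (IHf i) as (f' & Sf' & Hf').
    destruct (IHg i) as (g' & Sg' & Hg').
    eexists; split; [|apply has_pd_plus; eassumption]. now apply sc_plus.
  - split; [intros x x3 Hx; apply @continuous_mult; auto|].
    intros i. destruct (IHf i) as (f' & Sf' & Hf').
    destruct (IHg i) as (g' & Sg' & Hg').
    eexists; split; [|apply has_pd_mult; eassumption].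
    apply sc_plus; now apply sc_mult.
  - apply (comp Rinv (fun t => (-1) * (/ t * / t))%R f IH).
    + intros x x3 Hx. auto_derive; [now apply N|]. field. now apply N.
    + apply (sc_mult P (fun _ _ => (-1)%R)); [apply sc_const|].
      apply (sc_mult P (fun x x3 => / f x x3)%R (fun x x3 => / f x x3)%R);
        now apply sc_inv.
  - apply (comp sqrt (fun t => / (2 * sqrt t))%R f IH).
    + intros x x3 Hx. now apply is_derive_Reals, derivable_pt_lim_sqrt, N.
    + apply (sc_inv P (fun x x3 => 2 * sqrt (f x x3))%R).
      * apply (sc_mult P (fun _ _ => 2%R)); [apply sc_const | now apply sc_sqrt].
      * intros x x3 Hx. pose proof (sqrt_lt_R0 _ (N x x3 Hx)). lra.
  - apply (comp exp exp f IH).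
    + intros x x3 _. apply is_derive_exp.
    + now apply sc_exp.
  - apply (comp cos (fun t => (-1) * sin t)%R f IH).
    + intros x x3 _. auto_derive; [exact I | ring].
    + apply (sc_mult P (fun _ _ => (-1)%R)); [apply sc_const | now apply sc_sin].
  - apply (comp sin cos f IH).
    + intros x x3 _. auto_derive; [exact I | ring].
    + now apply sc_cos.
Qed.

(** Smoothness is coinductive: each derivative of a function of the closure is
    again in the closure, so a word of derivatives never leaves it. *)
Lemma smooth_on_closure P g : open_set P -> smooth_closure P g -> smooth_on P g.
Proof.
  intros HP H w. revert g H.
  induction w as [|i w IH] using rev_ind; intros g H x x3 Hx;
    destruct (smooth_closure_step P g H) as [Hc Hd].
  - split; [now apply Hc|].
    intros i. destruct (Hd i) as (g' & _ & Hg'). eexists; now apply Hg'.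
  - destruct (Hd i) as (g' & Sg' & Hg').
    rewrite pds_app. apply (regular_at_eq P (pds w g')); [exact HP | | exact Hx |].
    + apply pds_eq_on; [exact HP|]. intros y t Ht. symmetry.
      now apply (has_pd_eq_on P).
    + now apply IH.
Qed.

Lemma smooth_of_closure g : smooth_closure everywhere g -> smooth g.
Proof.
  intros H. now apply smooth_everywhere, smooth_on_closure; [apply open_everywhere|].
Qed.

Lemma smooth_const c : smooth (fun _ _ => c).
Proof. apply smooth_of_closure, sc_const. Qed.

Lemma smooth_pt i : smooth (pt i).
Proof. apply smooth_of_closure, sc_pt. Qed.

Lemma smooth_slice Q g t : smooth_on Q g -> Q t -> smooth (fun x _ => g x t).
Proof. intros; now apply smooth_of_closure, (sc_slice everywhere Q). Qed.

Lemma smooth_plus f g : smooth f -> smooth g ->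
  smooth (fun x x3 => f x x3 + g x x3)%R.
Proof.
  intros; apply smooth_of_closure, sc_plus; now apply sc_smooth, smooth_everywhere.
Qed.

Lemma smooth_mult f g : smooth f -> smooth g ->
  smooth (fun x x3 => f x x3 * g x x3)%R.
Proof.
  intros; apply smooth_of_closure, sc_mult; now apply sc_smooth, smooth_everywhere.
Qed.

Lemma smooth_ext f g : smooth f -> (forall x x3, f x x3 = g x x3) -> smooth g.
Proof.
  intros H E. replace g with f; [exact H|].
  extensionality x; extensionality x3; apply E.
Qed.

Lemma smooth_opp f : smooth f -> smooth (fun x x3 => - f x x3)%R.
Proof.
  intros H. eapply smooth_ext;
    [apply (smooth_mult (fun _ _ => (-1)%R) f); [apply smooth_const | exact H]|].
  intros; simpl; ring.
Qed.

Lemma smooth_inv f : smooth f -> (forall x x3, f x x3 <> 0%R) ->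
  smooth (fun x x3 => / f x x3)%R.
Proof.
  intros. apply smooth_of_closure, sc_inv; [now apply sc_smooth, smooth_everywhere | auto].
Qed.

Lemma smooth_sqrt f : smooth f -> (forall x x3, (0 < f x x3)%R) ->
  smooth (fun x x3 => sqrt (f x x3)).
Proof.
  intros. apply smooth_of_closure, sc_sqrt; [now apply sc_smooth, smooth_everywhere | auto].
Qed.

(** * Complex-valued smooth functions *)

Definition cpd (i : nat) (u : R2 -> R -> C) : R2 -> R -> C := fun x x3 =>
  (pd i (fun y y3 => Re (u y y3)) x x3, pd i (fun y y3 => Im (u y y3)) x x3).

Lemma C_ext (z w : C) : Re z = Re w -> Im z = Im w -> z = w.
Proof. destruct z, w; simpl; now intros -> ->. Qed.

Lemma Ceq_minus (a b : C) : a = b <-> a - b = 0.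
Proof.
  split; [intros ->; ring|]. intros E. replace a with (a - b + b) by ring.
  rewrite E. ring.
Qed.

Lemma Csmooth_ext u v : Csmooth u -> (forall x x3, u x x3 = v x x3) -> Csmooth v.
Proof.
  intros H E. replace v with u; [exact H|].
  extensionality x; extensionality x3; apply E.
Qed.

Lemma Csmooth_cpd i u : Csmooth u -> Csmooth (cpd i u).
Proof.
  intros [H1 H2]. split; now apply smooth_everywhere, smooth_pd, smooth_everywhere.
Qed.

Lemma Csmooth_RtoC g : smooth g -> Csmooth (fun x x3 => RtoC (g x x3)).
Proof. intros H. split; [exact H | exact (smooth_const 0)]. Qed.

Lemma Csmooth_const c : Csmooth (fun _ _ => c).
Proof. split; [exact (smooth_const (Re c)) | exact (smooth_const (Im c))]. Qed.

Lemma Csmooth_plus u v : Csmooth u -> Csmooth v ->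
  Csmooth (fun x x3 => u x x3 + v x x3).
Proof.
  intros [H1 H2] [H3 H4].
  split; now apply (smooth_plus (fun x x3 => _) (fun x x3 => _)).
Qed.

Lemma Csmooth_mult u v : Csmooth u -> Csmooth v ->
  Csmooth (fun x x3 => u x x3 * v x x3).
Proof.
  intros [H1 H2] [H3 H4]. split.
  - apply (smooth_plus (fun x x3 => _ * _)%R (fun x x3 => - (_ * _))%R).
    + now apply smooth_mult.
    + apply smooth_opp. now apply smooth_mult.
  - apply (smooth_plus (fun x x3 => _ * _)%R (fun x x3 => _ * _)%R);
      now apply smooth_mult.
Qed.

Lemma Csmooth_opp u : Csmooth u -> Csmooth (fun x x3 => - u x x3).
Proof. intros [H1 H2]. split; now apply (smooth_opp (fun x x3 => _)). Qed.

Lemma Csmooth_minus u v : Csmooth u -> Csmooth v ->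
  Csmooth (fun x x3 => u x x3 - v x x3).
Proof. intros Hu Hv. apply Csmooth_plus; [exact Hu | now apply Csmooth_opp]. Qed.

Lemma Csmooth_inv u : Csmooth u -> (forall x x3, u x x3 <> 0) ->
  Csmooth (fun x x3 => / u x x3).
Proof.
  intros [H1 H2] N.
  assert (P : forall x x3, (Re (u x x3) * Re (u x x3)
    + Im (u x x3) * Im (u x x3))%R <> 0%R).
  { intros x x3 E. apply (N x x3). apply C_ext; simpl Re; simpl Im; nra. }
  assert (S : smooth (fun x x3 => / (Re (u x x3) * Re (u x x3)
    + Im (u x x3) * Im (u x x3)))%R).
  { apply smooth_inv; [|exact P].
    apply (smooth_plus (fun x x3 => _ * _)%R (fun x x3 => _ * _)%R);
      now apply smooth_mult. }
  split; [apply (smooth_ext _ _ (smooth_mult _ _ H1 S))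
         |apply (smooth_ext _ _ (smooth_mult _ _ (smooth_opp _ H2) S))];
    intros x x3; unfold Cinv, Rdiv, Re, Im; simpl; now rewrite !Rmult_1_r.
Qed.

Lemma Csmooth_Cexp u : Csmooth u -> Csmooth (fun x x3 => Cexp (u x x3)).
Proof.
  intros [H1 H2]. split; apply smooth_of_closure.
  - apply (sc_mult _ (fun x x3 => exp _) (fun x x3 => cos _));
      [apply sc_exp | apply sc_cos]; now apply sc_smooth, smooth_everywhere.
  - apply (sc_mult _ (fun x x3 => exp _) (fun x x3 => sin _));
      [apply sc_exp | apply sc_sin]; now apply sc_smooth, smooth_everywhere.
Qed.

(** * The principal square root *)

(** If z = w^2 then |z| + Re z = 2 (Re w)^2, so z is off the cut. *)
Lemma root_pos_radius z : has_root_pos z -> (0 < Cmod z + Re z)%R.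
Proof.
  intros (w & Hw & <-). rewrite Cmod_mult.
  assert (E : (Cmod w * Cmod w = Re w * Re w + Im w * Im w)%R).
  { unfold Cmod. rewrite sqrt_sqrt; [unfold Re, Im; ring|]. nra. }
  rewrite E, re_mult. nra.
Qed.

Lemma csqrt_root z : has_root_pos z -> (0 < Re (csqrt z))%R /\ csqrt z * csqrt z = z.
Proof.
  intros Hz. pose proof (root_pos_radius z Hz) as P. destruct Hz as (w & Hw & <-).
  assert (E : (Cmod (w * w) + Re (w * w) = 2 * (Re w * Re w))%R).
  { rewrite Cmod_mult.
    assert (E : (Cmod w * Cmod w = Re w * Re w + Im w * Im w)%R).
    { unfold Cmod. rewrite sqrt_sqrt; [unfold Re, Im; ring|]. nra. }
    rewrite E, re_mult. ring. }
  replace (csqrt (w * w)) with w; [easy|].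
  unfold csqrt. rewrite E.
  replace (2 * (Re w * Re w) / 2)%R with (Rsqr (Re w)) by (unfold Rsqr; field).
  rewrite sqrt_Rsqr by lra. apply C_ext; [reflexivity|].
  change (Im w = Im (w * w) / (2 * Re w))%R. rewrite im_mult. field. lra.
Qed.

(** Off the cut both square roots in [csqrt] have positive arguments. *)
Lemma Csmooth_csqrt u : Csmooth u -> (forall x x3, has_root_pos (u x x3)) ->
  Csmooth (fun x x3 => csqrt (u x x3)).
Proof.
  intros [H1 H2] N.
  assert (N0 : forall x x3, (0 < Re (u x x3) * Re (u x x3)
                             + Im (u x x3) * Im (u x x3))%R).
  { intros x x3. pose proof (root_pos_radius _ (N x x3)) as P.
    destruct (Req_dec (Re (u x x3)) 0) as [E1|]; [|nra].
    destruct (Req_dec (Im (u x x3)) 0) as [E2|]; [|nra].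
    exfalso. replace (u x x3) with (RtoC 0) in P by now apply C_ext.
    rewrite Cmod_0 in P. simpl in P. lra. }
  assert (S1 : smooth (fun x x3 => sqrt ((Cmod (u x x3) + Re (u x x3)) * / 2))).
  { apply smooth_sqrt.
    2:{ intros x x3. pose proof (root_pos_radius _ (N x x3)). lra. }
    apply (smooth_mult (fun x x3 => _) (fun _ _ => (/2)%R)); [|apply smooth_const].
    apply (smooth_plus (fun x x3 => _) (fun x x3 => _)); [|exact H1].
    eapply smooth_ext; [apply (smooth_sqrt _ (smooth_plus _ _
      (smooth_mult _ _ H1 H1) (smooth_mult _ _ H2 H2)) N0)|].
    intros x x3. unfold Cmod. f_equal. simpl. unfold Re, Im. ring. }
  split; [exact S1|].
  apply (smooth_mult (fun x x3 => Im (u x x3)) (fun x x3 => / (2 * sqrt _))%R);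
    [exact H2|].
  apply smooth_inv.
  - apply (smooth_mult (fun _ _ => 2%R)); [apply smooth_const | exact S1].
  - intros x x3. pose proof (root_pos_radius _ (N x x3)).
    assert (0 < sqrt ((Cmod (u x x3) + Re (u x x3)) / 2))%R by
      (apply sqrt_lt_R0; lra). lra.
Qed.

Lemma has_pd_ext P i g g' g'' : has_pd P i g g' ->
  (forall x x3, g' x x3 = g'' x x3) -> has_pd P i g g''.
Proof. intros H E x x3 Hx. rewrite <- E. now apply H. Qed.

(** * Rules of differentiation *)

Lemma cpd_eq i u v :
  has_pd everywhere i (fun y y3 => Re (u y y3)) (fun y y3 => Re (v y y3)) ->
  has_pd everywhere i (fun y y3 => Im (u y y3)) (fun y y3 => Im (v y y3)) ->
  cpd i u = v.
Proof.
  intros H1 H2. extensionality x; extensionality x3. unfold cpd.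
  rewrite (has_pd_eq_on _ _ _ _ H1), (has_pd_eq_on _ _ _ _ H2) by exact I.
  now apply C_ext.
Qed.

Lemma Csmooth_has_pd i u : Csmooth u ->
  has_pd everywhere i (fun y y3 => Re (u y y3)) (fun y y3 => Re (cpd i u y y3)) /\
  has_pd everywhere i (fun y y3 => Im (u y y3)) (fun y y3 => Im (cpd i u y y3)).
Proof. intros [H1 H2]. split; now apply smooth_has_pd, smooth_everywhere. Qed.

Lemma cpd_const i c : cpd i (fun _ _ => c) = fun _ _ => 0.
Proof. apply cpd_eq; apply has_pd_const. Qed.

Lemma cpd_plus i u v : Csmooth u -> Csmooth v ->
  cpd i (fun x x3 => u x x3 + v x x3) = fun x x3 => cpd i u x x3 + cpd i v x x3.
Proof.
  intros Hu Hv. pose proof (Csmooth_has_pd i _ Hu) as [A1 A2].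
  pose proof (Csmooth_has_pd i _ Hv) as [B1 B2].
  apply cpd_eq; [apply (has_pd_plus _ _ _ _ _ _ A1 B1)
                | apply (has_pd_plus _ _ _ _ _ _ A2 B2)].
Qed.

Lemma cpd_mult i u v : Csmooth u -> Csmooth v ->
  cpd i (fun x x3 => u x x3 * v x x3)
  = fun x x3 => cpd i u x x3 * v x x3 + u x x3 * cpd i v x x3.
Proof.
  intros Hu Hv. pose proof (Csmooth_has_pd i _ Hu) as [A1 A2].
  pose proof (Csmooth_has_pd i _ Hv) as [B1 B2].
  apply cpd_eq.
  - pose proof (has_pd_mult _ _ _ _ _ _ A2 B2) as P.
    pose proof (has_pd_mult _ _ _ _ _ _ (has_pd_const everywhere i (-1)%R) P) as P'.
    pose proof (has_pd_plus _ _ _ _ _ _ (has_pd_mult _ _ _ _ _ _ A1 B1) P') as Q.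
    replace (fun y y3 => Re (u y y3 * v y y3)) with
      (fun y y3 => (Re (u y y3) * Re (v y y3) + -1 * (Im (u y y3) * Im (v y y3)))%R).
    + apply (has_pd_ext _ _ _ _ _ Q). intros x x3. simpl. unfold Re, Im. ring.
    + extensionality y; extensionality y3. rewrite re_mult. ring.
  - pose proof (has_pd_plus _ _ _ _ _ _ (has_pd_mult _ _ _ _ _ _ A1 B2)
      (has_pd_mult _ _ _ _ _ _ A2 B1)) as Q.
    replace (fun y y3 => Im (u y y3 * v y y3)) with
      (fun y y3 => (Re (u y y3) * Im (v y y3) + Im (u y y3) * Re (v y y3))%R).
    + apply (has_pd_ext _ _ _ _ _ Q). intros x x3. simpl. unfold Re, Im. ring.
    + extensionality y; extensionality y3. rewrite im_mult. ring.
Qed.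

Lemma cpd_scal i c u : Csmooth u ->
  cpd i (fun x x3 => c * u x x3) = fun x x3 => c * cpd i u x x3.
Proof.
  intros Hu. rewrite (cpd_mult i (fun _ _ => c)); [|apply Csmooth_const|exact Hu].
  rewrite cpd_const. extensionality x; extensionality x3. ring.
Qed.

Lemma cpd_minus i u v : Csmooth u -> Csmooth v ->
  cpd i (fun x x3 => u x x3 - v x x3) = fun x x3 => cpd i u x x3 - cpd i v x x3.
Proof.
  intros Hu Hv. etransitivity; [apply (cpd_plus i u _ Hu (Csmooth_opp v Hv))|].
  replace (fun x x3 => - v x x3) with (fun x x3 => (-1) * v x x3)
    by (extensionality x; extensionality x3; ring).
  rewrite (cpd_scal i _ v Hv). extensionality x; extensionality x3. ring.
Qed.

Lemma cpd_Cexp i u : Csmooth u ->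
  cpd i (fun x x3 => Cexp (u x x3)) = fun x x3 => cpd i u x x3 * Cexp (u x x3).
Proof.
  intros Hu. pose proof (Csmooth_has_pd i _ Hu) as [A1 A2].
  assert (E : has_pd everywhere i (fun x x3 => exp (Re (u x x3)))
    (fun x x3 => (Re (cpd i u x x3) * exp (Re (u x x3)))%R)).
  { apply (has_pd_comp _ exp exp _ _ _ A1). intros; apply is_derive_exp. }
  assert (Ec : has_pd everywhere i (fun x x3 => cos (Im (u x x3)))
    (fun x x3 => (Im (cpd i u x x3) * (- sin (Im (u x x3))))%R)).
  { apply (has_pd_comp _ cos (fun t => - sin t)%R _ _ _ A2).
    intros; auto_derive; [exact I | ring]. }
  assert (Es : has_pd everywhere i (fun x x3 => sin (Im (u x x3)))
    (fun x x3 => (Im (cpd i u x x3) * cos (Im (u x x3)))%R)).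
  { apply (has_pd_comp _ sin cos _ _ _ A2). intros; auto_derive; [exact I | ring]. }
  apply cpd_eq.
  - apply (has_pd_ext _ _ _ _ _ (has_pd_mult _ _ _ _ _ _ E Ec)).
    intros x x3. simpl. unfold Re, Im, Cexp. simpl. ring.
  - apply (has_pd_ext _ _ _ _ _ (has_pd_mult _ _ _ _ _ _ E Es)).
    intros x x3. simpl. unfold Re, Im, Cexp. simpl. ring.
Qed.

(** * The operators D_{x'} and D_3 *)

Fixpoint cpdn (i n : nat) (u : R2 -> R -> C) : R2 -> R -> C :=
  match n with 0%nat => u | S m => cpd i (cpdn i m u) end.

Lemma Csmooth_cpdn i n u : Csmooth u -> Csmooth (cpdn i n u).
Proof. intros H. induction n; [exact H | now apply Csmooth_cpd]. Qed.

Lemma CDerive_n_0 f t : CDerive_n f 0 t = f t.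
Proof. now apply C_ext. Qed.

Lemma CDerive_n_ext f g n t : (forall s, f s = g s) ->
  CDerive_n f n t = CDerive_n g n t.
Proof. intros E. replace g with f by (now extensionality s). reflexivity. Qed.

(** D_{x'} and D_3 iterate one-variable derivatives along coordinate lines p;
    seen on the whole space these are powers of a partial derivative. *)
Lemma CDerive_n_path i (p : R -> R2 * R) :
  (forall (v : R2 -> R -> C) t,
     CDerive_n (fun s => v (fst (p s)) (snd (p s))) 1 t
     = cpd i v (fst (p t)) (snd (p t))) ->
  forall n (v : R2 -> R -> C) t,
    CDerive_n (fun s => v (fst (p s)) (snd (p s))) n t
    = cpdn i n v (fst (p t)) (snd (p t)).
Proof.
  intros Hp n v. induction n as [|n IH]; intros t; [now rewrite CDerive_n_0|].
  etransitivity; [exact (CDerive_n_ext _ _ 1 t IH) | apply Hp].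
Qed.

Lemma Dx_cpdn a1 a2 u :
  Dx a1 a2 u = fun x x3 => (- Ci) ^ (a1 + a2) * cpdn 1 a1 (cpdn 2 a2 u) x x3.
Proof.
  extensionality x; extensionality x3. unfold Dx. f_equal.
  etransitivity; [apply CDerive_n_ext; intros t1;
    exact (CDerive_n_path 2 (fun t => ((t1, t), x3)) (fun _ _ => eq_refl) a2 u (snd x))|].
  etransitivity; [exact (CDerive_n_path 1 (fun t => ((t, snd x), x3))
    (fun _ _ => eq_refl) a1 (cpdn 2 a2 u) (fst x))|].
  now destruct x.
Qed.

Lemma D3_cpdn i u : D3 i u = fun x x3 => (- Ci) ^ i * cpdn 3 i u x x3.
Proof.
  extensionality x; extensionality x3. unfold D3. f_equal.
  exact (CDerive_n_path 3 (fun t => (x, t)) (fun _ _ => eq_refl) i u x3).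
Qed.

(** * Orders of symbols *)

Lemma has_ord_eq e m n : has_ord e m -> m = n -> has_ord e n.
Proof. now intros H <-. Qed.

Lemma of_order_eq f m n : of_order f m -> m = n -> of_order f n.
Proof. now intros H <-. Qed.

Lemma of_order_ext f g m : of_order f m -> (forall q x, g q x = f q x) ->
  of_order g m.
Proof. intros (e & He & E) H. exists e; split; [exact He|]. intros; now rewrite H. Qed.

Lemma of_order_const c : of_order (fun _ _ => c) 0.
Proof. exists (Ecst c); split; [constructor | reflexivity]. Qed.

Lemma of_order_k : of_order (fun q _ => RtoC (kk (med q))) 0.
Proof. exists Ek; split; [constructor | reflexivity]. Qed.

Lemma of_order_invJy : of_order (fun q _ => invJy q) 0.
Proof. exists EinvJ; split; [constructor | reflexivity]. Qed.

Lemma of_order_m0 j l : of_order (m0 j l) 0.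
Proof. exists (Em0 j l); split; [constructor | reflexivity]. Qed.

Lemma of_order_m1 j l : of_order (m1 j l) 0.
Proof. exists (Em1 [] j l); split; [constructor | reflexivity]. Qed.

Lemma of_order_xi j : of_order (fun q _ => xij q j) 1.
Proof. exists (Exi j); split; [constructor | reflexivity]. Qed.

Lemma of_order_tau : of_order (fun q _ => tau q) 2.
Proof. exists Etau; split; [constructor | reflexivity]. Qed.

Lemma of_order_my3 : of_order (fun q _ => RtoC (- y3 q)) (-1).
Proof. exists Emy3; split; [constructor | reflexivity]. Qed.

Lemma of_order_plus f g m : of_order f m -> of_order g m ->
  of_order (fun q x => f q x + g q x) m.
Proof.
  intros (e1 & H1 & E1) (e2 & H2 & E2).
  exists (Eadd e1 e2); split; [now constructor|]. intros; simpl. now rewrite E1, E2.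
Qed.

Lemma of_order_mult f g m n p : of_order f m -> of_order g n -> (m + n)%Z = p ->
  of_order (fun q x => f q x * g q x) p.
Proof.
  intros (e1 & H1 & E1) (e2 & H2 & E2) <-.
  exists (Emul e1 e2); split; [now constructor|]. intros; simpl. now rewrite E1, E2.
Qed.

Lemma of_order_scal c f m : of_order f m -> of_order (fun q x => c * f q x) m.
Proof.
  intros H. now apply (of_order_mult (fun _ _ => c) f 0 m); [apply of_order_const|..].
Qed.

Lemma of_order_opp f m : of_order f m -> of_order (fun q x => - f q x) m.
Proof.
  intros H. eapply of_order_ext; [apply (of_order_scal (-1)%R _ _ H)|].
  intros; cbv beta. ring.
Qed.

Lemma of_order_minus f g m : of_order f m -> of_order g m ->
  of_order (fun q x => f q x - g q x) m.
Proof. intros Hf Hg. apply of_order_plus; [exact Hf | now apply of_order_opp]. Qed.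

Lemma of_order_inv f m p : of_order f m -> (- m)%Z = p ->
  of_order (fun q x => / f q x) p.
Proof.
  intros (e1 & H1 & E1) <-. exists (Einv e1); split; [now constructor|].
  intros; simpl. now rewrite E1.
Qed.

Lemma of_order_div f g m n p : of_order f m -> of_order g n -> (m - n)%Z = p ->
  of_order (fun q x => f q x / g q x) p.
Proof.
  intros Hf Hg <-. apply (of_order_mult f (fun q x => / g q x) m (- n)).
  - exact Hf.
  - now apply (of_order_inv g n).
  - lia.
Qed.

Lemma of_order_csqrt f m : of_order f (2 * m) -> of_order (fun q x => csqrt (f q x)) m.
Proof.
  intros (e1 & H1 & E1). exists (Esqrt e1); split; [now constructor|].
  intros; simpl. now rewrite E1.
Qed.

(** Multiply by 0 an expression of order m: a power of xi_1 or of -y_3, according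
    to the sign of m. *)
Lemma of_order_zero m : of_order (fun _ _ => 0) m.
Proof.
  assert (P : forall n, (exists e, has_ord e (Z.of_nat n)) /\
    exists e, has_ord e (- Z.of_nat n)).
  { induction n as [|n [[e1 H1] [e2 H2]]].
    - split; exists (Ecst 0); constructor.
    - split.
      + exists (Emul (Exi 1) e1).
        apply (has_ord_eq _ _ _ (ord_mul _ _ _ _ (ord_xi 1) H1)). lia.
      + exists (Emul Emy3 e2).
        apply (has_ord_eq _ _ _ (ord_mul _ _ _ _ ord_my3 H2)). lia. }
  assert (Q : exists e, has_ord e m).
  { destruct (Z_le_gt_dec 0 m) as [H|H].
    - destruct (P (Z.to_nat m)) as [[e He] _]. exists e.
      apply (has_ord_eq _ _ _ He). lia.
    - destruct (P (Z.to_nat (- m))) as [_ [e He]]. exists e.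
      apply (has_ord_eq _ _ _ He). lia. }
  destruct Q as [e He]. exists (Emul (Ecst 0) e). split.
  - apply (has_ord_eq _ _ _ (ord_mul _ _ _ _ (ord_cst 0) He)). lia.
  - intros; simpl. ring.
Qed.

Lemma of_order_sum_n_m (f : nat -> symbol) a b m :
  (forall k, (a <= k <= b)%nat -> of_order (f k) m) ->
  of_order (fun q x => sum_n_m (fun k => f k q x) a b) m.
Proof.
  induction b as [|b IH]; intros H.
  - destruct a as [|a].
    + eapply of_order_ext; [apply (H 0%nat); lia|].
      intros. apply (sum_n_n (fun k => f k q x)).
    + eapply of_order_ext; [apply (of_order_zero m)|].
      intros. apply (sum_n_m_zero (G := C_AbelianGroup)). lia.
  - destruct (Compare_dec.le_lt_dec a (S b)) as [L|L].
    + eapply of_order_ext;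
        [apply (of_order_plus _ _ m (IH (fun k Hk => H k ltac:(lia)))
                 (H (S b) ltac:(lia)))|].
      intros. now apply (sum_n_Sm (G := C_AbelianGroup) (fun k => f k q x)).
    + eapply of_order_ext; [apply (of_order_zero m)|].
      intros. apply (sum_n_m_zero (G := C_AbelianGroup)). lia.
Qed.

Lemma of_order_sum_n (f : nat -> symbol) b m :
  (forall k, (k <= b)%nat -> of_order (f k) m) ->
  of_order (fun q x => sum_n (fun k => f k q x) b) m.
Proof. intros H. apply of_order_sum_n_m. intros; apply H; lia. Qed.

Lemma of_order_pow f m n : of_order f m ->
  of_order (fun q x => f q x ^ n) (Z.of_nat n * m).
Proof.
  intros H. induction n as [|n IH].
  - exact (of_order_const 1).
  - apply (of_order_mult f (fun q x => f q x ^ n) m (Z.of_nat n * m));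
      [exact H | exact IH | lia].
Qed.

(** The value 0 of the last coordinate is arbitrary: the function differentiated
    does not depend on it. *)
Definition cd (i : nat) (f : symbol) : symbol := fun q x =>
  cpd i (fun x' _ => f q x') x 0.

(** d/dx_i is i D_{x_i}, an operation on expressions that keeps the order. *)
Lemma of_order_cd i f m : i = 1%nat \/ i = 2%nat -> of_order f m ->
  of_order (cd i f) m.
Proof.
  intros Hi (e & He & E).
  assert (P : of_order (eval (EDx (if Nat.eqb i 1 then 1 else 0)
                                  (if Nat.eqb i 1 then 0 else 1) e)) m).
  { eexists; split; [apply ord_Dx, He | reflexivity]. }
  apply (of_order_ext _ (cd i f) _ (of_order_scal Ci _ _ P)).
  intros q x. unfold cd.
  replace (fun x' (_ : R) => f q x') with (fun x' (_ : R) => eval e q x')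
    by (extensionality x'; extensionality y; now rewrite E).
  cbn [eval]. rewrite Dx_cpdn.
  assert (I2 : Ci * (- Ci) = 1).
  { apply C_ext; simpl; ring. }
  destruct Hi as [-> | ->]; cbn -[cpd]; rewrite Cmult_1_r;
    rewrite Cmult_assoc, I2; ring.
Qed.

Lemma of_order_R0 : of_order R0 1.
Proof.
  apply of_order_sum_n_m. intros. eapply of_order_mult;
    [apply of_order_m0 | apply of_order_xi | reflexivity].
Qed.

Lemma of_order_R1 : of_order R1 1.
Proof.
  apply of_order_sum_n_m. intros. eapply of_order_mult;
    [apply of_order_m1 | apply of_order_xi | reflexivity].
Qed.

Lemma of_order_radicand (t : par -> C) :
  of_order (fun q _ => t q) 2 -> of_order (fun q x => radicand (t q) q x) 2.
Proof.
  intros Ht. unfold radicand. apply of_order_minus.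
  - apply (of_order_mult (m1 3 3) (fun q x => _ + t q) 0 2);
      [apply of_order_m1| |reflexivity].
    apply (of_order_plus (fun q x => _) (fun q x => t q)); [|exact Ht].
    apply of_order_sum_n_m; intros; apply of_order_sum_n_m; intros.
    apply (of_order_mult (fun q x => _ * _) (fun q x => _) 1 1);
      [|apply of_order_xi | reflexivity].
    eapply of_order_mult; [apply of_order_m1 | apply of_order_xi | reflexivity].
  - apply (of_order_pow R1 1 2), of_order_R1.
Qed.

Lemma of_order_roots :
  of_order lamp 1 /\ of_order lamm 1 /\ of_order mup 1 /\ of_order mum 1.
Proof.
  assert (T2 : of_order (fun q _ => tau q / kk (med q)) 2).
  { eapply (of_order_div (fun q _ => tau q) (fun q _ => RtoC (kk (med q))));
      [apply of_order_tau | apply of_order_k | reflexivity]. }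
  assert (P : forall g, of_order g 1 ->
    of_order (fun q x => / m1 3 3 q x * (- (Ci * R1 q x) + g q x)) 1).
  { intros g Hg.
    apply (of_order_mult (fun q x => / m1 3 3 q x)
             (fun q x => - (Ci * R1 q x) + g q x) 0 1); [| |reflexivity].
    - eapply of_order_inv; [apply of_order_m1 | reflexivity].
    - apply (of_order_plus (fun q x => - (Ci * R1 q x)) g); [|exact Hg].
      apply (of_order_opp (fun q x => Ci * R1 q x)), of_order_scal, of_order_R1. }
  pose proof (of_order_csqrt _ 1 (of_order_radicand _ of_order_tau)) as S1.
  pose proof (of_order_csqrt _ 1 (of_order_radicand _ T2)) as S2.
  split; [|split; [|split]].
  - apply (P _ S1).
  - apply (P _ (of_order_opp _ _ S1)).
  - apply (P _ S2).
  - apply (P _ (of_order_opp _ _ S2)).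
Qed.

Lemma of_order_beta j : of_order (beta_ j) 1.
Proof.
  destruct of_order_roots as (H1 & H2 & H3 & H4).
  unfold beta_. now do 8 (destruct j as [|j]; auto).
Qed.

Lemma of_order_delta j : of_order (delta_ j) 1.
Proof.
  destruct of_order_roots as (H1 & H2 & H3 & H4).
  unfold delta_. now do 8 (destruct j as [|j]; auto).
Qed.

Lemma of_order_Delta0 : of_order Delta0 1.
Proof.
  destruct of_order_roots as (H1 & H2 & H3 & H4).
  assert (P : forall g, of_order g 1 ->
    of_order (fun q x => Ci * R0 q x + g q x * m0 3 3 q x) 1).
  { intros g Hg. apply of_order_plus.
    - apply of_order_scal, of_order_R0.
    - eapply of_order_mult; [exact Hg | apply of_order_m0 | reflexivity]. }
  unfold Delta0. apply of_order_minus; [|now apply P].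
  eapply (of_order_mult (fun q _ => RtoC (kk (med q))));
    [apply of_order_k | now apply P | reflexivity].
Qed.

Lemma Cplus_0_cancel (a b : C) : a + 0 = b + 0 -> a = b.
Proof. now rewrite !Cplus_0_r. Qed.

(* Adding 0 displays a bare sum as an element of the ring [C] rather than of its
   additive monoid. *)
Ltac cring := apply Cplus_0_cancel; ring.

(** * Finite sums of complex numbers *)

Lemma Csum_O (a : nat -> C) : sum_n a 0 = a 0%nat.
Proof. exact (sum_O (G := C_AbelianMonoid) a). Qed.

Lemma Csum_S (a : nat -> C) n : sum_n a (S n) = sum_n a n + a (S n).
Proof. exact (sum_Sn (G := C_AbelianMonoid) a n). Qed.

Lemma Csum_ext (a b : nat -> C) n : (forall l, (l <= n)%nat -> a l = b l) ->
  sum_n a n = sum_n b n.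
Proof. apply sum_n_ext_loc. Qed.

Lemma Csum_plus (a b : nat -> C) n :
  sum_n (fun l => a l + b l) n = sum_n a n + sum_n b n.
Proof. exact (sum_n_plus (G := C_AbelianMonoid) a b n). Qed.

Lemma Csum_scal c (a : nat -> C) n : sum_n (fun l => c * a l) n = c * sum_n a n.
Proof. exact (sum_n_mult_l (K := C_Ring) c a n). Qed.

Lemma Csum_shift (a : nat -> C) n :
  sum_n a (S n) = a 0%nat + sum_n (fun l => a (S l)) n.
Proof.
  induction n as [|n IH].
  - now rewrite Csum_S, !Csum_O.
  - rewrite Csum_S, IH, Csum_S. cring.
Qed.

Lemma Csum_zero n : sum_n (fun _ => RtoC 0) n = RtoC 0.
Proof. induction n; [apply Csum_O | rewrite Csum_S, IHn; cring]. Qed.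

Lemma Csum_widen (a : nat -> C) n m : (n <= m)%nat ->
  (forall l, (n < l)%nat -> a l = 0) -> sum_n a m = sum_n a n.
Proof.
  intros H Z. induction H as [|m H IH]; [reflexivity|].
  rewrite Csum_S, IH, Z by lia. cring.
Qed.

Lemma Csmooth_sum (u : nat -> R2 -> R -> C) n :
  (forall l, (l <= n)%nat -> Csmooth (u l)) ->
  Csmooth (fun x x3 => sum_n (fun l => u l x x3) n).
Proof.
  induction n as [|n IH]; intros H.
  - eapply Csmooth_ext; [apply (H 0%nat); lia|]. intros; now rewrite Csum_O.
  - eapply Csmooth_ext; [apply Csmooth_plus; [apply IH | apply (H (S n))]; auto|].
    intros; cbv beta. now rewrite Csum_S.
Qed.

Lemma cpd_sum i (u : nat -> R2 -> R -> C) n :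
  (forall l, (l <= n)%nat -> Csmooth (u l)) ->
  cpd i (fun x x3 => sum_n (fun l => u l x x3) n)
  = fun x x3 => sum_n (fun l => cpd i (u l) x x3) n.
Proof.
  induction n as [|n IH]; intros H.
  - replace (fun x x3 => sum_n (fun l => u l x x3) 0) with (u 0%nat).
    + extensionality x; extensionality x3. now rewrite Csum_O.
    + extensionality x; extensionality x3. now rewrite Csum_O.
  - replace (fun x x3 => sum_n (fun l => u l x x3) (S n)) with
      (fun x x3 => sum_n (fun l => u l x x3) n + u (S n) x x3).
    + rewrite (cpd_plus i (fun x x3 => sum_n (fun l => u l x x3) n) (u (S n)));
        [|apply Csmooth_sum; auto | auto].
      rewrite IH by auto.
      extensionality x; extensionality x3. now rewrite Csum_S.
    + extensionality x; extensionality x3. now rewrite Csum_S.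
Qed.

(** * One exponential with a polynomial factor *)

Definition csm (c : R2 -> C) : Prop := Csmooth (fun x _ => c x).

Definition cd1 (i : nat) (c : R2 -> C) (x : R2) : C := cpd i (fun x' _ => c x') x 0.

Lemma cpd_slice i (c : R2 -> C) : i = 1%nat \/ i = 2%nat ->
  cpd i (fun x _ => c x) = fun x _ => cd1 i c x.
Proof. intros [-> | ->]; reflexivity. Qed.

Lemma cpd3_slice (c : R2 -> C) : cpd 3 (fun x _ => c x) = fun _ _ => 0.
Proof.
  extensionality x; extensionality x3.
  apply C_ext; exact (Derive_const _ _).
Qed.

Lemma csm_cd1 i c : i = 1%nat \/ i = 2%nat -> csm c -> csm (cd1 i c).
Proof.
  intros Hi H. unfold csm. rewrite <- (cpd_slice i c Hi). now apply Csmooth_cpd.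
Qed.

Definition zpow (q : par) (l : nat) : R2 -> R -> C := fun _ x3 =>
  RtoC ((x3 - y3 q) ^ l).

Lemma Csmooth_z q : Csmooth (fun _ x3 => RtoC (x3 - y3 q)).
Proof.
  apply Csmooth_RtoC.
  apply (smooth_plus (pt 3) (fun _ _ => - y3 q)%R); [apply smooth_pt | apply smooth_const].
Qed.

Lemma zpow_S q l : zpow q (S l) = fun x x3 => RtoC (x3 - y3 q) * zpow q l x x3.
Proof.
  extensionality x; extensionality x3. unfold zpow. simpl. now rewrite RtoC_mult.
Qed.

Lemma Csmooth_zpow q l : Csmooth (zpow q l).
Proof.
  induction l as [|l IH].
  - exact (Csmooth_const 1).
  - rewrite zpow_S. apply Csmooth_mult; [apply Csmooth_z | exact IH].
Qed.

Lemma cpd_x3 i : i = 1%nat \/ i = 2%nat -> cpd i (fun _ x3 => RtoC x3) = fun _ _ => 0.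
Proof.
  intros Hi. extensionality x; extensionality x3.
  destruct Hi as [-> | ->]; apply C_ext; exact (Derive_const _ _).
Qed.

Lemma cpd3_x3 : cpd 3 (fun _ x3 => RtoC x3) = fun _ _ => 1.
Proof.
  extensionality x; extensionality x3.
  apply C_ext; [exact (Derive_id _) | exact (Derive_const _ _)].
Qed.

Lemma cpd_zpow i q l : i = 1%nat \/ i = 2%nat -> cpd i (zpow q l) = fun _ _ => 0.
Proof.
  intros Hi. extensionality x; extensionality x3.
  destruct Hi as [-> | ->]; apply C_ext; exact (Derive_const _ _).
Qed.

Lemma cpd3_zpow q l :
  cpd 3 (zpow q l) = fun x x3 => INR l * zpow q (l - 1) x x3.
Proof.
  extensionality x; extensionality x3. unfold zpow. rewrite <- RtoC_mult. apply C_ext.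
  - apply is_derive_unique.
    change (is_derive (fun t => ((t - y3 q) ^ l)%R) x3 (INR l * (x3 - y3 q) ^ (l - 1))%R).
    auto_derive; [exact I|]. rewrite Nat.sub_1_r. apply Rmult_1_l.
  - exact (Derive_const _ _).
Qed.

Lemma Csmooth_x3 : Csmooth (fun _ x3 => RtoC x3).
Proof. apply Csmooth_RtoC. apply (smooth_pt 3). Qed.

Ltac Csmooth_tac :=
  lazymatch goal with
  | |- Csmooth (fun x x3 => @?a x x3 - @?b x x3) => apply (Csmooth_minus a b)
  | |- Csmooth (fun x x3 => @?a x x3 * @?b x x3) => apply (Csmooth_mult a b)
  end; try Csmooth_tac; first [assumption | exact Csmooth_x3 | exact (Csmooth_const _)].

Definition phase (b d : R2 -> C) (q : par) (s : R) : R2 -> R -> C := fun x x3 =>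
  b x * RtoC x3 - d x * y3 q - tau q * s
  - Ci * sum_n_m (fun j => co (ypr q) j * xij q j) 1 2.

Definition expph (b d : R2 -> C) (q : par) (s : R) : R2 -> R -> C := fun x x3 =>
  Cexp (phase b d q s x x3).

Lemma Csmooth_phase b d q s : csm b -> csm d -> Csmooth (phase b d q s).
Proof. intros Hb Hd. unfold phase. unfold csm in *. Csmooth_tac. Qed.

Lemma Csmooth_expph b d q s : csm b -> csm d -> Csmooth (expph b d q s).
Proof. intros. now apply Csmooth_Cexp, Csmooth_phase. Qed.

Lemma cpd_minus_const i u c : Csmooth u ->
  cpd i (fun x x3 => u x x3 - c) = cpd i u.
Proof.
  intros H. rewrite (cpd_minus i u (fun _ _ => c) H (Csmooth_const c)), cpd_const.
  extensionality x; extensionality x3. ring.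
Qed.

Lemma cpd_phase i b d q s : csm b -> csm d ->
  cpd i (phase b d q s) = fun x x3 =>
    cpd i (fun x _ => b x) x x3 * RtoC x3 + b x * cpd i (fun _ x3 => RtoC x3) x x3
    - cpd i (fun x _ => d x) x x3 * y3 q.
Proof.
  intros Hb Hd. unfold phase.
  unfold csm in *.
  assert (S1 : Csmooth (fun x x3 => b x * RtoC x3)) by Csmooth_tac.
  assert (S2 : Csmooth (fun x (_ : R) => d x * y3 q)) by Csmooth_tac.
  assert (S3 : Csmooth (fun x x3 => b x * RtoC x3 - d x * y3 q)) by Csmooth_tac.
  assert (S4 : Csmooth (fun x x3 => b x * RtoC x3 - d x * y3 q - tau q * s))
    by Csmooth_tac.
  rewrite (cpd_minus_const i (fun x x3 => b x * RtoC x3 - d x * y3 q - tau q * s))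
    by exact S4.
  rewrite (cpd_minus_const i (fun x x3 => b x * RtoC x3 - d x * y3 q)) by exact S3.
  rewrite (cpd_minus i (fun x x3 => b x * RtoC x3) (fun x _ => d x * y3 q) S1 S2).
  rewrite (cpd_mult i (fun x _ => b x) (fun _ x3 => RtoC x3) Hb Csmooth_x3).
  rewrite (cpd_mult i (fun x _ => d x) (fun _ _ => RtoC (y3 q)) Hd (Csmooth_const _)).
  rewrite cpd_const. extensionality x; extensionality x3. cring.
Qed.

Definition mono (c b d : R2 -> C) (l : nat) (q : par) (s : R) : R2 -> R -> C :=
  fun x x3 => c x * RtoC ((x3 - y3 q) ^ l) * expph b d q s x x3.

Lemma Csmooth_mono c b d l q s : csm c -> csm b -> csm d -> Csmooth (mono c b d l q s).
Proof.
  intros Hc Hb Hd.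
  apply (Csmooth_mult (fun x x3 => c x * zpow q l x x3) (expph b d q s)).
  - apply (Csmooth_mult (fun x x3 => c x) (zpow q l)); [exact Hc | apply Csmooth_zpow].
  - now apply Csmooth_expph.
Qed.

Lemma cpd_mono i c b d l q s : csm c -> csm b -> csm d ->
  cpd i (mono c b d l q s) = fun x x3 =>
    cpd i (fun x _ => c x) x x3 * RtoC ((x3 - y3 q) ^ l) * expph b d q s x x3
    + c x * cpd i (zpow q l) x x3 * expph b d q s x x3
    + c x * RtoC ((x3 - y3 q) ^ l) * (cpd i (phase b d q s) x x3 * expph b d q s x x3).
Proof.
  intros Hc Hb Hd.
  assert (S1 : Csmooth (fun x x3 => c x * zpow q l x x3)).
  { apply (Csmooth_mult (fun x x3 => c x) (zpow q l)); [exact Hc | apply Csmooth_zpow]. }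
  change (mono c b d l q s) with
    (fun x x3 => c x * zpow q l x x3 * expph b d q s x x3).
  rewrite (cpd_mult i (fun x x3 => c x * zpow q l x x3) (expph b d q s) S1
             (Csmooth_expph b d q s Hb Hd)).
  rewrite (cpd_mult i (fun x _ => c x) (zpow q l) Hc (Csmooth_zpow q l)).
  unfold expph at 2.
  rewrite (cpd_Cexp i (phase b d q s) (Csmooth_phase b d q s Hb Hd)).
  extensionality x; extensionality x3. unfold zpow at 1 3, expph. cring.
Qed.

Definition branch (N : nat) (c : nat -> R2 -> C) (b d : R2 -> C) (q : par) (s : R)
    : R2 -> R -> C := fun x x3 =>
  sum_n (fun l => mono (c l) b d l q s x x3) N.

Lemma Csmooth_branch N c b d q s : (forall l, csm (c l)) -> csm b -> csm d ->
  Csmooth (branch N c b d q s).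
Proof. intros Hc Hb Hd. apply Csmooth_sum. intros. now apply Csmooth_mono. Qed.

(** In x_3 a term c z^l exp(b x_3) contributes to the powers l and l - 1 of z. *)
Lemma cpd3_branch N c b d q s : (forall l, csm (c l)) -> csm b -> csm d ->
  (forall x, c (S N) x = 0) ->
  cpd 3 (branch N c b d q s)
  = branch N (fun l x => b x * c l x + INR (l + 1) * c (l + 1)%nat x) b d q s.
Proof.
  intros Hc Hb Hd Z. unfold branch. rewrite (cpd_sum 3 (fun l => mono (c l) b d l q s))
    by (intros; now apply Csmooth_mono).
  extensionality x; extensionality x3.
  set (e := expph b d q s x x3). set (z := fun l => RtoC ((x3 - y3 q) ^ l)).
  transitivity (sum_n (fun l => b x * c l x * z l * e) N
    + sum_n (fun l => INR l * c l x * z (l - 1)%nat * e) N).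
  - rewrite <- Csum_plus. apply Csum_ext. intros l _.
    rewrite cpd_mono, cpd3_slice, cpd3_zpow, cpd_phase, !cpd3_slice, cpd3_x3 by auto.
    unfold zpow. fold e. fold (z l) (z (l - 1)%nat). cring.
  - assert (E : sum_n (fun l => INR l * c l x * z (l - 1)%nat * e) N
      = sum_n (fun l => INR (S l) * c (S l) x * z l * e) N).
    { transitivity (sum_n (fun l => INR l * c l x * z (l - 1)%nat * e) (S N)).
      - rewrite Csum_S, Z. cring.
      - rewrite Csum_shift. simpl INR at 1.
        rewrite (Csum_ext _ (fun l => INR (S l) * c (S l) x * z l * e)); [cring|].
        intros l _. now rewrite Nat.sub_1_r. }
    rewrite E, <- Csum_plus. apply Csum_ext. intros l _.
    rewrite Nat.add_1_r. unfold mono. fold e. fold (z l). cring.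
Qed.

(** In x_i, i = 1, 2, the exponential yields x_3 d b - y_3 d d', which is
    z d b + y_3 (d b - d d'): the degree in z goes up by one. *)
Lemma cpd_branch i N c b d q s : i = 1%nat \/ i = 2%nat ->
  (forall l, csm (c l)) -> csm b -> csm d ->
  (forall x, c (S N) x = 0) ->
  cpd i (branch N c b d q s)
  = branch (S N) (fun l x => cd1 i (c l) x + y3 q * (cd1 i b x - cd1 i d x) * c l x
      + match l with 0%nat => 0 | S l' => cd1 i b x * c l' x end) b d q s.
Proof.
  intros Hi Hc Hb Hd Z. unfold branch. rewrite (cpd_sum i (fun l => mono (c l) b d l q s))
    by (intros; now apply Csmooth_mono).
  extensionality x; extensionality x3.
  set (e := expph b d q s x x3). set (z := fun l => RtoC ((x3 - y3 q) ^ l)).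
  transitivity (sum_n (fun l => (cd1 i (c l) x + y3 q * (cd1 i b x - cd1 i d x) * c l x)
      * z l * e) N
    + sum_n (fun l => cd1 i b x * c l x * z (S l) * e) N).
  - rewrite <- Csum_plus. apply Csum_ext. intros l _.
    rewrite cpd_mono, cpd_slice, cpd_zpow, cpd_phase, !cpd_slice, cpd_x3 by auto.
    fold e. fold (z l).
    replace (z (S l)) with ((RtoC x3 - y3 q) * z l); [cring|].
    unfold z. simpl pow. rewrite RtoC_mult, RtoC_minus. cring.
  - assert (E1 : sum_n (fun l => (cd1 i (c l) x + y3 q * (cd1 i b x - cd1 i d x) * c l x)
        * z l * e) (S N) =
      sum_n (fun l => (cd1 i (c l) x + y3 q * (cd1 i b x - cd1 i d x) * c l x)
        * z l * e) N).
    { rewrite Csum_S. rewrite Z.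
      replace (cd1 i (c (S N)) x) with (RtoC 0); [cring|].
      unfold cd1.
      replace (fun x' (_ : R) => c (S N) x') with (fun (_ : R2) (_ : R) => RtoC 0).
      - now rewrite cpd_const.
      - extensionality x'; extensionality y. now rewrite Z. }
    assert (E2 : sum_n (fun l => match l with 0%nat => 0 | S l' => cd1 i b x * c l' x end
        * z l * e) (S N)
      = sum_n (fun l => cd1 i b x * c l x * z (S l) * e) N).
    { rewrite Csum_shift. cring. }
    rewrite <- E1, <- E2, <- Csum_plus. apply Csum_ext. intros l _.
    unfold mono. fold e. fold (z l). cring.
Qed.

(** * Expansions *)

Definition csmooth2 (c : nat -> nat -> R2 -> C) : Prop := forall l j, csm (c l j).
Definition degree_le (N : nat) (c : nat -> nat -> R2 -> C) : Prop :=
  forall l j x, (N < l)%nat -> c l j x = 0.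

Definition exponents_smooth (q : par) : Prop :=
  csm (lamp q) /\ csm (lamm q) /\ csm (mup q) /\ csm (mum q).

Lemma csm_beta q j : exponents_smooth q -> csm (beta_ j q).
Proof.
  intros (H1 & H2 & H3 & H4). unfold beta_. now do 8 (destruct j as [|j]; auto).
Qed.

Lemma csm_delta q j : exponents_smooth q -> csm (delta_ j q).
Proof.
  intros (H1 & H2 & H3 & H4). unfold delta_. now do 8 (destruct j as [|j]; auto).
Qed.

Lemma expansion_cons j S N c q ell s x x3 :
  expansion (j :: S) N c q ell s x x3 =
  alpha_ ell j * branch N (fun l => c l j) (beta_ j q) (delta_ j q) q s x x3
  + expansion S N c q ell s x x3.
Proof. reflexivity. Qed.

Lemma expansion_cons_fun j S N c q ell s :
  expansion (j :: S) N c q ell s = fun x x3 =>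
  alpha_ ell j * branch N (fun l => c l j) (beta_ j q) (delta_ j q) q s x x3
  + expansion S N c q ell s x x3.
Proof. reflexivity. Qed.

Lemma expansion_ext S N c c' q ell s x x3 :
  (forall l j, (l <= N)%nat -> In j S -> c l j x = c' l j x) ->
  expansion S N c q ell s x x3 = expansion S N c' q ell s x x3.
Proof.
  intros H. induction S as [|j S IH]; [reflexivity|].
  rewrite !expansion_cons, IH by (intros; apply H; simpl; auto).
  f_equal. f_equal. apply Csum_ext. intros l Hl. unfold mono.
  rewrite H by (simpl; auto). reflexivity.
Qed.

Lemma expansion_widen S N N' c q ell s : degree_le N c -> (N <= N')%nat ->
  expansion S N' c q ell s = expansion S N c q ell s.
Proof.
  intros H HN. extensionality x; extensionality x3.
  induction S as [|j S IH]; [reflexivity|].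
  rewrite !expansion_cons, IH. f_equal. f_equal.
  apply Csum_widen; [exact HN|]. intros l Hl. unfold mono. rewrite H by exact Hl. cring.
Qed.

Lemma Csmooth_expansion S N c q ell s : exponents_smooth q -> csmooth2 c ->
  Csmooth (expansion S N c q ell s).
Proof.
  intros He Hc. induction S as [|j S IH].
  - exact (Csmooth_const 0).
  - rewrite expansion_cons_fun. apply Csmooth_plus; [|exact IH].
    apply Csmooth_mult; [apply Csmooth_const|].
    apply Csmooth_branch; [intros; apply Hc | now apply csm_beta | now apply csm_delta].
Qed.

Lemma expansion_plus S N c c' q ell s x x3 :
  expansion S N c q ell s x x3 + expansion S N c' q ell s x x3
  = expansion S N (fun l j x => c l j x + c' l j x) q ell s x x3.
Proof.
  induction S as [|j S IH]; [cbn; cring|].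
  rewrite !expansion_cons, <- IH.
  set (B := branch N (fun l => c l j)). set (B' := branch N (fun l => c' l j)).
  replace (branch N _ (beta_ j q) (delta_ j q) q s x x3) with
    (B (beta_ j q) (delta_ j q) q s x x3 + B' (beta_ j q) (delta_ j q) q s x x3);
    [cring|].
  unfold B, B', branch. rewrite <- Csum_plus. apply Csum_ext. intros.
  unfold mono. cring.
Qed.

Lemma expansion_scal S N c (g : C) q ell s x x3 :
  g * expansion S N c q ell s x x3
  = expansion S N (fun l j x => g * c l j x) q ell s x x3.
Proof.
  induction S as [|j S IH]; [cbn; cring|].
  rewrite !expansion_cons, <- IH. set (B := branch N (fun l => c l j)).
  replace (branch N _ (beta_ j q) (delta_ j q) q s x x3) with
    (g * B (beta_ j q) (delta_ j q) q s x x3); [cring|].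
  unfold B, branch. rewrite <- Csum_scal. apply Csum_ext. intros.
  unfold mono. cring.
Qed.

Lemma expansion_zero S N q ell s x x3 :
  expansion S N (fun _ _ _ => 0) q ell s x x3 = 0.
Proof.
  transitivity (0 * expansion S N (fun _ _ _ => 0) q ell s x x3); [|apply Cmult_0_l].
  rewrite expansion_scal. apply expansion_ext. intros; symmetry; apply Cmult_0_l.
Qed.

Lemma expansion_sum S N (c : nat -> nat -> nat -> R2 -> C) q ell s x x3 n :
  sum_n (fun k => expansion S N (c k) q ell s x x3) n
  = expansion S N (fun l j x => sum_n (fun k => c k l j x) n) q ell s x x3.
Proof.
  induction n as [|n IH].
  - rewrite Csum_O. apply expansion_ext. intros. now rewrite Csum_O.
  - rewrite Csum_S, IH, expansion_plus. apply expansion_ext. intros.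
    now rewrite Csum_S.
Qed.

(** Multiplication by z^n. *)
Definition shift (n : nat) (c : nat -> nat -> R2 -> C) : nat -> nat -> R2 -> C :=
  fun l j x => if Nat.ltb l n then 0 else c (l - n)%nat j x.

Lemma expansion_zmult S N c q ell s x x3 :
  RtoC (x3 - y3 q) * expansion S N c q ell s x x3
  = expansion S (1 + N) (shift 1 c) q ell s x x3.
Proof.
  induction S as [|j S IH]; [cbn; cring|].
  rewrite !expansion_cons, <- IH. unfold branch.
  change (1 + N)%nat with (Datatypes.S N). rewrite Csum_shift. unfold mono, shift.
  rewrite (Csum_ext (fun l => (if Nat.ltb (Datatypes.S l) 1 then 0 else
        c (Datatypes.S l - 1)%nat j x) * RtoC ((x3 - y3 q) ^ Datatypes.S l)
      * expph (beta_ j q) (delta_ j q) q s x x3)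
    (fun l => RtoC (x3 - y3 q) * (c l j x * RtoC ((x3 - y3 q) ^ l)
      * expph (beta_ j q) (delta_ j q) q s x x3))).
  - rewrite Csum_scal. change (Nat.ltb 0 1) with true. cbv iota. cring.
  - intros l _. rewrite Nat.sub_1_r. simpl. rewrite RtoC_mult. cring.
Qed.

Lemma expansion_shift S N c q ell s x x3 n :
  RtoC ((x3 - y3 q) ^ n) * expansion S N c q ell s x x3
  = expansion S (n + N) (shift n c) q ell s x x3.
Proof.
  induction n as [|n IH].
  - simpl pow. rewrite Cmult_1_l. apply expansion_ext.
    intros. unfold shift. simpl. now rewrite Nat.sub_0_r.
  - simpl pow. rewrite RtoC_mult, <- Cmult_assoc, IH, expansion_zmult.
    apply expansion_ext. intros l j _ _. unfold shift.
    destruct l as [|l]; [reflexivity|].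
    replace (Nat.ltb (Datatypes.S l) 1) with false by reflexivity.
    rewrite Nat.sub_1_r. reflexivity.
Qed.

(** * Derivatives of expansions *)

(** d/dx_3 and d/dx_i on the coefficients, as found in [cpd3_branch] and
    [cpd_branch]. *)
Definition d3_coef (q : par) (c : nat -> nat -> R2 -> C) : nat -> nat -> R2 -> C :=
  fun l j x => beta_ j q x * c l j x + INR (l + 1) * c (l + 1)%nat j x.

Definition dx_coef (i : nat) (q : par) (c : nat -> nat -> R2 -> C)
    : nat -> nat -> R2 -> C := fun l j x =>
  cd1 i (c l j) x + y3 q * (cd1 i (beta_ j q) x - cd1 i (delta_ j q) x) * c l j x
  + match l with 0%nat => 0 | S l' => cd1 i (beta_ j q) x * c l' j x end.

Lemma cpd3_expansion S N c q ell s : exponents_smooth q -> csmooth2 c ->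
  degree_le N c ->
  cpd 3 (expansion S N c q ell s) = expansion S N (d3_coef q c) q ell s.
Proof.
  intros He Hc Hd. induction S as [|j S IH]; [exact (cpd_const 3 0)|].
  assert (Sb : Csmooth (branch N (fun l => c l j) (beta_ j q) (delta_ j q) q s)).
  { apply Csmooth_branch; [intros; apply Hc | now apply csm_beta | now apply csm_delta]. }
  rewrite expansion_cons_fun.
  rewrite (cpd_plus 3 (fun x x3 => alpha_ ell j * branch N (fun l => c l j)
      (beta_ j q) (delta_ j q) q s x x3)).
  - rewrite cpd_scal by exact Sb. rewrite IH, cpd3_branch.
    + reflexivity.
    + intros; apply Hc.
    + now apply csm_beta.
    + now apply csm_delta.
    + intros; apply Hd; lia.
  - apply Csmooth_mult; [apply Csmooth_const | exact Sb].
  - now apply Csmooth_expansion.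
Qed.

Lemma cpd_expansion i S N c q ell s : i = 1%nat \/ i = 2%nat ->
  exponents_smooth q -> csmooth2 c -> degree_le N c ->
  cpd i (expansion S N c q ell s) = expansion S (1 + N) (dx_coef i q c) q ell s.
Proof.
  intros Hi He Hc Hd. induction S as [|j S IH]; [exact (cpd_const i 0)|].
  assert (Sb : Csmooth (branch N (fun l => c l j) (beta_ j q) (delta_ j q) q s)).
  { apply Csmooth_branch; [intros; apply Hc | now apply csm_beta | now apply csm_delta]. }
  rewrite expansion_cons_fun.
  rewrite (cpd_plus i (fun x x3 => alpha_ ell j * branch N (fun l => c l j)
      (beta_ j q) (delta_ j q) q s x x3)).
  - rewrite cpd_scal by exact Sb. rewrite IH, cpd_branch.
    + reflexivity.
    + exact Hi.
    + intros; apply Hc.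
    + now apply csm_beta.
    + now apply csm_delta.
    + intros; apply Hd; lia.
  - apply Csmooth_mult; [apply Csmooth_const | exact Sb].
  - now apply Csmooth_expansion.
Qed.

(** * The hierarchy on the level of coefficients *)

Definition coefs : Type := nat -> nat -> R2 -> C.

Definition Dx_coef (a1 a2 : nat) (q : par) (c : coefs) : coefs := fun l j x =>
  (- Ci) ^ (a1 + a2)
  * Nat.iter a1 (dx_coef 1 q) (Nat.iter a2 (dx_coef 2 q) c) l j x.

Definition D3_coef (i : nat) (q : par) (c : coefs) : coefs := fun l j x =>
  (- Ci) ^ i * Nat.iter i (d3_coef q) c l j x.

(** [K i n a1 a2 q x] stands for the coefficient of D_3^i in an operator, after
    n derivatives in x_3, a1 in xi_1 and a2 in xi_2, at x_3 = y_3. *)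
Definition opcoef : Type := nat -> nat -> nat -> nat -> par -> R2 -> C.

Definition frozen_coef (K : opcoef) (n a1 a2 : nat) (q : par) (c : coefs) : coefs :=
  fun l j x => sum_n (fun i => K i n a1 a2 q x * D3_coef i q c l j x) 2.

Definition taylor_weight (n a1 a2 : nat) : R :=
  / (INR (fact a1) * INR (fact a2) * INR (fact n)).

Definition taylor_coef (K : opcoef) (N : nat) (q : par) (c : coefs) : coefs :=
  fun l j x => sum_n (fun a1 => sum_n (fun a2 =>
    let n := (N - a1 - a2)%nat in
    RtoC (taylor_weight n a1 a2)
    * shift n (frozen_coef K n a1 a2 q (Dx_coef a1 a2 q c)) l j x) (N - a1)) N.

Definition theta_coef (K2 K1 : opcoef) (L : nat) (q : par) (m : nat -> coefs)
    : coefs := fun l j x =>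
  sum_n_m (fun N => taylor_coef K2 (L + 1 - N) q (m N) l j x) 1 L
  + sum_n_m (fun N => taylor_coef K1 (L - N) q (m N) l j x) 1 L.

(** [frozen] differentiates the coefficients of its operator; orders refer to
    closed formulas K for the outcome. *)
Definition represents (c : oper) (K : opcoef) (q : par) : Prop :=
  forall i n a1 a2 x, (i <= 2)%nat ->
    CDerive_n (fun t =>
      CDerive_n (fun u1 =>
        CDerive_n (fun u2 => c i x t (u1, u2)) a2 (snd (xi q))) a1 (fst (xi q)))
      n (y3 q) = K i n a1 a2 q x.

Definition opcoef_smooth (K : opcoef) (q : par) : Prop :=
  forall i n a1 a2, csm (K i n a1 a2 q).

(** * Degrees *)

Lemma degree_d3 q N c : degree_le N c -> degree_le N (d3_coef q c).
Proof. intros H l j x Hl. unfold d3_coef. rewrite !H by lia. ring. Qed.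

Lemma degree_dx i q N c : degree_le N c -> degree_le (1 + N) (dx_coef i q c).
Proof.
  intros H l j x Hl. unfold dx_coef. destruct l as [|l]; [lia|].
  rewrite !H by lia. unfold cd1.
  replace (fun x' (_ : R) => c (S l) j x') with (fun (_ : R2) (_ : R) => RtoC 0).
  - rewrite cpd_const. ring.
  - extensionality x'; extensionality y. now rewrite H by lia.
Qed.

Lemma degree_iter_d3 q n N c : degree_le N c ->
  degree_le N (Nat.iter n (d3_coef q) c).
Proof. intros H. induction n; [exact H | now apply degree_d3]. Qed.

Lemma degree_iter_dx i q n N c : degree_le N c ->
  degree_le (n + N) (Nat.iter n (dx_coef i q) c).
Proof. intros H. induction n; [exact H | now apply (degree_dx i q (n + N))]. Qed.

Lemma degree_Dx a1 a2 q N c : degree_le N c ->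
  degree_le (a1 + a2 + N) (Dx_coef a1 a2 q c).
Proof.
  intros H l j x Hl. unfold Dx_coef.
  rewrite (degree_iter_dx 1 q a1 (a2 + N)); [ring | now apply degree_iter_dx | lia].
Qed.

Lemma degree_D3 i q N c : degree_le N c -> degree_le N (D3_coef i q c).
Proof.
  intros H l j x Hl. unfold D3_coef. rewrite (degree_iter_d3 q i N) by assumption. ring.
Qed.

Lemma degree_frozen K n a1 a2 q N c : degree_le N c ->
  degree_le N (frozen_coef K n a1 a2 q c).
Proof.
  intros H l j x Hl. unfold frozen_coef.
  rewrite (Csum_ext _ (fun _ => RtoC 0)); [apply Csum_zero|].
  intros i _. rewrite (degree_D3 i q N) by assumption. apply Cmult_0_r.
Qed.

Lemma degree_shift n N c : degree_le N c -> degree_le (n + N) (shift n c).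
Proof.
  intros H l j x Hl. unfold shift. destruct (Nat.ltb l n); [reflexivity|].
  apply H. lia.
Qed.

(** In each term D_{x'}^alpha raises the degree by |alpha| and the factor z^n
    raises it by n, with n + |alpha| = M. *)
Lemma degree_taylor K M q N c : degree_le N c ->
  degree_le (N + M) (taylor_coef K M q c).
Proof.
  intros H l j x Hl. unfold taylor_coef.
  rewrite (Csum_ext _ (fun _ => RtoC 0)); [apply Csum_zero|]. intros a1 H1.
  rewrite (Csum_ext _ (fun _ => RtoC 0)); [apply Csum_zero|]. intros a2 H2.
  cbv zeta.
  rewrite (degree_shift (M - a1 - a2) (a1 + a2 + N)); [apply Cmult_0_r | | lia].
  now apply degree_frozen, degree_Dx.
Qed.

Lemma Csum1 (a : nat -> C) L : sum_n_m a 1 (S L) = sum_n (fun k => a (S k)) L.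
Proof. symmetry. exact (sum_n_m_S a 0 L). Qed.

Lemma Csum1_ext (a b : nat -> C) L : (forall k, (1 <= k <= L)%nat -> a k = b k) ->
  sum_n_m a 1 L = sum_n_m b 1 L.
Proof. apply (sum_n_m_ext_loc (G := C_AbelianMonoid)). Qed.

Lemma Csum1_zero L : sum_n_m (fun _ => RtoC 0) 1 L = RtoC 0.
Proof. exact (sum_n_m_const_zero (G := C_AbelianMonoid) 1 L). Qed.

(** The term of index N has degree at most 2N - 2 + (L + 1 - N), and N <= L. *)
Lemma degree_theta K2 K1 L q m : (1 <= L)%nat ->
  (forall N, (1 <= N <= L)%nat -> degree_le (2 * N - 2) (m N)) ->
  degree_le (2 * L - 1) (theta_coef K2 K1 L q m).
Proof.
  intros HL H l j x Hl. unfold theta_coef.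
  assert (Z : forall K (F : nat -> nat), (forall N, (F N <= L + 1 - N)%nat) ->
    sum_n_m (fun N => taylor_coef K (F N) q (m N) l j x) 1 L = RtoC 0).
  { intros K F HF. rewrite (Csum1_ext _ (fun _ => RtoC 0)); [apply Csum1_zero|].
    intros N HN. apply (degree_taylor _ _ _ (2 * N - 2)); [auto | specialize (HF N); lia]. }
  rewrite !Z by (intros; lia). apply Cplus_0_l.
Qed.

(** * Smooth coefficients *)

Lemma csm_plus f g : csm f -> csm g -> csm (fun x => f x + g x).
Proof. apply (Csmooth_plus (fun x _ => f x) (fun x _ => g x)). Qed.

Lemma csm_mult f g : csm f -> csm g -> csm (fun x => f x * g x).
Proof. apply (Csmooth_mult (fun x _ => f x) (fun x _ => g x)). Qed.

Lemma csm_const c : csm (fun _ => c).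
Proof. apply Csmooth_const. Qed.

Lemma csm_opp f : csm f -> csm (fun x => - f x).
Proof. apply (Csmooth_opp (fun x _ => f x)). Qed.

Lemma csm_minus f g : csm f -> csm g -> csm (fun x => f x - g x).
Proof. apply (Csmooth_minus (fun x _ => f x) (fun x _ => g x)). Qed.

Lemma csm_inv f : csm f -> (forall x, f x <> 0) -> csm (fun x => / f x).
Proof. intros H N. apply (Csmooth_inv (fun x _ => f x)); auto. Qed.

Lemma csm_div f g : csm f -> csm g -> (forall x, g x <> 0) -> csm (fun x => f x / g x).
Proof. intros Hf Hg N. apply csm_mult; [exact Hf | now apply csm_inv]. Qed.

Lemma csm_sum_n (f : nat -> R2 -> C) n : (forall k, (k <= n)%nat -> csm (f k)) ->
  csm (fun x => sum_n (fun k => f k x) n).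
Proof. apply (Csmooth_sum (fun k x _ => f k x)). Qed.

Lemma csm_sum1 (f : nat -> R2 -> C) n : (forall k, (1 <= k <= n)%nat -> csm (f k)) ->
  csm (fun x => sum_n_m (fun k => f k x) 1 n).
Proof.
  intros H. destruct n as [|n].
  - apply (csm_const 0).
  - eapply Csmooth_ext; [apply (csm_sum_n (fun k => f (S k)) n)|].
    + intros; apply H; lia.
    + intros; cbv beta. now rewrite Csum1.
Qed.

Lemma csm_d3 q c : exponents_smooth q -> csmooth2 c -> csmooth2 (d3_coef q c).
Proof.
  intros He Hc l j. apply csm_plus; apply csm_mult.
  - now apply csm_beta.
  - apply Hc.
  - apply csm_const.
  - apply Hc.
Qed.

Lemma csm_dx i q c : i = 1%nat \/ i = 2%nat -> exponents_smooth q -> csmooth2 c ->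
  csmooth2 (dx_coef i q c).
Proof.
  intros Hi He Hc l j. unfold dx_coef.
  assert (Sb : csm (cd1 i (beta_ j q))) by now apply csm_cd1, csm_beta.
  assert (Sd : csm (cd1 i (delta_ j q))) by now apply csm_cd1, csm_delta.
  apply csm_plus; [apply csm_plus|].
  - now apply csm_cd1.
  - apply csm_mult; [|apply Hc]. apply csm_mult; [apply csm_const|].
    now apply csm_minus.
  - destruct l; [apply csm_const | now apply csm_mult].
Qed.

Lemma csm_iter_d3 q n c : exponents_smooth q -> csmooth2 c ->
  csmooth2 (Nat.iter n (d3_coef q) c).
Proof. intros He Hc. induction n; [exact Hc | now apply csm_d3]. Qed.

Lemma csm_iter_dx i q n c : i = 1%nat \/ i = 2%nat -> exponents_smooth q ->
  csmooth2 c -> csmooth2 (Nat.iter n (dx_coef i q) c).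
Proof. intros Hi He Hc. induction n; [exact Hc | now apply csm_dx]. Qed.

Lemma csm_Dx a1 a2 q c : exponents_smooth q -> csmooth2 c ->
  csmooth2 (Dx_coef a1 a2 q c).
Proof.
  intros He Hc l j. apply csm_mult; [apply csm_const|].
  apply csm_iter_dx; auto. now apply csm_iter_dx; auto.
Qed.

Lemma csm_D3 i q c : exponents_smooth q -> csmooth2 c -> csmooth2 (D3_coef i q c).
Proof.
  intros He Hc l j. apply csm_mult; [apply csm_const|]. now apply csm_iter_d3.
Qed.

Lemma csm_frozen K n a1 a2 q c : opcoef_smooth K q -> exponents_smooth q ->
  csmooth2 c -> csmooth2 (frozen_coef K n a1 a2 q c).
Proof.
  intros HK He Hc l j. apply csm_sum_n. intros i _. apply csm_mult; [apply HK|].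
  now apply csm_D3.
Qed.

Lemma csm_shift n c : csmooth2 c -> csmooth2 (shift n c).
Proof.
  intros Hc l j. unfold shift. destruct (Nat.ltb l n); [apply csm_const | apply Hc].
Qed.

Lemma csm_taylor K M q c : opcoef_smooth K q -> exponents_smooth q ->
  csmooth2 c -> csmooth2 (taylor_coef K M q c).
Proof.
  intros HK He Hc l j. apply csm_sum_n. intros a1 _. apply csm_sum_n. intros a2 _.
  apply csm_mult; [apply csm_const|]. apply csm_shift. now apply csm_frozen, csm_Dx.
Qed.

Lemma csm_theta K2 K1 L q m : opcoef_smooth K2 q -> opcoef_smooth K1 q ->
  exponents_smooth q -> (forall N, (1 <= N <= L)%nat -> csmooth2 (m N)) ->
  csmooth2 (theta_coef K2 K1 L q m).
Proof.
  intros H2 H1 He Hm l j. apply csm_plus; apply csm_sum1; intros N HN;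
    apply csm_taylor; auto.
Qed.

(** * Theta of an expansion *)

Lemma cpdn3_expansion S N n c q ell s : exponents_smooth q -> csmooth2 c ->
  degree_le N c ->
  cpdn 3 n (expansion S N c q ell s) = expansion S N (Nat.iter n (d3_coef q) c) q ell s.
Proof.
  intros He Hc Hd. induction n as [|n IH]; [reflexivity|]. simpl. rewrite IH.
  apply cpd3_expansion; [exact He | now apply csm_iter_d3 | now apply degree_iter_d3].
Qed.

Lemma cpdn_expansion i S N n c q ell s : i = 1%nat \/ i = 2%nat ->
  exponents_smooth q -> csmooth2 c -> degree_le N c ->
  cpdn i n (expansion S N c q ell s)
  = expansion S (n + N) (Nat.iter n (dx_coef i q) c) q ell s.
Proof.
  intros Hi He Hc Hd. induction n as [|n IH]; [reflexivity|]. simpl. rewrite IH.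
  apply cpd_expansion; [exact Hi | exact He | now apply csm_iter_dx
                       | now apply degree_iter_dx].
Qed.

Lemma D3_expansion S N i c q ell s x x3 : exponents_smooth q -> csmooth2 c ->
  degree_le N c ->
  D3 i (expansion S N c q ell s) x x3 = expansion S N (D3_coef i q c) q ell s x x3.
Proof.
  intros He Hc Hd. rewrite D3_cpdn, cpdn3_expansion by assumption.
  apply expansion_scal.
Qed.

Lemma Dx_expansion S N a1 a2 c q ell s : exponents_smooth q -> csmooth2 c ->
  degree_le N c ->
  Dx a1 a2 (expansion S N c q ell s)
  = expansion S (a1 + a2 + N) (Dx_coef a1 a2 q c) q ell s.
Proof.
  intros He Hc Hd. rewrite Dx_cpdn, (cpdn_expansion 2) by auto.
  rewrite (cpdn_expansion 1);
    [|auto|exact He|now apply csm_iter_dx; auto|now apply degree_iter_dx].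
  extensionality x; extensionality x3. rewrite Nat.add_assoc. apply expansion_scal.
Qed.

Lemma frozen_expansion op K n a1 a2 S N c q ell s x x3 : represents op K q ->
  exponents_smooth q -> csmooth2 c -> degree_le N c ->
  frozen op n a1 a2 q (expansion S N c q ell s) x x3
  = expansion S N (frozen_coef K n a1 a2 q c) q ell s x x3.
Proof.
  intros HK He Hc Hd. unfold frozen, frozen_coef.
  rewrite <- (expansion_sum S N
    (fun i l j x => K i n a1 a2 q x * D3_coef i q c l j x) q ell s x x3).
  apply Csum_ext. intros i Hi. rewrite HK, D3_expansion by assumption.
  rewrite expansion_scal. now apply expansion_ext.
Qed.

Lemma taylor_expansion op K M S N c q ell s x x3 : represents op K q ->
  opcoef_smooth K q -> exponents_smooth q -> csmooth2 c -> degree_le N c ->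
  taylor op M q (expansion S N c q ell s) x x3
  = expansion S (N + M) (taylor_coef K M q c) q ell s x x3.
Proof.
  intros HK SK He Hc Hd. unfold taylor, taylor_coef.
  rewrite <- (expansion_sum S (N + M)). apply Csum_ext. intros a1 H1.
  rewrite <- (expansion_sum S (N + M)). apply Csum_ext. intros a2 H2.
  cbv zeta. set (n := (M - a1 - a2)%nat).
  rewrite Dx_expansion by assumption.
  rewrite (frozen_expansion op K) by
    (assumption || now apply csm_Dx || now apply degree_Dx).
  rewrite <- expansion_scal. unfold Rdiv.
  rewrite Rmult_comm, RtoC_mult, <- Cmult_assoc, expansion_shift.
  replace (N + M)%nat with (n + (a1 + a2 + N))%nat by (unfold n; lia).
  reflexivity.
Qed.

Lemma Theta_expansion c2 c1 K2 K1 L S mc q ell s (m : series) x x3 :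
  represents c2 K2 q -> represents c1 K1 q ->
  opcoef_smooth K2 q -> opcoef_smooth K1 q -> exponents_smooth q ->
  (1 <= L)%nat ->
  (forall N, (1 <= N <= L)%nat -> csmooth2 (mc N) /\ degree_le (2 * N - 2) (mc N) /\
     m N = expansion S (2 * N - 2) (mc N) q ell s) ->
  Theta c2 c1 q L m x x3
  = expansion S (2 * L - 1) (theta_coef K2 K1 L q mc) q ell s x x3.
Proof.
  intros R2' R1' S2 S1 He HL Hm. unfold Theta, theta_coef.
  rewrite <- expansion_plus. destruct L as [|L]; [lia|].
  assert (P : forall (c : oper) K (F : nat -> nat), represents c K q ->
    opcoef_smooth K q ->
    (forall N, (1 <= N <= Datatypes.S L)%nat -> (F N <= Datatypes.S L + 1 - N)%nat) ->
    sum_n_m (fun N => taylor c (F N) q (m N) x x3) 1 (Datatypes.S L)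
    = expansion S (2 * Datatypes.S L - 1)
        (fun l j x => sum_n_m (fun N => taylor_coef K (F N) q (mc N) l j x) 1
           (Datatypes.S L)) q ell s x x3).
  { intros c K F HR HS HF.
    rewrite (expansion_ext S _ _ (fun l j x => sum_n (fun N =>
      taylor_coef K (F (Datatypes.S N)) q (mc (Datatypes.S N)) l j x) L))
      by (intros; apply Csum1).
    rewrite <- (expansion_sum S _ (fun N =>
      taylor_coef K (F (Datatypes.S N)) q (mc (Datatypes.S N)))).
    rewrite Csum1. apply Csum_ext. intros N HN.
    destruct (Hm (Datatypes.S N)) as (H1 & H2 & ->); [lia|].
    rewrite (taylor_expansion c K) by assumption.
    symmetry.
    pose proof (HF (Datatypes.S N)).
    rewrite (expansion_widen S (2 * Datatypes.S N - 2 + F (Datatypes.S N)));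
      [reflexivity | now apply degree_taylor | lia]. }
  f_equal; apply P; auto; intros; lia.
Qed.

(** * Operators whose symbols are lists of terms *)

(** Each coefficient is a sum of terms [ot_cst * ot_fun(x) * xi_1^p1 * xi_2^p2]. *)
Record opterm := OpTerm {
  ot_cst : par -> C;
  ot_fun : medium -> R2 -> R -> R;
  ot_p1 : nat;
  ot_p2 : nat
}.

Definition csum {A : Type} (h : A -> C) (l : list A) : C :=
  fold_right Cplus 0 (map h l).

Definition op_at (ts : nat -> list opterm) (q : par) : oper := fun i x t u =>
  csum (fun o => ot_cst o q
    * RtoC (ot_fun o (med q) x t * (fst u ^ ot_p1 o * snd u ^ ot_p2 o))) (ts i).

Definition op_coef (ts : nat -> list opterm) : opcoef := fun i n a1 a2 q x =>
  csum (fun o => ot_cst o q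
    * (RtoC (pds (repeat 3%nat n) (ot_fun o (med q)) x (y3 q))
       * (RtoC (Derive_n (fun u => u ^ ot_p1 o)%R a1 (fst (xi q)))
          * RtoC (Derive_n (fun u => u ^ ot_p2 o)%R a2 (snd (xi q)))))) (ts i).

Lemma csum_ext {A} (h h' : A -> C) l : (forall o, In o l -> h o = h' o) ->
  csum h l = csum h' l.
Proof.
  intros H. induction l as [|o l IH]; [reflexivity|]. unfold csum; simpl.
  rewrite H by (simpl; auto). f_equal. apply IH. intros; apply H; simpl; auto.
Qed.

Lemma csum_cons {A} (h : A -> C) o l : csum h (o :: l) = h o + csum h l.
Proof. reflexivity. Qed.

Lemma csum_scal {A} c (h : A -> C) l : c * csum h l = csum (fun o => c * h o) l.
Proof.
  induction l as [|o l IH]; [cbn; ring|]. rewrite !csum_cons, <- IH. ring.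
Qed.

Lemma part_csum {A} (part : C -> R) (h : A -> C) l : part 0 = 0%R ->
  (forall z w, part (z + w) = (part z + part w)%R) ->
  part (csum h l) = fold_right Rplus 0%R (map (fun o => part (h o)) l).
Proof.
  intros P0 PD. induction l as [|o l IH]; [exact P0|].
  rewrite csum_cons, PD. simpl. now rewrite <- IH.
Qed.

(** The second part is what makes the induction work: the derivative of a sum
    needs the differentiability of both summands near t. *)
Lemma Derive_n_lin {A} (c : A -> R) (g : A -> R -> R) l n t :
  (forall o, In o l ->
     locally t (fun s => forall k, (k <= n)%nat -> ex_derive_n (g o) k s)) ->
  Derive_n (fun s => fold_right Rplus 0%R (map (fun o => (c o * g o s)%R) l)) n t
  = fold_right Rplus 0%R (map (fun o => (c o * Derive_n (g o) n t)%R) l) /\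
  locally t (fun s => forall k, (k <= n)%nat ->
    ex_derive_n (fun s => fold_right Rplus 0%R (map (fun o => (c o * g o s)%R) l)) k s).
Proof.
  induction l as [|o l IH]; intros H.
  - split.
    + destruct n; [reflexivity | exact (Derive_n_const n 0%R t)].
    + apply filter_forall. intros s k _. exact (ex_derive_n_const 0%R k s).
  - destruct IH as [IH1 IH2]; [intros; apply H; simpl; auto|].
    assert (Ho : locally t (fun s => forall k, (k <= n)%nat ->
      ex_derive_n (fun s => (c o * g o s)%R) k s)).
    { apply (filter_imp (fun s => forall k, (k <= n)%nat -> ex_derive_n (g o) k s)).
      - intros s Hs k Hk. now apply ex_derive_n_scal_l, Hs.
      - apply H. simpl; auto. }
    split.
    + simpl. rewrite Derive_n_plus by assumption.
      now rewrite IH1, Derive_n_scal_l.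
    + destruct Ho as [e1 He1], IH2 as [e2 He2].
      assert (P : locally t (fun s => locally s (fun s' => forall k, (k <= n)%nat ->
         ex_derive_n (fun s => (c o * g o s)%R) k s' /\
         ex_derive_n (fun s => fold_right Rplus 0%R
            (map (fun o => (c o * g o s)%R) l)) k s'))).
      { apply (locally_locally t). exists (mkposreal _ (Rmin_stable_in_posreal e1 e2)).
        intros s Hs k Hk. split.
        - apply He1; [|exact Hk]. eapply ball_le; [|exact Hs]. apply Rmin_l.
        - apply He2; [|exact Hk]. eapply ball_le; [|exact Hs]. apply Rmin_r. }
      revert P. apply filter_imp. intros s Hs k Hk. simpl.
      apply ex_derive_n_plus;
        (revert Hs; apply filter_imp; intros s' Hs' k' Hk'; apply Hs'; lia).
Qed.

Lemma CDerive_n_csum {A} (c : A -> C) (g : A -> R -> R) l n t :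
  (forall o, In o l ->
     locally t (fun s => forall k, (k <= n)%nat -> ex_derive_n (g o) k s)) ->
  CDerive_n (fun s => csum (fun o => c o * RtoC (g o s)) l) n t
  = csum (fun o => c o * RtoC (Derive_n (g o) n t)) l.
Proof.
  intros H.
  assert (P : forall part : C -> R, part 0 = 0%R ->
    (forall z w, part (z + w) = (part z + part w)%R) ->
    (forall z (r : R), part (z * RtoC r) = (part z * r)%R) ->
    Derive_n (fun s => part (csum (fun o => c o * RtoC (g o s)) l)) n t
    = part (csum (fun o => c o * RtoC (Derive_n (g o) n t)) l)).
  { intros part P0 PD PM. rewrite (part_csum part _ l P0 PD).
    rewrite (Derive_n_ext _ (fun s => fold_right Rplus 0%R
      (map (fun o => (part (c o) * g o s)%R) l))).
    - rewrite (proj1 (Derive_n_lin (fun o => part (c o)) g l n t H)).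
      f_equal. apply map_ext. intros o. now rewrite PM.
    - intros s. rewrite (part_csum part _ l P0 PD). f_equal. apply map_ext.
      intros o. apply PM. }
  apply C_ext.
  - now apply (P Re); [| |intros; apply re_scal_r].
  - now apply (P Im); [| |intros; apply im_scal_r].
Qed.

Lemma Derive_n_pds g n x t :
  Derive_n (g x) n t = pds (repeat 3%nat n) g x t.
Proof.
  revert t. induction n as [|n IH]; intros t; [reflexivity|].
  simpl. apply Derive_ext. exact IH.
Qed.

Lemma ex_derive_n_slab P g n x t : open_set P -> smooth_on P g -> P t ->
  ex_derive_n (g x) n t.
Proof.
  intros HP Hg Ht. destruct n as [|n]; [exact I|]. simpl.
  apply (ex_derive_ext (line 3 (pds (repeat 3%nat n) g) x t)).
  - intros s. symmetry. apply Derive_n_pds.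
  - now apply (Hg (repeat 3%nat n) x t).
Qed.

Lemma ex_derive_n_mono p k s : ex_derive_n (fun u => u ^ p)%R k s.
Proof. apply ex_derive_n_pow. Qed.

Definition neg : R -> Prop := fun t => (t < 0)%R.

(** In each term the variables x_3, xi_1, xi_2 separate, so each derivative falls
    on one factor. *)
Lemma represents_op_at ts q : (y3 q < 0)%R ->
  (forall i o, In o (ts i) -> smooth_on neg (ot_fun o (med q))) ->
  represents (op_at ts q) (op_coef ts) q.
Proof.
  intros Hy Hs i n a1 a2 x Hi. unfold op_at, op_coef.
  assert (L : forall t (g : R -> R) m,
    (forall k s, ex_derive_n g k s) ->
    locally t (fun s => forall k, (k <= m)%nat -> ex_derive_n g k s)).
  { intros t g m Hg. apply filter_forall. intros; apply Hg. }
  rewrite (CDerive_n_ext _ (fun t => csum (fun o =>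
    (ot_cst o q * (RtoC (Derive_n (fun u => u ^ ot_p1 o)%R a1 (fst (xi q)))
          * RtoC (Derive_n (fun u => u ^ ot_p2 o)%R a2 (snd (xi q)))))
    * RtoC (ot_fun o (med q) x t)) (ts i))).
  - rewrite (CDerive_n_csum _ (fun o => ot_fun o (med q) x)).
    + apply csum_ext. intros o Ho. rewrite Derive_n_pds. ring.
    + intros o Ho. apply (filter_imp neg).
      * intros s Hneg k _. apply (ex_derive_n_slab neg); [apply open_neg | | exact Hneg].
        now apply (Hs i).
      * now apply open_neg.
  - intros t.
    rewrite (CDerive_n_ext _ (fun u1 => csum (fun o =>
      (ot_cst o q * (RtoC (ot_fun o (med q) x t)
         * RtoC (Derive_n (fun u => u ^ ot_p2 o)%R a2 (snd (xi q)))))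
      * RtoC (u1 ^ ot_p1 o)) (ts i))).
    + rewrite (CDerive_n_csum _ (fun o u => (u ^ ot_p1 o)%R)).
      * apply csum_ext. intros o _. ring.
      * intros; apply L; intros; apply ex_derive_n_mono.
    + intros u1. simpl.
      rewrite (CDerive_n_ext _ (fun u2 => csum (fun o =>
        (ot_cst o q * (RtoC (ot_fun o (med q) x t) * RtoC (u1 ^ ot_p1 o)))
        * RtoC (u2 ^ ot_p2 o)) (ts i))).
      * rewrite (CDerive_n_csum _ (fun o u => (u ^ ot_p2 o)%R)).
        -- apply csum_ext. intros o _. ring.
        -- intros; apply L; intros; apply ex_derive_n_mono.
      * intros u2. apply csum_ext. intros o _. rewrite !RtoC_mult. ring.
Qed.

Lemma represents_ext c c' K q : represents c K q ->
  (forall i x t u, (i <= 2)%nat -> c' i x t u = c i x t u) -> represents c' K q.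
Proof.
  intros H E i n a1 a2 x Hi. rewrite <- H by exact Hi.
  apply CDerive_n_ext; intros t. apply CDerive_n_ext; intros u1.
  apply CDerive_n_ext; intros u2. now apply E.
Qed.

Lemma opcoef_smooth_op ts q : (y3 q < 0)%R ->
  (forall i o, In o (ts i) -> smooth_on neg (ot_fun o (med q))) ->
  opcoef_smooth (op_coef ts) q.
Proof.
  intros Hy Hs i n a1 a2. unfold op_coef. specialize (Hs i).
  induction (ts i) as [|o l IH].
  - exact (csm_const 0).
  - apply (csm_plus (fun x => _ * _)); [|apply IH; intros; apply Hs; simpl; auto].
    apply csm_mult; [apply csm_const|]. apply csm_mult; [|apply csm_const].
    apply Csmooth_RtoC. apply (smooth_slice neg); [|exact Hy].
    apply smooth_pds, Hs. simpl; auto.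
Qed.

(** * Orders of the coefficients of Theta *)

Definition coef_order (c : par -> coefs) (m : Z) : Prop :=
  forall l j, of_order (fun q x => c q l j x) (Z.of_nat l + m).

Definition opcoef_order (K : opcoef) (r : Z) : Prop := forall i n a1 a2,
  of_order (K i n a1 a2) (r - Z.of_nat i - Z.of_nat a1 - Z.of_nat a2).

Lemma of_order_Derive_n_pow (v : par -> R) p a : of_order (fun q _ => RtoC (v q)) 1 ->
  of_order (fun q _ => RtoC (Derive_n (fun u => u ^ p)%R a (v q)))
    (Z.of_nat p - Z.of_nat a).
Proof.
  intros Hv. destruct (Compare_dec.le_dec a p) as [H|H].
  - eapply of_order_ext.
    + apply (of_order_eq _ (Z.of_nat (p - a) * 1)).
      * apply (of_order_scal (RtoC (INR (fact p) / INR (fact (p - a))))).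
        apply (of_order_pow _ 1 (p - a) Hv).
      * lia.
    + intros q x. cbv beta. rewrite Derive_n_pow. destruct (le_dec a p); [|lia].
      now rewrite RtoC_mult, RtoC_pow.
  - eapply of_order_ext; [apply of_order_zero|].
    intros q x. cbv beta. rewrite Derive_n_pow. now destruct (le_dec a p); [lia|].
Qed.

Definition opterm_order (o : opterm) (m : Z) : Prop :=
  (exists m', of_order (fun q _ => ot_cst o q) m' /\
     m = (m' + Z.of_nat (ot_p1 o) + Z.of_nat (ot_p2 o))%Z) /\
  forall n, of_order (fun q x =>
    RtoC (pds (repeat 3%nat n) (ot_fun o (med q)) x (y3 q))) 0.

Lemma opcoef_order_op ts r :
  (forall i o, In o (ts i) -> opterm_order o (r - Z.of_nat i)) ->
  opcoef_order (op_coef ts) r.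
Proof.
  intros H i n a1 a2. unfold op_coef. specialize (H i).
  induction (ts i) as [|o l IH]; [apply of_order_zero|].
  apply (of_order_plus (fun q x => _ * _)); [|apply IH; intros; apply H; simpl; auto].
  destruct (H o) as [(m' & Hc & E) Hf]; [simpl; auto|].
  eapply (of_order_mult (fun q _ => ot_cst o q)); [exact Hc | | ].
  - eapply (of_order_mult (fun q x => RtoC (pds _ _ x (y3 q)))); [apply Hf| |reflexivity].
    eapply (of_order_mult (fun q _ => RtoC (Derive_n _ _ _))); [| |reflexivity].
    + apply of_order_Derive_n_pow. apply (of_order_xi 1).
    + apply of_order_Derive_n_pow. apply (of_order_xi 2).
  - lia.
Qed.

Lemma order_d3 c m : coef_order c m -> coef_order (fun q => d3_coef q (c q)) (m + 1).
Proof.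
  intros H l j. unfold d3_coef. apply of_order_plus.
  - eapply (of_order_mult (beta_ j)); [apply of_order_beta | apply H | lia].
  - apply (of_order_scal (INR (l + 1)) (fun q x => c q (l + 1)%nat j x)).
    eapply of_order_eq; [apply H | lia].
Qed.

Lemma of_order_y3 : of_order (fun q _ => RtoC (y3 q)) (-1).
Proof.
  eapply of_order_ext; [apply (of_order_opp _ _ of_order_my3)|].
  intros; cbv beta. rewrite RtoC_opp. ring.
Qed.

(** A derivative of beta or delta has order 1, but it is multiplied by z, which
    shifts the index l, or by y_3. *)
Lemma order_dx i c m : i = 1%nat \/ i = 2%nat -> coef_order c m ->
  coef_order (fun q => dx_coef i q (c q)) m.
Proof.
  intros Hi H l j. unfold dx_coef.
  assert (Hb : of_order (cd i (beta_ j)) 1) by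
    (apply of_order_cd; [exact Hi | apply of_order_beta]).
  assert (Hd : of_order (cd i (delta_ j)) 1) by
    (apply of_order_cd; [exact Hi | apply of_order_delta]).
  apply (of_order_plus (fun q x => _ + _)); [apply (of_order_plus (fun q x => _))|].
  - apply (of_order_cd i (fun q x => c q l j x)); auto.
  - eapply (of_order_mult (fun q x => _ * _) (fun q x => c q l j x)); [|apply H|].
    + eapply (of_order_mult (fun q _ => RtoC (y3 q)));
        [apply of_order_y3 | apply (of_order_minus _ _ _ Hb Hd) | reflexivity].
    + lia.
  - destruct l as [|l]; [apply of_order_zero|].
    eapply (of_order_mult (cd i (beta_ j)) (fun q x => c q l j x)); [exact Hb | apply H | lia].
Qed.

Lemma order_iter_d3 n c m : coef_order c m ->
  coef_order (fun q => Nat.iter n (d3_coef q) (c q)) (m + Z.of_nat n).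
Proof.
  intros H. induction n as [|n IH].
  - intros l j. eapply of_order_eq; [apply H | lia].
  - intros l j. eapply of_order_eq; [apply (order_d3 _ _ IH l j) | lia].
Qed.

Lemma order_iter_dx i n c m : i = 1%nat \/ i = 2%nat -> coef_order c m ->
  coef_order (fun q => Nat.iter n (dx_coef i q) (c q)) m.
Proof.
  intros Hi H. induction n as [|n IH]; [exact H|]. now apply (order_dx i _ _ Hi IH).
Qed.

Lemma order_Dx a1 a2 c m : coef_order c m ->
  coef_order (fun q => Dx_coef a1 a2 q (c q)) m.
Proof.
  intros H l j. apply (of_order_scal _ (fun q x => Nat.iter a1 (dx_coef 1 q)
    (Nat.iter a2 (dx_coef 2 q) (c q)) l j x)).
  apply (order_iter_dx 1 a1 (fun q => Nat.iter a2 (dx_coef 2 q) (c q))); [auto|].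
  apply order_iter_dx; auto.
Qed.

Lemma order_D3 i c m : coef_order c m ->
  coef_order (fun q => D3_coef i q (c q)) (m + Z.of_nat i).
Proof.
  intros H l j. apply (of_order_scal _ (fun q x => Nat.iter i (d3_coef q) (c q) l j x)).
  now apply order_iter_d3.
Qed.

Lemma order_frozen K r n a1 a2 c m : opcoef_order K r -> coef_order c m ->
  coef_order (fun q => frozen_coef K n a1 a2 q (c q))
    (m + r - Z.of_nat a1 - Z.of_nat a2).
Proof.
  intros HK H l j. unfold frozen_coef.
  apply (of_order_sum_n (fun i q x => K i n a1 a2 q x * D3_coef i q (c q) l j x)).
  intros i _. eapply (of_order_mult (K i n a1 a2) (fun q x => D3_coef i q (c q) l j x)).
  - apply HK.
  - now apply order_D3.
  - lia.
Qed.

Lemma order_shift n c m : coef_order c m ->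
  coef_order (fun q => shift n (c q)) (m - Z.of_nat n).
Proof.
  intros H l j. unfold shift. destruct (Nat.ltb_spec l n) as [Hl|Hl].
  - apply of_order_zero.
  - eapply of_order_eq; [apply H | lia].
Qed.

Lemma order_taylor K r M c m : opcoef_order K r -> coef_order c m ->
  coef_order (fun q => taylor_coef K M q (c q)) (m + r - Z.of_nat M).
Proof.
  intros HK H l j. unfold taylor_coef.
  apply (of_order_sum_n (fun a1 q x => sum_n _ (M - a1))). intros a1 H1.
  apply (of_order_sum_n (fun a2 q x => RtoC (taylor_weight (M - a1 - a2) a1 a2)
    * shift (M - a1 - a2) (frozen_coef K (M - a1 - a2) a1 a2 q
        (Dx_coef a1 a2 q (c q))) l j x)). intros a2 H2.
  apply (of_order_scal _ (fun q x => shift (M - a1 - a2)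
    (frozen_coef K (M - a1 - a2) a1 a2 q (Dx_coef a1 a2 q (c q))) l j x)).
  eapply of_order_eq.
  - apply (order_shift (M - a1 - a2) _ (m + r - Z.of_nat a1 - Z.of_nat a2)).
    apply (order_frozen K r _ a1 a2 (fun q => Dx_coef a1 a2 q (c q))); [exact HK|].
    now apply order_Dx.
  - lia.
Qed.

(** With n + |alpha| = L + 1 - N the term of index N has order
    (l - N) + 2 - |alpha| - n = l + 1 - L; the terms with p_1 lose 1 from the
    symbol and gain 1 from n + |alpha| = L - N. *)
Lemma order_theta K2 K1 L (f : nat -> par -> coefs) :
  opcoef_order K2 2 -> opcoef_order K1 1 ->
  (forall N, (1 <= N <= L)%nat -> coef_order (f N) (- Z.of_nat N)) ->
  coef_order (fun q => theta_coef K2 K1 L q (fun N => f N q)) (1 - Z.of_nat L).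
Proof.
  intros H2 H1 H l j. unfold theta_coef.
  apply (of_order_plus (fun q x => sum_n_m _ _ _)).
  - apply (of_order_sum_n_m (fun N q x => taylor_coef K2 (L + 1 - N) q (f N q) l j x)).
    intros N HN. eapply of_order_eq;
      [apply (order_taylor K2 2 (L + 1 - N) (f N) (- Z.of_nat N)); auto | lia].
  - apply (of_order_sum_n_m (fun N q x => taylor_coef K1 (L - N) q (f N q) l j x)).
    intros N HN. eapply of_order_eq;
      [apply (order_taylor K1 1 (L - N) (f N) (- Z.of_nat N)); auto | lia].
Qed.

Lemma Csum12 (a : nat -> C) : sum_n_m a 1 2 = a 1%nat + a 2%nat.
Proof. rewrite (Csum1 a 1), Csum_S, Csum_O. reflexivity. Qed.

Lemma Csum13 (a : nat -> C) : sum_n_m a 1 3 = a 1%nat + a 2%nat + a 3%nat.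
Proof. rewrite (Csum1 a 2), !Csum_S, Csum_O. reflexivity. Qed.

Lemma Rsum13 (a : nat -> R) : sum_n_m a 1 3 = (a 1%nat + a 2%nat + a 3%nat)%R.
Proof.
  rewrite (sum_n_Sm (G := R_AbelianMonoid) a 1 2) by lia.
  rewrite (sum_n_Sm (G := R_AbelianMonoid) a 1 1) by lia.
  rewrite (sum_n_n (G := R_AbelianMonoid)). reflexivity.
Qed.

(** * The medium *)

Lemma smooth_closed_neg g : smooth_closed g -> smooth_on neg g.
Proof.
  intros (G & HG & E). apply (smooth_on_eq neg G); [apply open_neg | |].
  - intros x x3 H. apply E. unfold neg in H. lra.
  - intros w x x3 _. apply HG.
Qed.

Lemma smooth_closed_slice g t : smooth_closed g -> (t <= 0)%R ->
  csm (fun x => RtoC (g x t)).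
Proof.
  intros (G & HG & E) Ht.
  apply (Csmooth_ext (fun x _ => RtoC (G x t))).
  - apply Csmooth_RtoC. apply (smooth_slice everywhere); [|exact I].
    now apply smooth_everywhere.
  - intros x _. now rewrite E.
Qed.

Lemma mm_smooth_closed D j l : admissible D -> (1 <= j <= 3)%nat ->
  (1 <= l <= 3)%nat -> smooth_closed (mm D j l).
Proof. intros (_ & H & _) Hj Hl. now apply H. Qed.

(** Ellipticity in the direction e_3. *)
Lemma mm33_pos D x x3 : admissible D -> (x3 <= 0)%R -> (0 < mm D 3 3 x x3)%R.
Proof.
  intros (_ & _ & (c & Hc & H) & _) Hx.
  specialize (H x x3 Hx (fun j => if Nat.eqb j 3 then 1 else 0)%R).
  rewrite !Rsum13 in H. simpl in H.
  lra.
Qed.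

Lemma ww_smooth D j : admissible D -> (1 <= j <= 3)%nat -> smooth_on neg (ww D j).
Proof.
  intros HD Hj. pose proof HD as (_ & Hm & _ & HJ & HJp).
  apply smooth_on_closure; [apply open_neg|].
  replace (ww D j) with (fun x x3 => / JJ D x x3 *
    (mm D j 1 x x3 * pd 1 (JJ D) x x3 + mm D j 2 x x3 * pd 2 (JJ D) x x3
     + mm D j 3 x x3 * pd 3 (JJ D) x x3))%R.
  - assert (S : forall l, (1 <= l <= 3)%nat ->
      smooth_closure neg (fun x x3 => mm D j l x x3 * pd l (JJ D) x x3)%R).
    { intros l Hl. apply sc_mult; apply sc_smooth.
      - now apply smooth_closed_neg, mm_smooth_closed.
      - now apply smooth_pd, smooth_closed_neg. }
    apply (sc_mult neg (fun x x3 => / JJ D x x3)%R).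
    + apply sc_inv; [now apply sc_smooth, smooth_closed_neg|].
      intros x x3 H. unfold neg in H. specialize (HJp x x3 ltac:(lra)). lra.
    + apply (sc_plus neg (fun x x3 => _ + _)%R (fun x x3 => _)%R); [|apply S; lia].
      apply (sc_plus neg (fun x x3 => _)%R (fun x x3 => _)%R); apply S; lia.
  - extensionality x; extensionality x3. unfold ww. now rewrite Rsum13.
Qed.

(** * The symbols p_2, p_1, q_2, q_1 *)

Definition one_fun : medium -> R2 -> R -> R := fun _ _ _ => 1%R.
Definition mm_fun (j l : nat) : medium -> R2 -> R -> R := fun D => mm D j l.
Definition dmm_fun (j l : nat) : medium -> R2 -> R -> R := fun D => pd j (mm D j l).
Definition ww_fun (j : nat) : medium -> R2 -> R -> R := fun D => ww D j.

Definition cst (c : C) : par -> C := fun _ => c.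

Definition quadratic_terms : list opterm :=
  [ OpTerm (cst 1) (mm_fun 1 1) 2 0; OpTerm (cst 1) (mm_fun 1 2) 1 1;
    OpTerm (cst 1) (mm_fun 2 1) 1 1; OpTerm (cst 1) (mm_fun 2 2) 0 2 ].

Definition D3_terms : list opterm :=
  [ OpTerm (cst 2) (mm_fun 3 1) 1 0; OpTerm (cst 2) (mm_fun 3 2) 0 1 ].

Definition D33_terms : list opterm := [ OpTerm (cst 1) (mm_fun 3 3) 0 0 ].

Definition tau_term : opterm := OpTerm tau one_fun 0 0.

Definition p2_terms (i : nat) : list opterm :=
  match i with
  | 0%nat => tau_term :: quadratic_terms
  | 1%nat => D3_terms
  | 2%nat => D33_terms
  | _ => []
  end.

Definition p1_terms (i : nat) : list opterm :=
  match i with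
  | 0%nat => map (fun '(g, a, b) => OpTerm (cst (- Ci)) g a b)
      [ (dmm_fun 1 1, 1, 0); (dmm_fun 2 1, 1, 0); (dmm_fun 3 1, 1, 0);
        (dmm_fun 1 2, 0, 1); (dmm_fun 2 2, 0, 1); (dmm_fun 3 2, 0, 1);
        (ww_fun 1, 1, 0); (ww_fun 2, 0, 1) ]%nat
  | 1%nat => map (fun g => OpTerm (cst (- Ci)) g 0 0)
      [ dmm_fun 1 3; dmm_fun 2 3; dmm_fun 3 3; ww_fun 3 ]
  | _ => []
  end.

Definition times_k (o : opterm) : opterm :=
  OpTerm (fun q => kk (med q) * ot_cst o q) (ot_fun o) (ot_p1 o) (ot_p2 o).

Definition q2_terms (i : nat) : list opterm :=
  match i with
  | 0%nat => tau_term :: map times_k quadratic_terms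
  | _ => map times_k (p2_terms i)
  end.

Definition q1_terms (i : nat) : list opterm := map times_k (p1_terms i).

Definition Kp2 : opcoef := op_coef p2_terms.
Definition Kp1 : opcoef := op_coef p1_terms.
Definition Kq2 : opcoef := op_coef q2_terms.
Definition Kq1 : opcoef := op_coef q1_terms.

Lemma terms_smooth D : admissible D ->
  (forall i o, In o (p2_terms i) -> smooth_on neg (ot_fun o D)) /\
  (forall i o, In o (p1_terms i) -> smooth_on neg (ot_fun o D)) /\
  (forall i o, In o (q2_terms i) -> smooth_on neg (ot_fun o D)) /\
  (forall i o, In o (q1_terms i) -> smooth_on neg (ot_fun o D)).
Proof.
  intros HD.
  assert (S1 : smooth_on neg (one_fun D)).
  { intros w x x3 _. apply (smooth_const 1 w x x3). }
  assert (Sm : forall j l, (1 <= j <= 3)%nat -> (1 <= l <= 3)%nat ->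
    smooth_on neg (mm_fun j l D)).
  { intros. now apply smooth_closed_neg, mm_smooth_closed. }
  assert (Sd : forall j l, (1 <= j <= 3)%nat -> (1 <= l <= 3)%nat ->
    smooth_on neg (dmm_fun j l D)).
  { intros. now apply smooth_pd, Sm. }
  assert (Sw : forall j, (1 <= j <= 3)%nat -> smooth_on neg (ww_fun j D)).
  { intros. now apply ww_smooth. }
  refine (conj _ (conj _ (conj _ _))); intros [|[|[|i]]] o Ho; simpl in Ho;
    repeat (destruct Ho as [<- | Ho]; [cbn [ot_fun times_k tau_term map];
      lazymatch goal with
      | |- smooth_on _ (one_fun _) => exact S1
      | |- smooth_on _ (mm_fun _ _ _) => apply Sm; lia
      | |- smooth_on _ (dmm_fun _ _ _) => apply Sd; lia
      | |- smooth_on _ (ww_fun _ _) => apply Sw; lia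
      end|]);
    destruct Ho.
Qed.

Lemma p2_op_at D q : med q = D -> forall i x t u, (i <= 2)%nat ->
  p2 D (tau q) i x t u = op_at p2_terms q i x t u.
Proof.
  intros <- i x t [u1 u2] Hi. destruct i as [|[|[|i]]]; [| | |lia];
    unfold p2, op_at, csum, p2_terms; cbn [map fold_right quadratic_terms D3_terms
      D33_terms tau_term ot_cst ot_fun ot_p1 ot_p2 cst]; rewrite ?Csum12;
    cbv beta; unfold co, mm_fun, one_fun, cst; cbn [fst snd];
    rewrite ?RtoC_mult; cbn [pow]; rewrite ?RtoC_mult; ring.
Qed.

Lemma p1_op_at D q : med q = D -> forall i x t u, (i <= 2)%nat ->
  p1 D i x t u = op_at p1_terms q i x t u.
Proof.
  intros <- i x t [u1 u2] Hi. destruct i as [|[|[|i]]]; [| | |lia];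
    unfold p1, op_at, csum, p1_terms; cbn [map fold_right ot_cst ot_fun ot_p1 ot_p2];
    rewrite ?Csum13, ?Csum12;
    cbv beta; unfold co, dmm_fun, ww_fun, cst; cbn [fst snd pow];
    rewrite ?RtoC_mult; ring.
Qed.

Lemma op_at_times_k ts q i x t u :
  op_at (fun i => map times_k (ts i)) q i x t u = kk (med q) * op_at ts q i x t u.
Proof.
  unfold op_at. rewrite csum_scal. unfold csum. rewrite map_map.
  f_equal. apply map_ext. intros o. simpl. symmetry. apply Cmult_assoc.
Qed.

Lemma q1_op_at D q : med q = D -> forall i x t u, (i <= 2)%nat ->
  q1 D i x t u = op_at q1_terms q i x t u.
Proof.
  intros HD i x t u Hi. unfold q1, q1_terms.
  rewrite (op_at_times_k p1_terms), <- (p1_op_at D) by assumption. now rewrite HD.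
Qed.

Lemma q2_op_at D q : med q = D -> forall i x t u, (i <= 2)%nat ->
  q2 D (tau q) i x t u = op_at q2_terms q i x t u.
Proof.
  intros HD i x t u Hi. destruct i as [|i].
  - unfold q2. rewrite (p2_op_at D q HD) by lia.
    unfold op_at, q2_terms, p2_terms. rewrite !csum_cons.
    unfold csum at 2. rewrite map_map. fold (csum (A := opterm)).
    transitivity (tau q + kk D * csum (fun o => ot_cst o q
      * RtoC (ot_fun o (med q) x t * (fst u ^ ot_p1 o * snd u ^ ot_p2 o)))
      quadratic_terms).
    + cbn [tau_term ot_cst ot_fun ot_p1 ot_p2 pow]. unfold one_fun.
      rewrite !Rmult_1_r. ring.
    + cbn [tau_term ot_cst ot_fun ot_p1 ot_p2 pow]. unfold one_fun.
      rewrite !Rmult_1_r. rewrite csum_scal. f_equal; [ring|].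
      unfold csum. f_equal. apply map_ext. intros o. simpl. rewrite HD.
      apply Cmult_assoc.
  - change (q2 D (tau q) (S i) x t u) with (kk D * p2 D (tau q) (S i) x t u).
    rewrite (p2_op_at D q HD) by lia.
    change (q2_terms (S i)) with (map times_k (p2_terms (S i))).
    rewrite <- HD. symmetry. apply (op_at_times_k p2_terms).
Qed.

Lemma symbols_represented D q : admissible D -> med q = D -> (y3 q < 0)%R ->
  represents (p2 D (tau q)) Kp2 q /\ represents (p1 D) Kp1 q /\
  represents (q2 D (tau q)) Kq2 q /\ represents (q1 D) Kq1 q.
Proof.
  intros HD Hq Hy. destruct (terms_smooth D HD) as (H1 & H2 & H3 & H4). subst D.
  refine (conj _ (conj _ (conj _ _))).
  - apply (represents_ext (op_at p2_terms q)); [now apply represents_op_at|].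
    now apply p2_op_at.
  - apply (represents_ext (op_at p1_terms q)); [now apply represents_op_at|].
    now apply p1_op_at.
  - apply (represents_ext (op_at q2_terms q)); [now apply represents_op_at|].
    now apply q2_op_at.
  - apply (represents_ext (op_at q1_terms q)); [now apply represents_op_at|].
    now apply q1_op_at.
Qed.

Lemma symbols_smooth q : admissible (med q) -> (y3 q < 0)%R ->
  opcoef_smooth Kp2 q /\ opcoef_smooth Kp1 q /\
  opcoef_smooth Kq2 q /\ opcoef_smooth Kq1 q.
Proof.
  intros HD Hy. destruct (terms_smooth (med q) HD) as (H1 & H2 & H3 & H4).
  refine (conj _ (conj _ (conj _ _))); now apply opcoef_smooth_op.
Qed.

Lemma symbols_order :
  opcoef_order Kp2 2 /\ opcoef_order Kp1 1 /\
  opcoef_order Kq2 2 /\ opcoef_order Kq1 1.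
Proof.
  assert (W : forall g, (exists e : nat -> expr, forall n, has_ord (e n) 0 /\
      forall q x, RtoC (pds (repeat 3%nat n) (g (med q)) x (y3 q)) = eval (e n) q x) ->
    forall n, of_order (fun q x =>
      RtoC (pds (repeat 3%nat n) (g (med q)) x (y3 q))) 0).
  { intros g (e & He) n. exists (e n). apply He. }
  assert (O1 : forall n, of_order (fun q x =>
      RtoC (pds (repeat 3%nat n) (one_fun (med q)) x (y3 q))) 0).
  { intros n. eapply of_order_ext;
      [apply (of_order_const (RtoC (if Nat.eqb n 0 then 1 else 0)))|].
    intros q x. cbv beta. rewrite <- (Derive_n_pds (one_fun (med q))).
    destruct n; [reflexivity|].
    apply (f_equal RtoC). change (Derive_n (fun _ => 1%R) (S n) (y3 q) = 0%R).
    apply Derive_n_const. }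
  assert (Om : forall j l n, of_order (fun q x =>
      RtoC (pds (repeat 3%nat n) (mm_fun j l (med q)) x (y3 q))) 0).
  { intros j l. apply W. exists (fun n => Em1 (repeat 3%nat n) j l).
    intros n; split; [constructor | reflexivity]. }
  assert (Od : forall j l n, of_order (fun q x =>
      RtoC (pds (repeat 3%nat n) (dmm_fun j l (med q)) x (y3 q))) 0).
  { intros j l. apply W. exists (fun n => Em1 (repeat 3%nat n ++ [j]) j l).
    intros n; split; [constructor|]. intros. simpl. now rewrite pds_app. }
  assert (Ow : forall j n, of_order (fun q x =>
      RtoC (pds (repeat 3%nat n) (ww_fun j (med q)) x (y3 q))) 0).
  { intros j. apply W. exists (fun n => Ew1 (repeat 3%nat n) j).
    intros n; split; [constructor | reflexivity]. }
  pose proof of_order_tau as Ot.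
  assert (Oc : forall c, of_order (fun q _ => cst c q) 0) by
    (intros c; exact (of_order_const c)).
  assert (Ok : forall c m, of_order (fun q _ => c q) m ->
    of_order (fun q _ => kk (med q) * c q) m).
  { intros c m H.
    apply (of_order_mult (fun q _ => RtoC (kk (med q))) (fun q _ => c q) 0 m);
      [apply of_order_k | exact H | reflexivity]. }
  refine (conj _ (conj _ (conj _ _))); apply opcoef_order_op;
    intros [|[|[|i]]] o Ho; simpl in Ho;
    repeat (destruct Ho as [<- | Ho];
      [split; cbn [ot_fun ot_cst ot_p1 ot_p2 times_k tau_term map];
      [eexists; split; [lazymatch goal with
       | |- context [kk] => apply Ok, Oc
       | |- context [cst] => apply Oc
       | _ => apply Ot
       end|reflexivity]
      |lazymatch goal with
       | |- context [one_fun] => exact O1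
       | |- context [mm_fun] => apply Om
       | |- context [dmm_fun] => apply Od
       | |- context [ww_fun] => apply Ow
       end]|]);
    destruct Ho.
Qed.

(** * The coefficients of the amplitudes *)

Definition flux0 (b : symbol) : symbol := fun q x => Ci * R0 q x + b q x * m0 3 3 q x.

Definition coefA1 : symbol := fun q x => invJy q / (m1 3 3 q x * (lamp q x - lamm q x)).
Definition coefB1 : symbol := fun q x =>
  invJy q / (kk (med q) * m1 3 3 q x * (mup q x - mum q x)).
Definition coefA2 : symbol := fun q x =>
  / Delta0 q x * (lamm q x - lamp q x) * m0 3 3 q x * coefA1 q x.
Definition coefB2 : symbol := fun q x =>
  / Delta0 q x * (flux0 lamp q x - kk (med q) * flux0 mum q x) * coefB1 q x.

Definition first_coef (q : par) : coefs := fun l j x =>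
  if Nat.eqb l 0 then
    match j with
    | 1%nat => - coefA1 q x + coefA2 q x
    | 2%nat => coefB1 q x + coefB2 q x
    | 3%nat | 4%nat => coefA1 q x
    | 5%nat => coefA2 q x
    | 6%nat => coefB2 q x
    | _ => coefB1 q x
    end
  else 0.

(** [descent L q E n] is F_{2L+1-n}. Starting from F_{2L+1} = 0 makes the formula
    for F_{2L} an instance of the recursion. *)
Fixpoint descent (L : nat) (q : par) (E : coefs) (n j : nat) (x : R2) : C :=
  match n with
  | 0%nat => 0
  | S n' =>
      let l := (2 * L - S n')%nat in
      (E l j x - INR (l + 2) * INR (l + 1) * gamma_ (med q) j * m1 3 3 q x
                 * descent L q E n' j x)
      / (2 * INR (l + 1) * gamma_ (med q) j
         * (beta_ j q x * m1 3 3 q x + Ci * R1 q x))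
  end.

Definition ypow (q : par) (l : nat) : C := RtoC ((- y3 q) ^ l).

Definition coefC3 (q : par) (F : coefs) (x : R2) : C :=
  (F 1%nat 3%nat x - F 1%nat 4%nat x) / (lamp q x - lamm q x).
Definition coefC9 (q : par) (F : coefs) (x : R2) : C :=
  (F 1%nat 7%nat x - F 1%nat 8%nat x) / (mup q x - mum q x).

Definition coefA3 (L : nat) (q : par) (F : coefs) (x : R2) : C :=
  - sum_n_m (fun l =>
      (F l 1%nat x + F l 3%nat x - F l 5%nat x) * ypow q l) 1 (2 * L).
Definition coefB3 (L : nat) (q : par) (F : coefs) (x : R2) : C :=
  - sum_n_m (fun l =>
      (F l 2%nat x - F l 6%nat x - F l 7%nat x) * ypow q l) 1 (2 * L).

Definition coefA4 (L : nat) (q : par) (F : coefs) (x : R2) : C :=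
  - (Ci * R0 q x * sum_n_m (fun l =>
        (F l 1%nat x + F l 3%nat x) * ypow q l) 1 (2 * L))
  - m0 3 3 q x * sum_n_m (fun l =>
      INR l * (F l 1%nat x + F l 3%nat x) * ypow q (l - 1)
      + (lamp q x * F l 1%nat x + lamm q x * F l 3%nat x) * ypow q l) 1 (2 * L)
  + kk (med q) * (Ci * R0 q x) * sum_n_m (fun l => F l 5%nat x * ypow q l) 1 (2 * L)
  + kk (med q) * m0 3 3 q x * sum_n_m (fun l =>
      INR l * F l 5%nat x * ypow q (l - 1) + mup q x * F l 5%nat x * ypow q l)
      1 (2 * L).
Definition coefB4 (L : nat) (q : par) (F : coefs) (x : R2) : C :=
  - (Ci * R0 q x * sum_n_m (fun l => F l 2%nat x * ypow q l) 1 (2 * L))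
  - m0 3 3 q x * sum_n_m (fun l =>
      INR l * F l 2%nat x * ypow q (l - 1) + lamp q x * F l 2%nat x * ypow q l)
      1 (2 * L)
  + kk (med q) * (Ci * R0 q x) * sum_n_m (fun l =>
      (F l 6%nat x + F l 7%nat x) * ypow q l) 1 (2 * L)
  + kk (med q) * m0 3 3 q x * sum_n_m (fun l =>
      INR l * (F l 6%nat x + F l 7%nat x) * ypow q (l - 1)
      + (mup q x * F l 6%nat x + mum q x * F l 7%nat x) * ypow q l) 1 (2 * L).

Definition coefA5 L q F x := coefA3 L q F x - coefC3 q F x.
Definition coefB5 L q F x := coefB3 L q F x + coefC9 q F x.
Definition coefA6 L q F x := coefA4 L q F x - flux0 lamm q x * coefC3 q F x.
Definition coefB6 L q F x :=
  coefB4 L q F x + kk (med q) * flux0 mum q x * coefC9 q F x.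
Definition coefA7 L q F x :=
  / Delta0 q x * (flux0 lamp q x * coefA5 L q F x - coefA6 L q F x).
Definition coefB7 L q F x :=
  / Delta0 q x * (flux0 lamp q x * coefB5 L q F x - coefB6 L q F x).

Definition zeroth_coef (L : nat) (q : par) (F : coefs) (j : nat) (x : R2) : C :=
  match j with
  | 1%nat => coefA5 L q F x + coefA7 L q F x
  | 2%nat => coefB5 L q F x + coefB7 L q F x
  | 3%nat | 4%nat => coefC3 q F x
  | 5%nat => coefA7 L q F x
  | 6%nat => coefB7 L q F x
  | _ => coefC9 q F x
  end.

Definition positive_coef (L : nat) (q : par) (E : coefs) : coefs := fun l j x =>
  descent L q E (2 * L + 1 - l) j x.

Definition next_coef (L : nat) (q : par) (E : coefs) : coefs := fun l j x =>
  if Nat.eqb l 0 then zeroth_coef L q (positive_coef L q E) j x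
  else positive_coef L q E l j x.

(** The branches 1 to 4 belong to P and the branches 5 to 8 to Q. *)
Definition source_coef (L : nat) (q : par) (m : nat -> coefs) : coefs := fun l j x =>
  if Nat.leb j 4 then theta_coef Kp2 Kp1 L q m l j x
  else theta_coef Kq2 Kq1 L q m l j x.

(** The table of all coefficients of index at most L, since the source of index L
    involves all the earlier amplitudes. *)
Fixpoint coef_upto (L : nat) (q : par) : nat -> coefs :=
  match L with
  | 0%nat => fun _ _ _ _ => 0
  | S L' => fun N =>
      if Nat.eqb N (S L') then
        match L' with
        | 0%nat => first_coef q
        | _ => next_coef L' q (source_coef L' q (coef_upto L' q))
        end
      else coef_upto L' q N
  end.

Definition amp_coef (N : nat) (q : par) : coefs := coef_upto N q N.
Definition amp_source (L : nat) (q : par) : coefs :=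
  source_coef L q (fun N => amp_coef N q).

Lemma coef_upto_stable L N q : (N <= L)%nat -> coef_upto L q N = amp_coef N q.
Proof.
  intros H. induction H as [|L H IH]; [reflexivity|].
  rewrite <- IH. simpl. replace (Nat.eqb N (S L)) with false; [reflexivity|].
  symmetry. apply Nat.eqb_neq. lia.
Qed.

Lemma source_coef_ext L q m m' :
  (forall N, (1 <= N <= L)%nat -> m N = m' N) -> source_coef L q m = source_coef L q m'.
Proof.
  intros H. extensionality l; extensionality j; extensionality x.
  unfold source_coef, theta_coef. destruct (Nat.leb j 4);
    (f_equal; apply Csum1_ext; intros N HN; now rewrite H).
Qed.

Lemma amp_coef_1 q : amp_coef 1 q = first_coef q.
Proof. reflexivity. Qed.

Lemma amp_coef_S L q : (1 <= L)%nat ->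
  amp_coef (S L) q = next_coef L q (amp_source L q).
Proof.
  intros H. unfold amp_coef at 1. simpl. rewrite Nat.eqb_refl.
  destruct L as [|L]; [lia|]. unfold amp_source.
  rewrite (source_coef_ext (S L) q (coef_upto (S L) q) (fun N => amp_coef N q));
    [reflexivity|].
  intros N HN. apply coef_upto_stable. lia.
Qed.

(** * The explicit formulas *)

Lemma first_coef_formulas q x : first_coefficients q x (fun l j => first_coef q l j x).
Proof. repeat split. Qed.

Lemma zeroth_coef_ext L q F F' j x : (1 <= L)%nat ->
  (forall l j, (1 <= l <= 2 * L)%nat -> F l j x = F' l j x) ->
  zeroth_coef L q F j x = zeroth_coef L q F' j x.
Proof.
  intros HL H.
  assert (S : forall h h' : nat -> C, (forall l, (1 <= l <= 2 * L)%nat -> h l = h' l) ->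
    sum_n_m h 1 (2 * L) = sum_n_m h' 1 (2 * L)).
  { intros. now apply Csum1_ext. }
  assert (E3 : coefC3 q F x = coefC3 q F' x) by (unfold coefC3; now rewrite !H by lia).
  assert (E9 : coefC9 q F x = coefC9 q F' x) by (unfold coefC9; now rewrite !H by lia).
  assert (A3 : coefA3 L q F x = coefA3 L q F' x).
  { unfold coefA3. f_equal. apply S. intros; now rewrite !H. }
  assert (B3 : coefB3 L q F x = coefB3 L q F' x).
  { unfold coefB3. f_equal. apply S. intros; now rewrite !H. }
  assert (A4 : coefA4 L q F x = coefA4 L q F' x).
  { unfold coefA4. repeat first [apply S; intros; now rewrite !H | f_equal]. }
  assert (B4 : coefB4 L q F x = coefB4 L q F' x).
  { unfold coefB4. repeat first [apply S; intros; now rewrite !H | f_equal]. }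
  unfold zeroth_coef, coefA7, coefB7, coefA6, coefB6, coefA5, coefB5.
  now rewrite E3, E9, A3, B3, A4, B4.
Qed.

Lemma next_coef_pos L q E l j x : (1 <= l)%nat ->
  next_coef L q E l j x = positive_coef L q E l j x.
Proof. intros H. unfold next_coef. now destruct l; [lia|]. Qed.

Lemma next_coef_zero L q E j x : (1 <= L)%nat ->
  next_coef L q E 0%nat j x = zeroth_coef L q (next_coef L q E) j x.
Proof.
  intros H. apply (zeroth_coef_ext L q (positive_coef L q E)); [exact H|].
  intros l j' Hl. symmetry. now apply next_coef_pos.
Qed.

Lemma descent_step L q E l j x : (l < 2 * L)%nat ->
  positive_coef L q E (l + 1)%nat j x =
  (E l j x - INR (l + 2) * INR (l + 1) * gamma_ (med q) j * m1 3 3 q x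
             * positive_coef L q E (l + 2)%nat j x)
  / (2 * INR (l + 1) * gamma_ (med q) j * (beta_ j q x * m1 3 3 q x + Ci * R1 q x)).
Proof.
  intros H. unfold positive_coef.
  replace (2 * L + 1 - (l + 1))%nat with (S (2 * L + 1 - (l + 2))) by lia.
  cbn [descent]. cbv zeta.
  replace (2 * L - S (2 * L + 1 - (l + 2)))%nat with l by lia. reflexivity.
Qed.

Lemma positive_coef_top L q E l j x : (2 * L < l)%nat -> positive_coef L q E l j x = 0.
Proof.
  intros H. unfold positive_coef. now replace (2 * L + 1 - l)%nat with 0%nat by lia.
Qed.

Lemma next_coef_formulas L q E x : (1 <= L)%nat ->
  next_coefficients q x L (fun l j => E l j x) (fun l j => next_coef L q E l j x).
Proof.
  intros HL. unfold next_coefficients. cbv zeta. split; [|split].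
  - intros j _. rewrite next_coef_pos by lia.
    replace (2 * L)%nat with (2 * L - 1 + 1)%nat at 1 by lia.
    rewrite descent_step by lia.
    rewrite positive_coef_top by lia.
    replace (2 * L - 1 + 1)%nat with (2 * L)%nat by lia.
    rewrite mult_INR, RtoC_mult. change (INR 2) with 2%R.
    rewrite Cmult_0_r. unfold Cminus. rewrite Copp_0, Cplus_0_r. f_equal.
    (* 4 L = 2 (2 L) *)
    change (RtoC 4) with (RtoC (2 * 2)). rewrite RtoC_mult. ring.
  - intros l j Hl _. rewrite !next_coef_pos by lia. apply descent_step. lia.
  - cbv beta. rewrite !(next_coef_zero L q E) by exact HL. repeat split.
Qed.

(** * Orders of the coefficients of the amplitudes *)

Lemma of_order_gamma j : of_order (fun q _ => gamma_ (med q) j) 0.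
Proof.
  unfold gamma_. destruct (Nat.leb j 4); [exact (of_order_const 1) | apply of_order_k].
Qed.

Lemma of_order_ypow l : of_order (fun q _ => ypow q l) (- Z.of_nat l).
Proof.
  eapply of_order_eq; [eapply of_order_ext; [apply (of_order_pow _ (-1) l of_order_my3)|]|].
  - intros q x. unfold ypow. cbv beta. now rewrite RtoC_pow.
  - lia.
Qed.

Lemma of_order_mult_known f g m p : of_order f m -> of_order g (p - m) ->
  of_order (fun q x => f q x * g q x) p.
Proof. intros Hf Hg. apply (of_order_mult f g m (p - m)); [exact Hf | exact Hg | lia]. Qed.

Lemma of_order_div_known f g n p : of_order g n -> of_order f (p + n) ->
  of_order (fun q x => f q x / g q x) p.
Proof. intros Hg Hf. apply (of_order_div f g (p + n) n); [exact Hf | exact Hg | lia]. Qed.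

(* Goals [of_order f m] are decomposed along the arithmetic of [f]. The order of
   a left factor is found from its leaves; if m is known, the right factor must
   then account for the difference. *)
Ltac order_leaf :=
  first [ apply of_order_m0 | apply of_order_m1 | apply of_order_invJy
        | apply of_order_k | apply of_order_R0 | apply of_order_R1
        | apply of_order_roots | apply of_order_beta | apply of_order_delta
        | apply of_order_Delta0 | apply of_order_gamma | apply of_order_ypow
        | match goal with H : _ |- _ => apply H; lia end
        | match goal with H : _ |- _ => apply H end ].

Ltac order_eq := first [reflexivity | lia].

Ltac order_tac :=
  lazymatch goal with
  | |- of_order (fun q x => - @?a q x) _ => apply (of_order_opp a); order_tac
  | |- of_order (fun q x => @?a q x + @?b q x) _ =>
      apply (of_order_plus a b); order_tac
  | |- of_order (fun q x => @?a q x - @?b q x) _ =>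
      apply (of_order_minus a b); order_tac
  | |- of_order (fun q x => RtoC (INR ?c) * @?b q x) _ =>
      apply (of_order_scal (RtoC (INR c)) b); order_tac
  | |- of_order (fun q x => RtoC (IZR ?c) * @?b q x) _ =>
      apply (of_order_scal (RtoC (IZR c)) b); order_tac
  | |- of_order (fun q x => Ci * @?b q x) _ =>
      apply (of_order_scal Ci b); order_tac
  | |- of_order (fun q x => @?a q x * @?b q x) ?m =>
      tryif has_evar m
      then (eapply (of_order_mult a b); [order_tac | order_tac | order_eq])
      else (eapply (of_order_mult_known a b); [order_tac | order_tac])
  | |- of_order (fun q x => / @?a q x) _ =>
      eapply (of_order_inv a); [order_tac | order_eq]
  | |- of_order (fun q x => @?a q x / @?b q x) ?m =>
      tryif has_evar m
      then (eapply (of_order_div a b); [order_tac | order_tac | order_eq])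
      else (eapply (of_order_div_known a b); [order_tac | order_tac])
  | |- of_order (fun q x => sum_n_m (fun l => @?h l q x) ?a ?b) _ =>
      apply (of_order_sum_n_m h a b); intros; order_tac
  | |- of_order (fun q x => RtoC (IZR ?c)) _ =>
      eapply of_order_eq; [exact (of_order_const (RtoC (IZR c))) | order_eq]
  | |- of_order (fun q x => RtoC (INR ?c)) _ =>
      eapply of_order_eq; [exact (of_order_const (RtoC (INR c))) | order_eq]
  | _ => eapply of_order_eq; [order_leaf | order_eq]
  end.

Lemma order_flux0 b : of_order b 1 -> of_order (flux0 b) 1.
Proof. intros H. unfold flux0. order_tac. Qed.

Lemma order_A1 : of_order coefA1 (-1).
Proof. unfold coefA1. order_tac. Qed.

Lemma order_B1 : of_order coefB1 (-1).
Proof. unfold coefB1. order_tac. Qed.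

Lemma order_A2 : of_order coefA2 (-1).
Proof. unfold coefA2. pose proof order_A1 as H. order_tac. Qed.

Lemma order_B2 : of_order coefB2 (-1).
Proof.
  unfold coefB2. pose proof order_B1 as H.
  destruct of_order_roots as (Hlp & Hlm & Hmp & Hmm).
  pose proof (order_flux0 _ Hlp) as H1. pose proof (order_flux0 _ Hmm) as H2.
  order_tac.
Qed.

Lemma order_first : coef_order first_coef (-1).
Proof.
  pose proof order_A1 as H1. pose proof order_B1 as H2.
  pose proof order_A2 as H3. pose proof order_B2 as H4.
  intros l j. unfold first_coef. destruct l as [|l]; simpl; [|apply of_order_zero].
  do 8 (destruct j as [|j]; [order_tac|]). order_tac.
Qed.

(** Dividing by beta_j m_33 + i R_1, of order 1, turns the order l + 1 - L of E_l
    into the order (l + 1) - (L + 1) of F_{l+1}. *)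
Lemma order_descent L (E : par -> coefs) n j : coef_order E (1 - Z.of_nat L) ->
  (n <= 2 * L)%nat ->
  of_order (fun q x => descent L q (E q) n j x) (Z.of_nat L - Z.of_nat n).
Proof.
  intros H. induction n as [|n IH]; intros Hn; [apply of_order_zero|].
  specialize (IH ltac:(lia)). cbn [descent]. cbv zeta.
  specialize (H (2 * L - S n)%nat j).
  order_tac.
Qed.

(** At x_3 = 0 the powers of z become powers of -y_3, which count in the same way,
    so the sums have order - (L + 1), and one more after a derivative; the division
    by Delta_0 or by a difference of roots compensates that. *)
Lemma order_zeroth L (F : par -> coefs) j : (1 <= L)%nat ->
  (forall l j, (1 <= l <= 2 * L)%nat ->
     of_order (fun q x => F q l j x) (Z.of_nat l - Z.of_nat L - 1)) ->
  of_order (fun q x => zeroth_coef L q (F q) j x) (- Z.of_nat L - 1).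
Proof.
  intros HL H.
  destruct of_order_roots as (Hlp & Hlm & Hmp & Hmm).
  pose proof (order_flux0 _ Hlp) as G1. pose proof (order_flux0 _ Hlm) as G2.
  pose proof (order_flux0 _ Hmm) as G3.
  assert (C3 : of_order (fun q x => coefC3 q (F q) x) (- Z.of_nat L - 1)).
  { unfold coefC3. order_tac. }
  assert (C9 : of_order (fun q x => coefC9 q (F q) x) (- Z.of_nat L - 1)).
  { unfold coefC9. order_tac. }
  assert (A3 : of_order (fun q x => coefA3 L q (F q) x) (- Z.of_nat L - 1)).
  { unfold coefA3. order_tac. }
  assert (B3 : of_order (fun q x => coefB3 L q (F q) x) (- Z.of_nat L - 1)).
  { unfold coefB3. order_tac. }
  assert (A4 : of_order (fun q x => coefA4 L q (F q) x) (- Z.of_nat L)).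
  { unfold coefA4. order_tac. }
  assert (B4 : of_order (fun q x => coefB4 L q (F q) x) (- Z.of_nat L)).
  { unfold coefB4. order_tac. }
  clear H.
  assert (A5 : of_order (fun q x => coefA5 L q (F q) x) (- Z.of_nat L - 1)).
  { unfold coefA5. order_tac. }
  assert (B5 : of_order (fun q x => coefB5 L q (F q) x) (- Z.of_nat L - 1)).
  { unfold coefB5. order_tac. }
  assert (A6 : of_order (fun q x => coefA6 L q (F q) x) (- Z.of_nat L)).
  { unfold coefA6. order_tac. }
  assert (B6 : of_order (fun q x => coefB6 L q (F q) x) (- Z.of_nat L)).
  { unfold coefB6. order_tac. }
  assert (A7 : of_order (fun q x => coefA7 L q (F q) x) (- Z.of_nat L - 1)).
  { unfold coefA7. order_tac. }
  assert (B7 : of_order (fun q x => coefB7 L q (F q) x) (- Z.of_nat L - 1)).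
  { unfold coefB7. order_tac. }
  unfold zeroth_coef. do 8 (destruct j as [|j]; [order_tac|]). order_tac.
Qed.

Lemma order_next L (E : par -> coefs) : (1 <= L)%nat ->
  coef_order E (1 - Z.of_nat L) ->
  coef_order (fun q => next_coef L q (E q)) (- Z.of_nat (S L)).
Proof.
  intros HL H.
  assert (P : forall l j, (1 <= l)%nat ->
    of_order (fun q x => positive_coef L q (E q) l j x) (Z.of_nat l - Z.of_nat L - 1)).
  { intros l j Hl. destruct (Compare_dec.le_lt_dec l (2 * L)).
    - eapply of_order_eq; [apply (order_descent L E (2 * L + 1 - l) j H) | ]; lia.
    - eapply of_order_ext; [apply of_order_zero|]. intros. now apply positive_coef_top. }
  intros l j. unfold next_coef. destruct l as [|l].
  - eapply of_order_eq; [apply (order_zeroth L (fun q => positive_coef L q (E q)) j HL)|].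
    + intros l j' Hl. apply P. lia.
    + lia.
  - eapply of_order_eq; [apply P | ]; lia.
Qed.

Lemma order_source L (m : nat -> par -> coefs) :
  (forall N, (1 <= N <= L)%nat -> coef_order (m N) (- Z.of_nat N)) ->
  coef_order (fun q => source_coef L q (fun N => m N q)) (1 - Z.of_nat L).
Proof.
  intros H l j. destruct symbols_order as (O1 & O2 & O3 & O4).
  unfold source_coef. destruct (Nat.leb j 4); now apply order_theta.
Qed.

Lemma order_amp N : (1 <= N)%nat -> coef_order (amp_coef N) (- Z.of_nat N).
Proof.
  induction N as [N IH] using lt_wf_ind. intros HN.
  destruct N as [|[|L]]; [lia | exact order_first |].
  intros l j. eapply of_order_ext.
  - apply (order_next (S L) (amp_source (S L))); [lia|].
    apply (order_source (S L) amp_coef). intros; apply IH; lia.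
  - intros q x. now rewrite amp_coef_S by lia.
Qed.

(** * Degrees of the coefficients of the amplitudes *)

Lemma degree_next L q E : degree_le (2 * L) (next_coef L q E).
Proof.
  intros l j x Hl. rewrite next_coef_pos by lia. now apply positive_coef_top.
Qed.

Lemma degree_amp N q : (1 <= N)%nat -> degree_le (2 * N - 2) (amp_coef N q).
Proof.
  intros HN. destruct N as [|[|L]]; [lia | |].
  - intros l j x Hl. rewrite amp_coef_1. unfold first_coef. now destruct l; [lia|].
  - rewrite amp_coef_S by lia. replace (2 * S (S L) - 2)%nat with (2 * S L)%nat by lia.
    apply degree_next.
Qed.

Lemma degree_source L q : (1 <= L)%nat -> degree_le (2 * L - 1) (amp_source L q).
Proof.
  intros HL l j x Hl. unfold amp_source, source_coef.
  destruct (Nat.leb j 4); apply (degree_theta _ _ L);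
    try assumption; intros; apply degree_amp; lia.
Qed.

(** * Admissible parameters *)

Record good (q : par) : Prop := {
  good_medium : admissible (med q);
  good_y3 : (y3 q < 0)%R;
  good_lam : forall x, has_root_pos (radicand (tau q) q x);
  good_mu : forall x, has_root_pos (radicand (tau q / kk (med q)) q x);
  good_Delta0 : forall x, Delta0 q x <> 0
}.

Lemma good_k q : good q -> RtoC (kk (med q)) <> 0.
Proof.
  intros [(Hk & _) _ _ _ _] E. apply RtoC_inj in E. lra.
Qed.

Definition m33 (q : par) (x : R2) : R := mm (med q) 3 3 x (y3 q).

Lemma good_m33 q x : good q -> (0 < m33 q x)%R.
Proof. intros H. apply mm33_pos; [apply H | pose proof (good_y3 q H); lra]. Qed.

Lemma good_m1 q x : good q -> m1 3 3 q x <> 0.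
Proof.
  intros H E. pose proof (good_m33 q x H). unfold m1 in E. apply RtoC_inj in E.
  unfold m33 in *. lra.
Qed.

(** The square roots in the definitions of lambda_+- and mu_+-. *)
Definition root_lam (q : par) (x : R2) : C := csqrt (radicand (tau q) q x).
Definition root_mu (q : par) (x : R2) : C := csqrt (radicand (tau q / kk (med q)) q x).

Lemma root_lam_spec q x : good q ->
  (0 < Re (root_lam q x))%R /\ root_lam q x * root_lam q x = radicand (tau q) q x.
Proof. intros H. apply csqrt_root, (good_lam q H). Qed.

Lemma root_mu_spec q x : good q ->
  (0 < Re (root_mu q x))%R /\
  root_mu q x * root_mu q x = radicand (tau q / kk (med q)) q x.
Proof. intros H. apply csqrt_root, (good_mu q H). Qed.

Lemma Re_pos_neq0 z : (0 < Re z)%R -> z <> 0.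
Proof. intros H ->. simpl in H. lra. Qed.

Lemma lamp_eq q x : good q -> lamp q x * m1 3 3 q x + Ci * R1 q x = root_lam q x.
Proof. intros H. unfold lamp, root_lam. field. now apply good_m1. Qed.

Lemma lamm_eq q x : good q -> lamm q x * m1 3 3 q x + Ci * R1 q x = - root_lam q x.
Proof. intros H. unfold lamm, root_lam. field. now apply good_m1. Qed.

Lemma mup_eq q x : good q -> mup q x * m1 3 3 q x + Ci * R1 q x = root_mu q x.
Proof. intros H. unfold mup, root_mu. field. now apply good_m1. Qed.

Lemma mum_eq q x : good q -> mum q x * m1 3 3 q x + Ci * R1 q x = - root_mu q x.
Proof. intros H. unfold mum, root_mu. field. now apply good_m1. Qed.

Lemma Copp_neq0 (z : C) : z <> 0 -> - z <> 0.
Proof. intros H E. apply H. replace z with (- - z) by ring. rewrite E. ring. Qed.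

(** The denominators of the recursion are the square roots, up to sign. *)
Lemma beta_denominator q j x : good q ->
  beta_ j q x * m1 3 3 q x + Ci * R1 q x <> 0.
Proof.
  intros H.
  pose proof (Re_pos_neq0 _ (proj1 (root_lam_spec q x H))) as Nl.
  pose proof (Re_pos_neq0 _ (proj1 (root_mu_spec q x H))) as Nm.
  assert (A1 : lamp q x * m1 3 3 q x + Ci * R1 q x <> 0) by now rewrite lamp_eq.
  assert (A2 : lamm q x * m1 3 3 q x + Ci * R1 q x <> 0)
    by (rewrite lamm_eq by exact H; now apply Copp_neq0).
  assert (A3 : mup q x * m1 3 3 q x + Ci * R1 q x <> 0) by now rewrite mup_eq.
  assert (A4 : mum q x * m1 3 3 q x + Ci * R1 q x <> 0)
    by (rewrite mum_eq by exact H; now apply Copp_neq0).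
  unfold beta_. now do 8 (destruct j as [|j]; [assumption|]).
Qed.

Lemma root_distinct q x z1 z2 r : (0 < Re r)%R ->
  z1 * m1 3 3 q x + Ci * R1 q x = r -> z2 * m1 3 3 q x + Ci * R1 q x = - r ->
  z1 - z2 <> 0.
Proof.
  intros P E1 E2 E. apply Ceq_minus in E. rewrite E, E2 in E1.
  apply (f_equal Re) in E1. change (- Re r = Re r)%R in E1. lra.
Qed.

Lemma lam_distinct q x : good q -> lamp q x - lamm q x <> 0.
Proof.
  intros H. apply (root_distinct q x _ _ (root_lam q x));
    [apply root_lam_spec | apply lamp_eq | apply lamm_eq]; exact H.
Qed.

Lemma mu_distinct q x : good q -> mup q x - mum q x <> 0.
Proof.
  intros H. apply (root_distinct q x _ _ (root_mu q x));
    [apply root_mu_spec | apply mup_eq | apply mum_eq]; exact H.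
Qed.

(** R_1 and m_33 are real, so the real parts of the exponents are those of the
    square roots up to a positive factor. *)
Lemma exponent_Re q x z r : good q -> z * m1 3 3 q x + Ci * R1 q x = r ->
  (Re z * m33 q x = Re r)%R.
Proof.
  intros H <-. unfold m1, R1. rewrite Csum12. unfold m1, xij, m33. simpl. unfold Re; ring.
Qed.

Lemma exponents_Re q x : good q ->
  (0 < Re (lamp q x))%R /\ (Re (lamm q x) < 0)%R /\
  (0 < Re (mup q x))%R /\ (Re (mum q x) < 0)%R.
Proof.
  intros H. pose proof (good_m33 q x H) as M.
  destruct (root_lam_spec q x H) as [Pl _]. destruct (root_mu_spec q x H) as [Pm _].
  pose proof (exponent_Re q x _ _ H (lamp_eq q x H)).
  pose proof (exponent_Re q x _ _ H (lamm_eq q x H)).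
  pose proof (exponent_Re q x _ _ H (mup_eq q x H)).
  pose proof (exponent_Re q x _ _ H (mum_eq q x H)).
  change (Re (- root_lam q x)) with (- Re (root_lam q x))%R in *.
  change (Re (- root_mu q x)) with (- Re (root_mu q x))%R in *.
  repeat split; nra.
Qed.

(** * Smoothness of the amplitudes in x' *)

Lemma csm_m1 q j l : good q -> (1 <= j <= 3)%nat -> (1 <= l <= 3)%nat ->
  csm (m1 j l q).
Proof.
  intros H Hj Hl. apply (smooth_closed_slice (mm (med q) j l)).
  - apply mm_smooth_closed; [apply H | exact Hj | exact Hl].
  - pose proof (good_y3 q H). lra.
Qed.

Lemma csm_m0 q j l : good q -> (1 <= j <= 3)%nat -> (1 <= l <= 3)%nat ->
  csm (m0 j l q).
Proof.
  intros H Hj Hl. apply (smooth_closed_slice (mm (med q) j l)); [|lra].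
  apply mm_smooth_closed; [apply H | exact Hj | exact Hl].
Qed.

Lemma csm_R0 q : good q -> csm (R0 q).
Proof.
  intros H. apply csm_sum1. intros j Hj. apply csm_mult; [|apply csm_const].
  apply csm_m0; [exact H | lia | lia].
Qed.

Lemma csm_R1 q : good q -> csm (R1 q).
Proof.
  intros H. apply csm_sum1. intros j Hj. apply csm_mult; [|apply csm_const].
  apply csm_m1; [exact H | lia | lia].
Qed.

Lemma csm_radicand q t : good q -> csm (radicand t q).
Proof.
  intros H. unfold radicand. apply csm_minus.
  - apply csm_mult; [apply csm_m1; [exact H | lia | lia]|].
    apply csm_plus; [|apply csm_const].
    apply csm_sum1; intros j Hj. apply csm_sum1; intros l Hl.
    apply csm_mult; [|apply csm_const]. apply csm_mult; [|apply csm_const].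
    apply csm_m1; [exact H | lia | lia].
  - eapply (Csmooth_ext (fun x _ => R1 q x * R1 q x)).
    + apply (csm_mult (R1 q) (R1 q)); now apply csm_R1.
    + intros; simpl; ring.
Qed.

Lemma good_exponents q : good q -> exponents_smooth q.
Proof.
  intros H.
  assert (P : forall g, csm g ->
    csm (fun x => / m1 3 3 q x * (- (Ci * R1 q x) + g x))).
  { intros g Hg. apply csm_mult.
    - apply csm_inv; [apply csm_m1; [exact H | lia | lia]|].
      intros x. now apply good_m1.
    - apply csm_plus; [|exact Hg]. apply csm_opp, csm_mult;
        [apply csm_const | now apply csm_R1]. }
  assert (S1 : csm (root_lam q)).
  { apply (Csmooth_csqrt (fun x _ => radicand (tau q) q x)).
    - now apply csm_radicand.
    - intros x _. now apply good_lam. }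
  assert (S2 : csm (root_mu q)).
  { apply (Csmooth_csqrt (fun x _ => radicand (tau q / kk (med q)) q x)).
    - now apply csm_radicand.
    - intros x _. now apply good_mu. }
  refine (conj _ (conj _ (conj _ _))).
  - apply (P _ S1).
  - apply (P _ (csm_opp _ S1)).
  - apply (P _ S2).
  - apply (P _ (csm_opp _ S2)).
Qed.

Lemma csm_flux0 q b : good q -> csm (b q) -> csm (flux0 b q).
Proof.
  intros H Hb. unfold flux0. apply csm_plus; apply csm_mult.
  - apply csm_const.
  - now apply csm_R0.
  - exact Hb.
  - apply csm_m0; [exact H | lia | lia].
Qed.

Lemma csm_Delta0 q : good q -> csm (Delta0 q).
Proof.
  intros H. destruct (good_exponents q H) as (H1 & H2 & H3 & H4).
  apply (csm_minus (fun x => kk (med q) * flux0 mup q x) (flux0 lamp q)).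
  - apply csm_mult; [apply csm_const | now apply csm_flux0].
  - now apply csm_flux0.
Qed.

(* Leaves are recognized by their syntax: unification of two different
   symbols would unfold both down to the real numbers. *)
Ltac csm_leaf :=
  lazymatch goal with
  | |- csm (fun x => m0 _ _ _ x) => apply csm_m0; [assumption | lia | lia]
  | |- csm (fun x => m1 _ _ _ x) => apply csm_m1; [assumption | lia | lia]
  | |- csm (fun x => R0 _ x) => apply csm_R0; assumption
  | |- csm (fun x => R1 _ x) => apply csm_R1; assumption
  | |- csm (fun x => Delta0 _ x) => apply csm_Delta0; assumption
  | |- csm (fun x => beta_ _ _ x) => apply csm_beta, good_exponents; assumption
  | |- csm (fun x => ?f x) =>
      lazymatch goal with
      | H : csm f |- _ => exact H
      | _ => lazymatch f with ?G ?l ?j =>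
               lazymatch goal with
               | H : csmooth2 G |- _ => exact (H l j)
               end
             end
      end
  | |- _ => exact (csm_const _)
  end.

Ltac csm_tac :=
  lazymatch goal with
  | |- csm (fun x => - @?a x) => apply (csm_opp a); csm_tac
  | |- csm (fun x => @?a x + @?b x) => apply (csm_plus a b); csm_tac
  | |- csm (fun x => @?a x - @?b x) => apply (csm_minus a b); csm_tac
  | |- csm (fun x => @?a x * @?b x) => apply (csm_mult a b); csm_tac
  | |- csm (fun x => / @?a x) => apply (csm_inv a); [csm_tac |]
  | |- csm (fun x => @?a x / @?b x) => apply (csm_div a b); [csm_tac | csm_tac |]
  | |- csm (fun x => sum_n_m (fun l => @?h l x) 1 ?n) =>
      apply (csm_sum1 h n); intros; csm_tac
  | |- _ => csm_leaf
  end.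

Lemma csm_first q : good q -> csmooth2 (first_coef q).
Proof.
  intros H. destruct (good_exponents q H) as (H1 & H2 & H3 & H4).
  assert (A1 : csm (coefA1 q)).
  { unfold coefA1. csm_tac. intros x. apply Cmult_neq_0.
    - now apply good_m1.
    - now apply lam_distinct. }
  assert (B1 : csm (coefB1 q)).
  { unfold coefB1. csm_tac. intros x. repeat apply Cmult_neq_0.
    - now apply good_k.
    - now apply good_m1.
    - now apply mu_distinct. }
  assert (Fp : csm (flux0 lamp q)) by now apply csm_flux0.
  assert (Fm : csm (flux0 mum q)) by now apply csm_flux0.
  assert (A2 : csm (coefA2 q)).
  { unfold coefA2. csm_tac. apply (good_Delta0 q H). }
  assert (B2 : csm (coefB2 q)).
  { unfold coefB2. csm_tac. apply (good_Delta0 q H). }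
  intros l j. unfold first_coef. destruct (Nat.eqb l 0); [|apply csm_const].
  do 8 (destruct j as [|j]; [csm_tac|]). csm_tac.
Qed.

Lemma gamma_neq0 q j : good q -> gamma_ (med q) j <> 0.
Proof.
  intros H. unfold gamma_. destruct (Nat.leb j 4).
  - intros E. apply RtoC_inj in E. lra.
  - now apply good_k.
Qed.

Lemma INR_succ_neq0 l : RtoC (INR (l + 1)) <> 0.
Proof.
  intros E. apply RtoC_inj in E. rewrite plus_INR in E. simpl in E.
  pose proof (pos_INR l). lra.
Qed.

Lemma C2_neq0 : RtoC 2 <> 0.
Proof. intros E. apply RtoC_inj in E. lra. Qed.

Lemma csm_descent L q E n j : good q -> csmooth2 E -> csm (descent L q E n j).
Proof.
  intros H HE. induction n as [|n IH]; [apply csm_const|].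
  cbn [descent]. cbv zeta. set (l := (2 * L - S n)%nat).
  specialize (HE l j). change (csm (descent L q E n j)) in IH.
  csm_tac.
  intros x. repeat apply Cmult_neq_0.
  - apply C2_neq0.
  - apply INR_succ_neq0.
  - now apply gamma_neq0.
  - now apply beta_denominator.
Qed.

Lemma csm_zeroth L q F j : good q -> csmooth2 F -> csm (zeroth_coef L q F j).
Proof.
  intros H HF. destruct (good_exponents q H) as (H1 & H2 & H3 & H4).
  assert (G1 : csm (flux0 lamp q)) by now apply csm_flux0.
  assert (G2 : csm (flux0 lamm q)) by now apply csm_flux0.
  assert (G3 : csm (flux0 mum q)) by now apply csm_flux0.
  assert (C3 : csm (coefC3 q F)).
  { unfold coefC3. csm_tac. intros x. now apply lam_distinct. }
  assert (C9 : csm (coefC9 q F)).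
  { unfold coefC9. csm_tac. intros x. now apply mu_distinct. }
  assert (A3 : csm (coefA3 L q F)) by (unfold coefA3; csm_tac).
  assert (B3 : csm (coefB3 L q F)) by (unfold coefB3; csm_tac).
  assert (A4 : csm (coefA4 L q F)) by (unfold coefA4; csm_tac).
  assert (B4 : csm (coefB4 L q F)) by (unfold coefB4; csm_tac).
  clear HF.
  assert (A5 : csm (coefA5 L q F)) by (unfold coefA5; csm_tac).
  assert (B5 : csm (coefB5 L q F)) by (unfold coefB5; csm_tac).
  assert (A6 : csm (coefA6 L q F)) by (unfold coefA6; csm_tac).
  assert (B6 : csm (coefB6 L q F)) by (unfold coefB6; csm_tac).
  assert (A7 : csm (coefA7 L q F)) by
    (unfold coefA7; csm_tac; apply (good_Delta0 q H)).
  assert (B7 : csm (coefB7 L q F)) by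
    (unfold coefB7; csm_tac; apply (good_Delta0 q H)).
  unfold zeroth_coef. do 8 (destruct j as [|j]; [csm_tac|]). csm_tac.
Qed.

Lemma csm_source L q m : good q ->
  (forall N, (1 <= N <= L)%nat -> csmooth2 (m N)) -> csmooth2 (source_coef L q m).
Proof.
  intros H Hm l j. pose proof (good_exponents q H).
  destruct (symbols_smooth q (good_medium q H) (good_y3 q H)) as (S1 & S2 & S3 & S4).
  unfold source_coef. destruct (Nat.leb j 4).
  - now apply (csm_theta Kp2 Kp1).
  - now apply (csm_theta Kq2 Kq1).
Qed.

Lemma csm_amp N q : good q -> (1 <= N)%nat -> csmooth2 (amp_coef N q).
Proof.
  intros H. induction N as [N IH] using lt_wf_ind. intros HN.
  destruct N as [|[|L]]; [lia | now apply csm_first |].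
  rewrite amp_coef_S by lia.
  assert (HE : csmooth2 (amp_source (S L) q)).
  { apply (csm_source (S L) q (fun N => amp_coef N q) H).
    intros N HN'. apply (IH N); lia. }
  assert (HF : csmooth2 (positive_coef (S L) q (amp_source (S L) q))).
  { intros l j. now apply csm_descent. }
  intros l j. unfold next_coef. destruct (Nat.eqb l 0).
  - now apply csm_zeroth.
  - apply HF.
Qed.

(** * The amplitudes and their sources *)

Definition amp (S : list nat) (q : par) (ell : nat) (s : R) : series := fun N =>
  expansion S (2 * N - 2) (amp_coef N q) q ell s.

Lemma Csmooth_amp S q ell s N : good q -> (1 <= N)%nat -> Csmooth (amp S q ell s N).
Proof.
  intros H HN. apply Csmooth_expansion; [now apply good_exponents | now apply csm_amp].
Qed.

Lemma Theta_amp S q ell s L x x3 : good q -> (1 <= L)%nat ->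
  ((forall j, In j S -> (j <= 4)%nat) ->
   Theta (p2 (med q) (tau q)) (p1 (med q)) q L (amp S q ell s) x x3
     = expansion S (2 * L - 1) (amp_source L q) q ell s x x3) /\
  ((forall j, In j S -> (4 < j)%nat) ->
   Theta (q2 (med q) (tau q)) (q1 (med q)) q L (amp S q ell s) x x3
     = expansion S (2 * L - 1) (amp_source L q) q ell s x x3).
Proof.
  intros H HL. pose proof (good_exponents q H) as He.
  destruct (symbols_represented (med q) q (good_medium q H) eq_refl (good_y3 q H))
    as (R1' & R2' & R3' & R4').
  destruct (symbols_smooth q (good_medium q H) (good_y3 q H)) as (S1 & S2 & S3 & S4).
  assert (M : forall N, (1 <= N <= L)%nat -> csmooth2 (amp_coef N q) /\
    degree_le (2 * N - 2) (amp_coef N q) /\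
    amp S q ell s N = expansion S (2 * N - 2) (amp_coef N q) q ell s).
  { intros N HN. split; [apply csm_amp; [exact H | lia]|].
    split; [apply degree_amp; lia | reflexivity]. }
  split; intros HS.
  - rewrite (Theta_expansion _ _ Kp2 Kp1 L S (fun N => amp_coef N q) q ell s) by assumption.
    apply expansion_ext. intros l j _ Hj. unfold amp_source, source_coef.
    apply HS in Hj. apply Nat.leb_le in Hj. now rewrite Hj.
  - rewrite (Theta_expansion _ _ Kq2 Kq1 L S (fun N => amp_coef N q) q ell s) by assumption.
    apply expansion_ext. intros l j _ Hj. unfold amp_source, source_coef.
    apply HS in Hj. apply Nat.leb_gt in Hj. now rewrite Hj.
Qed.

Lemma Cmult_m1_l (z : C) : -1 * z = - z.
Proof. ring. Qed.

(** * The characteristic equation *)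

Definition quad_form (q : par) (x : R2) : C :=
  sum_n_m (fun j => sum_n_m (fun l => m1 j l q x * xij q j * xij q l) 1 2) 1 2.

(** Completing the square in m_33 z^2 + 2 i R_1 z. *)
Lemma characteristic q x z t : good q ->
  (z * m1 3 3 q x + Ci * R1 q x) * (z * m1 3 3 q x + Ci * R1 q x) = radicand t q x ->
  m1 3 3 q x * (z * z) + 2 * Ci * R1 q x * z = quad_form q x + t.
Proof.
  intros H E. unfold radicand in E. fold (quad_form q x) in E.
  pose proof (good_m1 q x H) as N. set (m := m1 3 3 q x) in *.
  set (r := R1 q x) in *. set (Q := quad_form q x) in *.
  assert (I2 : Ci * Ci = -1) by (apply C_ext; simpl; ring).
  assert (E2 : m * (m * (z * z) + 2 * Ci * r * z) = m * (Q + t)).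
  { replace (m * (Q + t)) with (m * (Q + t) - r ^ 2 + r ^ 2) by ring.
    rewrite <- E.
    replace ((z * m + Ci * r) * (z * m + Ci * r)) with
      (m * (m * (z * z) + 2 * Ci * r * z) + (Ci * Ci) * r ^ 2) by ring.
    rewrite I2. ring. }
  replace (m * (z * z) + 2 * Ci * r * z) with (/ m * (m * (m * (z * z) + 2 * Ci * r * z)))
    by (field; exact N).
  rewrite E2. field. exact N.
Qed.

(** The characteristic equation of p_2 for j <= 4 and of q_2 for j >= 5. *)
Lemma beta_characteristic q j x : good q -> (1 <= j)%nat ->
  gamma_ (med q) j * (quad_form q x - 2 * Ci * R1 q x * beta_ j q x
    - m1 3 3 q x * (beta_ j q x * beta_ j q x)) + tau q = 0.
Proof.
  intros H Hj.
  destruct (root_lam_spec q x H) as [_ El]. destruct (root_mu_spec q x H) as [_ Em].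
  assert (P : forall g r t z, r * r = radicand t q x -> g * t = tau q ->
    z * m1 3 3 q x + Ci * R1 q x = r \/ z * m1 3 3 q x + Ci * R1 q x = - r ->
    g * (quad_form q x - 2 * Ci * R1 q x * z - m1 3 3 q x * (z * z)) + tau q = 0).
  { intros g r t z Er Et Hz.
    assert (E : m1 3 3 q x * (z * z) + 2 * Ci * R1 q x * z = quad_form q x + t).
    { apply characteristic; [exact H|]. rewrite <- Er. destruct Hz as [-> | ->]; ring. }
    rewrite <- Et. transitivity (g * (quad_form q x + t
      - (m1 3 3 q x * (z * z) + 2 * Ci * R1 q x * z))); [ring | rewrite E; ring]. }
  pose proof (fun z => P _ _ _ z El (Cmult_1_l (tau q))) as Pl.
  assert (Ek : kk (med q) * (tau q / kk (med q)) = tau q) by (field; now apply good_k).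
  pose proof (fun z => P _ _ _ z Em Ek) as Pm. clear P.
  pose proof (lamp_eq q x H). pose proof (lamm_eq q x H).
  pose proof (mup_eq q x H). pose proof (mum_eq q x H).
  destruct j as [|j]; [lia|].
  unfold beta_, gamma_. do 7 (destruct j as [|j]; [simpl Nat.leb; auto|]).
  simpl Nat.leb. auto.
Qed.

(** * The equations of the hierarchy *)

Lemma Kp2_values q x : good q ->
  Kp2 0%nat 0%nat 0%nat 0%nat q x = quad_form q x + tau q /\
  Kp2 1%nat 0%nat 0%nat 0%nat q x = 2 * R1 q x /\
  Kp2 2%nat 0%nat 0%nat 0%nat q x = m1 3 3 q x.
Proof.
  intros H.
  destruct (symbols_represented (med q) q (good_medium q H) eq_refl (good_y3 q H))
    as (R' & _).
  rewrite <- !R' by lia. rewrite !CDerive_n_0.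
  refine (conj _ (conj _ _)).
  - unfold p2, quad_form. rewrite !Csum12. unfold m1, xij, co. cbn [fst snd].
    rewrite !RtoC_mult. ring.
  - unfold p2, R1. rewrite !Csum12. unfold m1, xij, co. cbn [fst snd].
    rewrite !RtoC_mult. ring.
  - reflexivity.
Qed.

Lemma Kq2_values q x : good q ->
  Kq2 0%nat 0%nat 0%nat 0%nat q x = kk (med q) * quad_form q x + tau q /\
  Kq2 1%nat 0%nat 0%nat 0%nat q x = kk (med q) * (2 * R1 q x) /\
  Kq2 2%nat 0%nat 0%nat 0%nat q x = kk (med q) * m1 3 3 q x.
Proof.
  intros H. destruct (Kp2_values q x H) as (V0 & V1 & V2).
  destruct (symbols_represented (med q) q (good_medium q H) eq_refl (good_y3 q H))
    as (R' & _ & R'' & _).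
  rewrite <- !R' in V0, V1, V2 by lia. rewrite !CDerive_n_0 in V0, V1, V2.
  rewrite <- !R'' by lia. rewrite !CDerive_n_0.
  refine (conj _ (conj _ _)); unfold q2; rewrite ?V0, ?V1, ?V2; ring.
Qed.

Lemma frozen_coef_value K q c l j x (k0 k1 k2 : C) :
  K 0%nat 0%nat 0%nat 0%nat q x = k0 -> K 1%nat 0%nat 0%nat 0%nat q x = k1 ->
  K 2%nat 0%nat 0%nat 0%nat q x = k2 ->
  frozen_coef K 0 0 0 q c l j x =
  (k0 - Ci * k1 * beta_ j q x - k2 * (beta_ j q x * beta_ j q x)) * c l j x
  - INR (l + 1) * (Ci * k1 + 2 * k2 * beta_ j q x) * c (l + 1)%nat j x
  - INR (l + 2) * INR (l + 1) * k2 * c (l + 2)%nat j x.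
Proof.
  intros H0 H1 H2. unfold frozen_coef. rewrite !Csum_S, Csum_O, H0, H1, H2.
  unfold D3_coef. cbn [Nat.iter nat_rect]. unfold d3_coef.
  replace (l + 1 + 1)%nat with (l + 2)%nat by lia.
  assert (I2 : (- Ci) ^ 2 = -1) by (apply C_ext; simpl; ring).
  rewrite I2. simpl pow. ring.
Qed.

(** Minus the coefficient of z^l in the image of a branch under p_2 or q_2: the
    contribution of c_l itself vanishes by the characteristic equation. *)
Definition reduced (q : par) (c : coefs) (l j : nat) (x : R2) : C :=
  2 * INR (l + 1) * gamma_ (med q) j * (beta_ j q x * m1 3 3 q x + Ci * R1 q x)
    * c (l + 1)%nat j x
  + INR (l + 2) * INR (l + 1) * gamma_ (med q) j * m1 3 3 q x * c (l + 2)%nat j x.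

Lemma frozen_coef_gamma K q c l j x : good q -> (1 <= j)%nat ->
  K 0%nat 0%nat 0%nat 0%nat q x = gamma_ (med q) j * quad_form q x + tau q ->
  K 1%nat 0%nat 0%nat 0%nat q x = gamma_ (med q) j * (2 * R1 q x) ->
  K 2%nat 0%nat 0%nat 0%nat q x = gamma_ (med q) j * m1 3 3 q x ->
  frozen_coef K 0 0 0 q c l j x =
  - reduced q c l j x.
Proof.
  intros H Hj H0 H1 H2. rewrite (frozen_coef_value K q c l j x _ _ _ H0 H1 H2).
  unfold reduced. set (g := gamma_ (med q) j) in *. set (b := beta_ j q x).
  replace (g * quad_form q x + tau q - Ci * (g * (2 * R1 q x)) * b
    - g * m1 3 3 q x * (b * b)) with (g * (quad_form q x - 2 * Ci * R1 q x * b
    - m1 3 3 q x * (b * b)) + tau q) by ring.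
  unfold g at 1, b at 1 2 3. rewrite beta_characteristic by assumption. ring.
Qed.

Lemma frozen_coef_p q c l j x : good q -> (1 <= j <= 4)%nat ->
  frozen_coef Kp2 0 0 0 q c l j x =
  - reduced q c l j x.
Proof.
  intros H Hj. destruct (Kp2_values q x H) as (V0 & V1 & V2).
  assert (G : gamma_ (med q) j = 1).
  { unfold gamma_. assert (E : Nat.leb j 4 = true) by (apply Nat.leb_le; lia).
    now rewrite E. }
  apply frozen_coef_gamma; [exact H | lia | | |]; rewrite G, ?Cmult_1_l; assumption.
Qed.

Lemma frozen_coef_q q c l j x : good q -> (4 < j)%nat ->
  frozen_coef Kq2 0 0 0 q c l j x =
  - reduced q c l j x.
Proof.
  intros H Hj. destruct (Kq2_values q x H) as (V0 & V1 & V2).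
  assert (G : gamma_ (med q) j = kk (med q)).
  { unfold gamma_. assert (E : Nat.leb j 4 = false) by (apply Nat.leb_gt; lia).
    now rewrite E. }
  apply frozen_coef_gamma; [exact H | lia | | |]; rewrite G; assumption.
Qed.

(** The descending recursion is the equation p_2 m = - Theta_L, or its analogue
    for q_2, read off coefficient by coefficient. *)
Lemma descent_solves L q E l j x : good q -> degree_le (2 * L - 1) E -> (1 <= L)%nat ->
  reduced q (next_coef L q E) l j x = E l j x.
Proof.
  intros H HE HL. unfold reduced. rewrite !next_coef_pos by lia.
  destruct (Compare_dec.le_lt_dec (2 * L) l) as [Hl|Hl].
  - rewrite !positive_coef_top by lia. rewrite HE by lia. ring.
  - rewrite (descent_step L q E l) by exact Hl. field. repeat split.
    + now apply beta_denominator.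
    + now apply gamma_neq0.
    + apply INR_succ_neq0.
Qed.

Lemma amp_equation S q ell s L x x3 : good q ->
  ((forall j, In j S -> (1 <= j <= 4)%nat) ->
   frozen (p2 (med q) (tau q)) 0 0 0 q (amp S q ell s (Datatypes.S L)) x x3
     = - Theta (p2 (med q) (tau q)) (p1 (med q)) q L (amp S q ell s) x x3) /\
  ((forall j, In j S -> (4 < j)%nat) ->
   frozen (q2 (med q) (tau q)) 0 0 0 q (amp S q ell s (Datatypes.S L)) x x3
     = - Theta (q2 (med q) (tau q)) (q1 (med q)) q L (amp S q ell s) x x3).
Proof.
  intros H. pose proof (good_exponents q H) as He.
  destruct (symbols_represented (med q) q (good_medium q H) eq_refl (good_y3 q H))
    as (R1' & R2' & R3' & R4').
  assert (Sm : csmooth2 (amp_coef (Datatypes.S L) q)) by (apply csm_amp; [exact H | lia]).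
  assert (Dg : degree_le (2 * Datatypes.S L - 2) (amp_coef (Datatypes.S L) q))
    by (apply degree_amp; lia).
  assert (Z : forall c2 c1 m, Theta c2 c1 q 0 m x x3 = 0).
  { intros. unfold Theta. rewrite !(sum_n_m_zero (G := C_AbelianMonoid)) by lia.
    apply Cplus_0_l. }
  assert (main : forall K,
    (forall j, In j S -> forall c l, frozen_coef K 0 0 0 q c l j x = - reduced q c l j x) ->
    expansion S (2 * Datatypes.S L - 2)
      (frozen_coef K 0 0 0 q (amp_coef (Datatypes.S L) q)) q ell s x x3 =
    match L with
    | 0%nat => 0
    | _ => - expansion S (2 * L - 1) (amp_source L q) q ell s x x3
    end).
  { intros K HK. destruct L as [|L'].
    - rewrite <- (expansion_zero S 0 q ell s x x3). apply expansion_ext.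
      intros l j Hl Hj. rewrite (HK j Hj), amp_coef_1. unfold reduced, first_coef.
      rewrite !Nat.add_succ_r. simpl Nat.eqb. cbv iota. ring.
    - set (L := Datatypes.S L') in *.
      rewrite <- (expansion_widen S (2 * L - 1) (2 * L) (amp_source L q));
        [|apply degree_source; lia|lia].
      replace (2 * Datatypes.S L - 2)%nat with (2 * L)%nat by lia.
      rewrite <- Cmult_m1_l, expansion_scal. apply expansion_ext. intros l j Hl Hj.
      rewrite (HK j Hj), amp_coef_S by lia.
      rewrite descent_solves; [ring | exact H | apply degree_source; lia | lia]. }
  split; intros HS; unfold amp.
  - rewrite (frozen_expansion _ Kp2) by assumption. rewrite main.
    + destruct L as [|L']; [rewrite Z; ring|].
      destruct (Theta_amp S q ell s (Datatypes.S L') x x3 H) as [T _]; [lia|].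
      unfold amp in T. rewrite T; [reflexivity|]. intros j Hj; apply HS in Hj; lia.
    + intros j Hj c l. now apply frozen_coef_p, HS.
  - rewrite (frozen_expansion _ Kq2) by assumption. rewrite main.
    + destruct L as [|L']; [rewrite Z; ring|].
      destruct (Theta_amp S q ell s (Datatypes.S L') x x3 H) as [_ T]; [lia|].
      unfold amp in T. rewrite T; [reflexivity|]. intros j Hj; apply HS in Hj; lia.
    + intros j Hj c l. now apply frozen_coef_q, HS.
Qed.

(** * The transmission conditions *)

Definition Rt (t : R) (q : par) (x : R2) : C :=
  sum_n_m (fun j => RtoC (mm (med q) 3 j x t) * xij q j) 1 2.

Definition flux_coef (t : R) (q : par) (c : coefs) : coefs := fun l j x =>
  (Ci * Rt t q x + beta_ j q x * RtoC (mm (med q) 3 3 x t)) * c l j x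
  + RtoC (mm (med q) 3 3 x t) * (INR (l + 1) * c (l + 1)%nat j x).

Lemma flux_expansion t S N c q ell s x x3 : exponents_smooth q -> csmooth2 c ->
  degree_le N c ->
  flux t q (expansion S N c q ell s) x x3
  = expansion S N (flux_coef t q c) q ell s x x3.
Proof.
  intros He Hc Hd. unfold flux. fold (Rt t q x). rewrite D3_expansion by assumption.
  rewrite !expansion_scal, expansion_plus, expansion_scal.
  apply expansion_ext. intros l j _ _. unfold D3_coef, flux_coef.
  cbn [Nat.iter nat_rect]. unfold d3_coef.
  assert (I2 : Ci * (- Ci) = 1) by (apply C_ext; simpl; ring).
  set (m := RtoC (mm (med q) 3 3 x t)). set (r := Rt t q x).
  set (v := beta_ j q x * c l j x + INR (l + 1) * c (l + 1)%nat j x).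
  replace (Ci * (r * c l j x + m * ((- Ci) ^ 1 * v))) with
    (Ci * r * c l j x + (Ci * (- Ci)) * m * v) by ring.
  rewrite I2. unfold v. ring.
Qed.

Lemma D3_minus u v x x3 : Csmooth u -> Csmooth v ->
  D3 1 (fun y y3 => u y y3 - v y y3) x x3 = D3 1 u x x3 - D3 1 v x x3.
Proof.
  intros Hu Hv. rewrite !D3_cpdn. simpl cpdn.
  rewrite (cpd_minus 3 u v Hu Hv). ring.
Qed.

Lemma flux_minus t q u v x x3 : Csmooth u -> Csmooth v ->
  flux t q (fun y y3 => u y y3 - v y y3) x x3 = flux t q u x x3 - flux t q v x x3.
Proof. intros Hu Hv. unfold flux. rewrite D3_minus by assumption. ring. Qed.

Lemma expansion_three j1 j2 j3 N c q ell s x x3 :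
  expansion [j1; j2; j3] N c q ell s x x3 =
  alpha_ ell j1 * branch N (fun l => c l j1) (beta_ j1 q) (delta_ j1 q) q s x x3
  + (alpha_ ell j2 * branch N (fun l => c l j2) (beta_ j2 q) (delta_ j2 q) q s x x3
  + alpha_ ell j3 * branch N (fun l => c l j3) (beta_ j3 q) (delta_ j3 q) q s x x3).
Proof.
  rewrite !expansion_cons. cbn [expansion map fold_right]. f_equal. f_equal.
  apply Cplus_0_r.
Qed.

Definition unit_source (q : par) (s : R) : C :=
  Cexp (- (tau q * s) - Ci * sum_n_m (fun j => co (ypr q) j * xij q j) 1 2).

(** At z = 0 only the term l = 0 remains, and exp(b x_3 - b y_3) is 1. *)
Lemma branch_at_y3 N c b q s x :
  branch N c b b q s x (y3 q) = c 0%nat x * unit_source q s.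
Proof.
  unfold branch. rewrite (Csum_widen _ 0 N); [|lia|].
  - rewrite Csum_O. unfold mono, expph, phase, unit_source. simpl pow.
    rewrite Cmult_1_r. f_equal. f_equal. ring.
  - intros l Hl. unfold mono.
    rewrite Rminus_diag, pow_i by lia. ring.
Qed.

(** The first two branches are the same above and below y_3. *)
Lemma jump_at_y3 j1 j2 j3 j4 N c q ell s x :
  beta_ j3 q = delta_ j3 q -> beta_ j4 q = delta_ j4 q ->
  alpha_ ell j3 = alpha_ ell j4 ->
  expansion [j1; j2; j3] N c q ell s x (y3 q)
  - expansion [j1; j2; j4] N c q ell s x (y3 q)
  = alpha_ ell j3 * ((c 0%nat j3 x - c 0%nat j4 x) * unit_source q s).
Proof.
  intros H3 H4 Ha. rewrite !expansion_three, H3, H4, <- Ha, !branch_at_y3. ring.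
Qed.

Definition exp0 (d : R2 -> C) (q : par) (s : R) (x : R2) : C :=
  Cexp (- (d x * y3 q) - tau q * s
        - Ci * sum_n_m (fun j => co (ypr q) j * xij q j) 1 2).

Lemma branch_at_0 N c b d q s x :
  branch N c b d q s x 0 = sum_n (fun l => c l x * ypow q l) N * exp0 d q s x.
Proof.
  unfold branch. rewrite Cmult_comm, <- Csum_scal. apply Csum_ext. intros l _.
  unfold mono, ypow, expph, phase, exp0.
  replace (0 - y3 q)%R with (- y3 q)%R by ring.
  replace (b x * RtoC 0 - d x * y3 q) with (- (d x * y3 q)) by ring. ring.
Qed.

(** Here z = -y_3. *)
Definition val0 (N : nat) (c : coefs) (q : par) (j : nat) (x : R2) : C :=
  sum_n (fun l => c l j x * ypow q l) N.
Definition der0 (N : nat) (c : coefs) (q : par) (j : nat) (x : R2) : C :=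
  sum_n (fun l => INR (l + 1) * c (l + 1)%nat j x * ypow q l) N.

Lemma val0_flux t N c q j x :
  val0 N (flux_coef t q c) q j x =
  (Ci * Rt t q x + beta_ j q x * RtoC (mm (med q) 3 3 x t)) * val0 N c q j x
  + RtoC (mm (med q) 3 3 x t) * der0 N c q j x.
Proof.
  unfold val0, der0. rewrite <- !Csum_scal, <- Csum_plus. apply Csum_ext.
  intros l _. unfold flux_coef. ring.
Qed.

Lemma val0_split L c q j x : (1 <= L)%nat ->
  val0 (2 * L) c q j x
  = c 0%nat j x + sum_n_m (fun l => c l j x * ypow q l) 1 (2 * L).
Proof.
  intros HL. unfold val0. destruct (2 * L)%nat as [|n] eqn:E; [lia|].
  rewrite Csum_shift, Csum1. unfold ypow at 1. simpl pow. cring.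
Qed.

Lemma der0_split L c q j x : (1 <= L)%nat -> degree_le (2 * L) c ->
  der0 (2 * L) c q j x
  = sum_n_m (fun l => INR l * c l j x * ypow q (l - 1)) 1 (2 * L).
Proof.
  intros HL Hd. unfold der0. destruct (2 * L)%nat as [|n] eqn:E; [lia|].
  rewrite Csum_S, Csum1, (Hd (S n + 1)%nat) by lia. transitivity (sum_n (fun l =>
    INR (l + 1) * c (l + 1)%nat j x * ypow q l) n); [cring|].
  apply Csum_ext. intros l _. now rewrite Nat.add_1_r, Nat.sub_1_r.
Qed.

(** The conditions at x_3 = 0, in terms of the values at 0 of the polynomial
    factors: the branches 1, 3, 5 share one exponential there and the branches
    2, 6, 7 share another. *)
Definition matched (q : par) (N : nat) (c : coefs) (x : R2) : Prop :=
  let v := fun j => val0 N c q j x in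
  let w := fun j => (Ci * R0 q x + beta_ j q x * m0 3 3 q x) * val0 N c q j x
                    + m0 3 3 q x * der0 N c q j x in
  let k := RtoC (kk (med q)) in
  v 1%nat + v 3%nat = v 5%nat /\ v 2%nat = v 6%nat + v 7%nat /\
  w 1%nat + w 3%nat = k * w 5%nat /\ w 2%nat = k * (w 6%nat + w 7%nat).

Lemma matched_values q N c ell s x : matched q N c x ->
  expansion Sa N c q ell s x 0 = expansion Sd N c q ell s x 0 /\
  expansion Sa N (flux_coef 0 q c) q ell s x 0
    = kk (med q) * expansion Sd N (flux_coef 0 q c) q ell s x 0.
Proof.
  intros (M1 & M2 & M3 & M4). unfold Sa, Sd.
  rewrite !expansion_three, !branch_at_0. cbn [alpha_ delta_].
  split.
  - fold (val0 N c q 1 x) (val0 N c q 2 x) (val0 N c q 3 x)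
      (val0 N c q 5 x) (val0 N c q 6 x) (val0 N c q 7 x).
    rewrite M2, <- M1. ring.
  - fold (val0 N (flux_coef 0 q c) q 1 x) (val0 N (flux_coef 0 q c) q 2 x)
      (val0 N (flux_coef 0 q c) q 3 x) (val0 N (flux_coef 0 q c) q 5 x)
      (val0 N (flux_coef 0 q c) q 6 x) (val0 N (flux_coef 0 q c) q 7 x).
    rewrite !val0_flux. change (Rt 0 q x) with (R0 q x).
    change (RtoC (mm (med q) 3 3 x 0)) with (m0 3 3 q x).
    rewrite M4.
    match type of M3 with ?a + ?b = _ => replace a with (kk (med q) *
      ((Ci * R0 q x + beta_ 5 q x * m0 3 3 q x) * val0 N c q 5 x
       + m0 3 3 q x * der0 N c q 5 x) - b) by (rewrite <- M3; ring) end.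
    ring.
Qed.

(** A_2 and B_2 solve the conditions with determinant Delta_0. *)
Lemma matched_first q x : good q -> matched q 0 (first_coef q) x.
Proof.
  intros H. unfold matched. cbv zeta. unfold val0, der0. rewrite !Csum_O.
  unfold first_coef. cbn [Nat.eqb Nat.add]. unfold ypow. cbn [pow beta_].
  pose proof (good_Delta0 q H x) as N.
  unfold coefA2, coefB2.
  assert (ED : Delta0 q x = kk (med q) * flux0 mup q x - flux0 lamp q x) by reflexivity.
  assert (E1 : flux0 lamp q x = Ci * R0 q x + lamp q x * m0 3 3 q x) by reflexivity.
  assert (E2 : flux0 mup q x = Ci * R0 q x + mup q x * m0 3 3 q x) by reflexivity.
  assert (E3 : flux0 mum q x = Ci * R0 q x + mum q x * m0 3 3 q x) by reflexivity.
  assert (E4 : flux0 lamm q x = Ci * R0 q x + lamm q x * m0 3 3 q x) by reflexivity.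
  rewrite <- E1, <- E2, <- E3, <- E4.
  refine (conj _ (conj _ (conj _ _))).
  - ring.
  - ring.
  - assert (E5 : (lamm q x - lamp q x) * m0 3 3 q x = flux0 lamm q x - flux0 lamp q x)
      by (rewrite E1, E4; ring).
    replace (/ Delta0 q x * (lamm q x - lamp q x) * m0 3 3 q x * coefA1 q x)
      with (/ Delta0 q x * ((lamm q x - lamp q x) * m0 3 3 q x) * coefA1 q x) by ring.
    rewrite E5. rewrite ED in *. field. exact N.
  - rewrite ED in *. field. exact N.
Qed.

Lemma Csum1_plus (a b : nat -> C) n :
  sum_n_m (fun l => a l + b l) 1 n = sum_n_m a 1 n + sum_n_m b 1 n.
Proof. exact (sum_n_m_plus (G := C_AbelianMonoid) a b 1 n). Qed.

Lemma Csum1_scal c (a : nat -> C) n :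
  sum_n_m (fun l => c * a l) 1 n = c * sum_n_m a 1 n.
Proof. exact (sum_n_m_mult_l (K := C_Ring) c a 1 n). Qed.

Lemma Csum1_lin (k1 k2 k3 k4 : C) (a b1 b2 b3 b4 : nat -> C) n :
  (forall l, a l = k1 * b1 l + k2 * b2 l + k3 * b3 l + k4 * b4 l) ->
  sum_n_m a 1 n = k1 * sum_n_m b1 1 n + k2 * sum_n_m b2 1 n
                  + k3 * sum_n_m b3 1 n + k4 * sum_n_m b4 1 n.
Proof.
  intros H. rewrite <- !Csum1_scal, <- !Csum1_plus. apply Csum1_ext. intros; apply H.
Qed.

Definition vsum (L : nat) (q : par) (F : coefs) (j : nat) (x : R2) : C :=
  sum_n_m (fun l => F l j x * ypow q l) 1 (2 * L).
Definition dsum (L : nat) (q : par) (F : coefs) (j : nat) (x : R2) : C :=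
  sum_n_m (fun l => INR l * F l j x * ypow q (l - 1)) 1 (2 * L).

Definition vterm (q : par) (F : coefs) (j : nat) (x : R2) (l : nat) : C :=
  F l j x * ypow q l.
Definition dterm (q : par) (F : coefs) (j : nat) (x : R2) (l : nat) : C :=
  INR l * F l j x * ypow q (l - 1).

Lemma coefA3_vsum L q F x :
  coefA3 L q F x = - (vsum L q F 1 x + vsum L q F 3 x - vsum L q F 5 x).
Proof.
  unfold coefA3. rewrite (Csum1_lin 1 1 (-1) 0 _ (vterm q F 1 x) (vterm q F 3 x)
    (vterm q F 5 x) (vterm q F 5 x)) by (intros; unfold vterm; ring).
  unfold vsum, vterm. ring.
Qed.

Lemma coefB3_vsum L q F x :
  coefB3 L q F x = - (vsum L q F 2 x - vsum L q F 6 x - vsum L q F 7 x).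
Proof.
  unfold coefB3. rewrite (Csum1_lin 1 (-1) (-1) 0 _ (vterm q F 2 x) (vterm q F 6 x)
    (vterm q F 7 x) (vterm q F 7 x)) by (intros; unfold vterm; ring).
  unfold vsum, vterm. ring.
Qed.

Lemma coefA4_vsum L q F x :
  coefA4 L q F x =
  - (Ci * R0 q x * (vsum L q F 1 x + vsum L q F 3 x))
  - m0 3 3 q x * (dsum L q F 1 x + dsum L q F 3 x
                  + lamp q x * vsum L q F 1 x + lamm q x * vsum L q F 3 x)
  + kk (med q) * (Ci * R0 q x) * vsum L q F 5 x
  + kk (med q) * m0 3 3 q x * (dsum L q F 5 x + mup q x * vsum L q F 5 x).
Proof.
  unfold coefA4.
  rewrite (Csum1_lin 1 1 0 0 (fun l => (F l 1%nat x + F l 3%nat x) * ypow q l)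
    (vterm q F 1 x) (vterm q F 3 x) (vterm q F 3 x) (vterm q F 3 x))
    by (intros; unfold vterm; ring).
  rewrite (Csum1_lin 1 1 (lamp q x) (lamm q x) (fun l => INR l * _ * _ + (_ + _) * _)
    (dterm q F 1 x) (dterm q F 3 x) (vterm q F 1 x) (vterm q F 3 x))
    by (intros; unfold vterm, dterm; ring).
  rewrite (Csum1_lin 1 (mup q x) 0 0 (fun l => INR l * F l 5%nat x * _ + _)
    (dterm q F 5 x) (vterm q F 5 x) (vterm q F 5 x) (vterm q F 5 x))
    by (intros; unfold vterm, dterm; ring).
  unfold vsum, vterm, dsum, dterm. ring.
Qed.

Lemma coefB4_vsum L q F x :
  coefB4 L q F x =
  - (Ci * R0 q x * vsum L q F 2 x)
  - m0 3 3 q x * (dsum L q F 2 x + lamp q x * vsum L q F 2 x)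
  + kk (med q) * (Ci * R0 q x) * (vsum L q F 6 x + vsum L q F 7 x)
  + kk (med q) * m0 3 3 q x * (dsum L q F 6 x + dsum L q F 7 x
      + mup q x * vsum L q F 6 x + mum q x * vsum L q F 7 x).
Proof.
  unfold coefB4.
  rewrite (Csum1_lin 1 1 0 0 (fun l => (F l 6%nat x + F l 7%nat x) * ypow q l)
    (vterm q F 6 x) (vterm q F 7 x) (vterm q F 7 x) (vterm q F 7 x))
    by (intros; unfold vterm; ring).
  rewrite (Csum1_lin 1 1 (mup q x) (mum q x) (fun l => INR l * _ * _ + (_ + _) * _)
    (dterm q F 6 x) (dterm q F 7 x) (vterm q F 6 x) (vterm q F 7 x))
    by (intros; unfold vterm, dterm; ring).
  rewrite (Csum1_lin 1 (lamp q x) 0 0 (fun l => INR l * F l 2%nat x * _ + _)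
    (dterm q F 2 x) (vterm q F 2 x) (vterm q F 2 x) (vterm q F 2 x))
    by (intros; unfold vterm, dterm; ring).
  unfold vsum, vterm, dsum, dterm. ring.
Qed.

(** The conditions on the values hold by the definition of A_5 and B_5; given these,
    the conditions on the fluxes are linear equations for A_7 and B_7 with
    determinant Delta_0. *)
Lemma matched_next L q E x : good q -> (1 <= L)%nat ->
  matched q (2 * L) (next_coef L q E) x.
Proof.
  intros H HL. unfold matched. cbv zeta.
  rewrite !val0_split, !der0_split by (exact HL || apply degree_next).
  set (F := next_coef L q E).
  fold (vsum L q F 1 x) (vsum L q F 2 x) (vsum L q F 3 x) (vsum L q F 5 x)
    (vsum L q F 6 x) (vsum L q F 7 x).
  fold (dsum L q F 1 x) (dsum L q F 2 x) (dsum L q F 3 x) (dsum L q F 5 x)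
    (dsum L q F 6 x) (dsum L q F 7 x).
  assert (Z : forall j, F 0%nat j x = zeroth_coef L q F j x).
  { intros j. now apply next_coef_zero. }
  rewrite !Z. cbn [zeroth_coef beta_].
  pose proof (good_Delta0 q H x) as N.
  assert (ED : Delta0 q x = kk (med q) * flux0 mup q x - flux0 lamp q x) by reflexivity.
  assert (D7 : Delta0 q x * coefA7 L q F x
    = flux0 lamp q x * coefA5 L q F x - coefA6 L q F x).
  { unfold coefA7. field. exact N. }
  assert (D7' : Delta0 q x * coefB7 L q F x
    = flux0 lamp q x * coefB5 L q F x - coefB6 L q F x).
  { unfold coefB7. field. exact N. }
  rewrite ED in D7, D7'. unfold coefA5, coefA6 in D7. unfold coefB5, coefB6 in D7'.
  unfold coefA5, coefB5.
  rewrite coefA3_vsum, coefA4_vsum in D7. rewrite coefB3_vsum, coefB4_vsum in D7'.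
  rewrite coefA3_vsum, coefB3_vsum. unfold flux0 in D7, D7'.
  set (a7 := coefA7 L q F x) in *. set (b7 := coefB7 L q F x) in *.
  set (c3 := coefC3 q F x) in *. set (c9 := coefC9 q F x) in *.
  refine (conj _ (conj _ (conj _ _))).
  - ring.
  - ring.
  - apply (f_equal Copp) in D7. apply Ceq_minus. apply Ceq_minus in D7.
    rewrite <- D7. ring.
  - apply (f_equal Copp) in D7'. apply Ceq_minus. apply Ceq_minus in D7'.
    rewrite <- D7'. ring.
Qed.

(** * Decay as x_3 tends to minus infinity *)

Definition vanishes (f : R -> C) : Prop :=
  filterlim f (Rbar_locally m_infty) (locally (RtoC 0)).

Lemma Cmod_le_sum z : (Cmod z <= Rabs (Re z) + Rabs (Im z))%R.
Proof.
  replace z with (RtoC (Re z) + RtoC (Im z) * Ci) at 1 by (apply C_ext; simpl; ring).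
  eapply Rle_trans; [apply Cmod_triangle|].
  rewrite Cmod_mult, !Cmod_R. rewrite Cmod_Ci. lra.
Qed.

Lemma Re_le_Cmod z : (Rabs (Re z) <= Cmod z)%R.
Proof. eapply Rle_trans; [apply Rmax_l | apply Rmax_Cmod]. Qed.

Lemma Im_le_Cmod z : (Rabs (Im z) <= Cmod z)%R.
Proof. eapply Rle_trans; [apply Rmax_r | apply Rmax_Cmod]. Qed.

Lemma vanishes_Cmod f : vanishes f <->
  forall eps : posreal, Rbar_locally m_infty (fun t => (Cmod (f t) < eps)%R).
Proof.
  unfold vanishes. split.
  - intros H eps.
    pose proof (proj1 (filterlim_locally (U := C_UniformSpace) f (RtoC 0)) H
      (pos_div_2 eps)) as H'. revert H'. apply filter_imp.
    intros t [H1 H2]. change (Rabs (Re (f t) - 0) < eps / 2)%R in H1.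
    change (Rabs (Im (f t) - 0) < eps / 2)%R in H2.
    rewrite Rminus_0_r in H1, H2. pose proof (Cmod_le_sum (f t)). lra.
  - intros H. apply (filterlim_locally (U := C_UniformSpace)). intros eps. pose proof (H eps) as H'.
    revert H'. apply filter_imp. intros t Ht. split.
    + change (Rabs (Re (f t) - 0) < eps)%R. rewrite Rminus_0_r.
      eapply Rle_lt_trans; [apply Re_le_Cmod | exact Ht].
    + change (Rabs (Im (f t) - 0) < eps)%R. rewrite Rminus_0_r.
      eapply Rle_lt_trans; [apply Im_le_Cmod | exact Ht].
Qed.

Lemma vanishes_dominated f (g : R -> R) :
  (forall t, (Cmod (f t) <= g t)%R) -> is_lim g m_infty 0 -> vanishes f.
Proof.
  intros Hle Hg. apply vanishes_Cmod. intros eps.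
  apply is_lim_spec in Hg. pose proof (Hg eps) as H. revert H. apply filter_imp.
  intros t Ht. rewrite Rminus_0_r in Ht. pose proof (Hle t). pose proof (Rle_abs (g t)).
  lra.
Qed.

Lemma vanishes_plus f g : vanishes f -> vanishes g -> vanishes (fun t => f t + g t).
Proof.
  rewrite !vanishes_Cmod. intros Hf Hg eps.
  pose proof (filter_and _ _ (Hf (pos_div_2 eps)) (Hg (pos_div_2 eps))) as H.
  revert H. apply filter_imp. intros t [H1 H2].
  eapply Rle_lt_trans; [apply Cmod_triangle|]. simpl in *. lra.
Qed.

Lemma vanishes_scal c f : vanishes f -> vanishes (fun t => c * f t).
Proof.
  rewrite !vanishes_Cmod. intros Hf eps.
  assert (P : (0 < eps / (Cmod c + 1))%R).
  { apply Rdiv_lt_0_compat; [apply cond_pos | pose proof (Cmod_ge_0 c); lra]. }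
  pose proof (Hf (mkposreal _ P)) as H. revert H. apply filter_imp. simpl.
  intros t Ht. rewrite Cmod_mult. pose proof (Cmod_ge_0 c). pose proof (Cmod_ge_0 (f t)).
  apply (Rmult_lt_compat_l (Cmod c + 1)) in Ht; [|lra].
  replace ((Cmod c + 1) * (eps / (Cmod c + 1)))%R with (pos eps) in Ht by (field; lra).
  nra.
Qed.

Lemma vanishes_zero : vanishes (fun _ => 0).
Proof. apply filterlim_const. Qed.

Lemma vanishes_ext f g : vanishes f -> (forall t, f t = g t) -> vanishes g.
Proof. intros H E. exact (filterlim_ext f g E H). Qed.

(** |t|^(l+1) exp(b t) is |t exp(b t / 2)| times |t|^l exp(b t / 2). *)
Lemma lim_pow_exp l b : (0 < b)%R ->
  is_lim (fun t => (Rabs t ^ l * exp (b * t))%R) m_infty 0.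
Proof.
  revert b.
  assert (L1 : forall b, (0 < b)%R -> is_lim (fun t => (b * t)%R) m_infty m_infty).
  { intros b Hb. replace m_infty with (Rbar_mult b m_infty) at 2.
    - apply is_lim_scal_l. apply is_lim_id.
    - simpl. destruct (Rle_dec 0 b) as [H|H]; [|lra].
      destruct (Rle_lt_or_eq_dec 0 b H); [reflexivity | lra]. }
  induction l as [|l IH]; intros b Hb.
  - apply (is_lim_ext (fun t => exp (b * t))%R); [intros; simpl; ring|].
    apply (is_lim_comp exp (fun t => (b * t)%R) m_infty 0 m_infty).
    + apply is_lim_exp_m.
    + now apply L1.
    + now apply filter_forall.
  - assert (H2 : (0 < b / 2)%R) by lra.
    apply (is_lim_ext (fun t => Rabs (2 / b * (b / 2 * t * exp (b / 2 * t)))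
      * (Rabs t ^ l * exp (b / 2 * t)))%R).
    + intros t. replace (2 / b * (b / 2 * t * exp (b / 2 * t)))%R with
        (t * exp (b / 2 * t))%R by (field; lra).
      rewrite Rabs_mult, (Rabs_pos_eq (exp _)) by (left; apply exp_pos).
      replace (b * t)%R with (b / 2 * t + b / 2 * t)%R by field.
      rewrite exp_plus. simpl. ring.
    + replace (Finite 0) with (Rbar_mult 0 0) by (simpl; f_equal; ring).
      apply is_lim_mult; [| now apply IH | exact I].
      replace (Finite 0) with (Rbar_abs 0) by (simpl; now rewrite Rabs_R0).
      apply is_lim_Rabs.
      replace (Finite 0) with (Rbar_mult (2 / b)%R 0) by (simpl; f_equal; ring).
      apply is_lim_scal_l.
      apply (is_lim_comp (fun y => y * exp y)%R (fun t => (b / 2 * t)%R) m_infty 0 m_infty).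
      * apply is_lim_mul_exp_m.
      * now apply L1.
      * now apply filter_forall.
Qed.

Lemma Cmod_Cexp z : Cmod (Cexp z) = exp (Re z).
Proof.
  unfold Cexp, Cmod. simpl.
  replace (exp (Re z) * cos (Im z) * (exp (Re z) * cos (Im z) * 1)
    + exp (Re z) * sin (Im z) * (exp (Re z) * sin (Im z) * 1))%R
    with (exp (Re z) * exp (Re z) * (Rsqr (sin (Im z)) + Rsqr (cos (Im z))))%R
    by (unfold Rsqr; ring).
  rewrite sin2_cos2, Rmult_1_r. apply sqrt_square. left; apply exp_pos.
Qed.

Lemma vanishes_mono c b d l q s x : (0 < Re (b x))%R ->
  vanishes (mono c b d l q s x).
Proof.
  intros Hb. set (K := (Cmod (c x) * exp (Re (phase b d q s x (y3 q))))%R).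
  apply (vanishes_dominated _ (fun t => K * (Rabs (t - y3 q) ^ l
    * exp (Re (b x) * (t - y3 q))))%R).
  - intros t. unfold mono, expph. rewrite !Cmod_mult, Cmod_Cexp, Cmod_R.
    rewrite <- RPow_abs.
    replace (Re (phase b d q s x t)) with
      (Re (phase b d q s x (y3 q)) + Re (b x) * (t - y3 q))%R.
    + rewrite exp_plus. unfold K. right. ring.
    + unfold phase, Cminus. simpl. unfold Re, Im. ring.
  - replace (Finite 0) with (Rbar_mult K 0) by (simpl; f_equal; ring).
    apply is_lim_scal_l.
    apply (is_lim_comp (fun t => Rabs t ^ l * exp (Re (b x) * t))%R
      (fun t => (t - y3 q)%R) m_infty 0 m_infty).
    + now apply lim_pow_exp.
    + apply is_lim_minus with (lf := m_infty) (lg := Finite (y3 q)).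
      * apply is_lim_id.
      * apply is_lim_const.
      * reflexivity.
    + now apply filter_forall.
Qed.

Lemma vanishes_expansion S N c q ell s x :
  (forall j, In j S -> (0 < Re (beta_ j q x))%R) ->
  vanishes (expansion S N c q ell s x).
Proof.
  intros HS. induction S as [|j S IH]; [exact vanishes_zero|].
  apply (vanishes_plus (fun t => alpha_ ell j * branch N (fun l => c l j)
    (beta_ j q) (delta_ j q) q s x t)); [|apply IH; intros; apply HS; simpl; auto].
  apply vanishes_scal. unfold branch.
  assert (V : forall l, vanishes (mono (c l j) (beta_ j q) (delta_ j q) l q s x)).
  { intros l. apply vanishes_mono, HS. simpl; auto. }
  clear IH. induction N as [|N IHN].
  - apply (vanishes_ext _ _ (V 0%nat)). intros t. now rewrite Csum_O.
  - apply (vanishes_ext _ _ (vanishes_plus _ _ IHN (V (Datatypes.S N)))).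
    intros t. cbv beta. now rewrite Csum_S.
Qed.

(** * The amplitudes solve the hierarchy *)

Lemma amp_at_0 q ell s L x : good q ->
  amp Sa q ell s (S L) x 0 = amp Sd q ell s (S L) x 0 /\
  flux 0 q (amp Sa q ell s (S L)) x 0 = kk (med q) * flux 0 q (amp Sd q ell s (S L)) x 0.
Proof.
  intros H. unfold amp.
  assert (Sm : csmooth2 (amp_coef (S L) q)) by (apply csm_amp; [exact H | lia]).
  assert (Dg : degree_le (2 * S L - 2) (amp_coef (S L) q)) by (apply degree_amp; lia).
  pose proof (good_exponents q H) as He.
  rewrite !flux_expansion by assumption. apply matched_values.
  destruct L as [|L]; [now apply matched_first|].
  rewrite amp_coef_S by lia.
  replace (2 * S (S L) - 2)%nat with (2 * S L)%nat by lia.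
  apply matched_next; [exact H | lia].
Qed.

Lemma flux_coef_jump q c x j1 j2 : good q ->
  c 0%nat j1 x = c 0%nat j2 x ->
  flux_coef (y3 q) q c 0%nat j1 x - flux_coef (y3 q) q c 0%nat j2 x
  = m1 3 3 q x * ((beta_ j1 q x - beta_ j2 q x) * c 0%nat j1 x
                  + (c 1%nat j1 x - c 1%nat j2 x)).
Proof.
  intros H E. unfold flux_coef. rewrite <- E. simpl Nat.add.
  change (RtoC (mm (med q) 3 3 x (y3 q))) with (m1 3 3 q x). simpl INR. ring.
Qed.

Definition kappa (L : nat) : C := RtoC (if Nat.eqb L 0 then 1 else 0).

(** A_1 and C_3 are chosen so that the homogeneous solutions with exponents
    lambda_- above and lambda_+ below y_3 produce the prescribed jump of the flux. *)
Lemma amp_coef_jump_lam q L x : good q ->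
  amp_coef (S L) q 0%nat 3%nat x = amp_coef (S L) q 0%nat 4%nat x /\
  flux_coef (y3 q) q (amp_coef (S L) q) 0%nat 3%nat x
  - flux_coef (y3 q) q (amp_coef (S L) q) 0%nat 4%nat x = - (kappa L * invJy q).
Proof.
  intros H. pose proof (good_m1 q x H) as Nm. pose proof (lam_distinct q x H) as Nl.
  assert (E : amp_coef (S L) q 0%nat 3%nat x = amp_coef (S L) q 0%nat 4%nat x).
  { destruct L as [|L]; [reflexivity|]. now rewrite amp_coef_S by lia. }
  split; [exact E|]. rewrite flux_coef_jump by assumption. cbn [beta_].
  destruct L as [|L].
  - rewrite amp_coef_1. unfold first_coef, kappa. cbn [Nat.eqb]. unfold coefA1.
    field. now split.
  - rewrite amp_coef_S by lia. set (F := next_coef (S L) q (amp_source (S L) q)).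
    replace (F 0%nat 3%nat x) with (coefC3 q F x)
      by (symmetry; apply (next_coef_zero (S L) q _ 3); lia).
    unfold coefC3, kappa. cbn [Nat.eqb]. field. exact Nl.
Qed.

Lemma amp_coef_jump_mu q L x : good q ->
  amp_coef (S L) q 0%nat 7%nat x = amp_coef (S L) q 0%nat 8%nat x /\
  kk (med q) * (flux_coef (y3 q) q (amp_coef (S L) q) 0%nat 7%nat x
  - flux_coef (y3 q) q (amp_coef (S L) q) 0%nat 8%nat x) = - (kappa L * invJy q).
Proof.
  intros H. pose proof (good_m1 q x H) as Nm. pose proof (mu_distinct q x H) as Nl.
  pose proof (good_k q H) as Nk.
  assert (E : amp_coef (S L) q 0%nat 7%nat x = amp_coef (S L) q 0%nat 8%nat x).
  { destruct L as [|L]; [reflexivity|]. now rewrite amp_coef_S by lia. }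
  split; [exact E|]. rewrite flux_coef_jump by assumption. cbn [beta_].
  destruct L as [|L].
  - rewrite amp_coef_1. unfold first_coef, kappa. cbn [Nat.eqb]. unfold coefB1.
    field. now repeat split.
  - rewrite amp_coef_S by lia. set (F := next_coef (S L) q (amp_source (S L) q)).
    replace (F 0%nat 7%nat x) with (coefC9 q F x)
      by (symmetry; apply (next_coef_zero (S L) q _ 7); lia).
    unfold coefC9, kappa. cbn [Nat.eqb]. field. exact Nl.
Qed.

Lemma amp_hierarchy q ell s : good q ->
  hierarchy q ell s (amp Sa q ell s) (amp Sb q ell s) (amp Sd q ell s) (amp Se q ell s).
Proof.
  intros H L. cbv zeta. fold (kappa L).
  assert (Sm : csmooth2 (amp_coef (S L) q)) by (apply csm_amp; [exact H | lia]).
  assert (Dg : degree_le (2 * S L - 2) (amp_coef (S L) q)) by (apply degree_amp; lia).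
  pose proof (good_exponents q H) as He.
  assert (CS : forall I, Csmooth (amp I q ell s (S L))).
  { intros I. apply Csmooth_amp; [exact H | lia]. }
  assert (Ia : forall j, In j Sa -> (1 <= j <= 4)%nat)
    by (unfold Sa; simpl; intros; lia).
  assert (Ib : forall j, In j Sb -> (1 <= j <= 4)%nat)
    by (unfold Sb; simpl; intros; lia).
  assert (Id : forall j, In j Sd -> (4 < j)%nat)
    by (unfold Sd; simpl; intros; lia).
  assert (Ie : forall j, In j Se -> (4 < j)%nat)
    by (unfold Se; simpl; intros; lia).
  refine (conj _ (conj _ (conj _ (conj _ (conj _ _))))).
  - exact (conj (CS Sa) (conj (CS Sb) (conj (CS Sd) (CS Se)))).
  - intros x x3 _. exact (conj (proj1 (amp_equation Sa q ell s L x x3 H) Ia)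
      (proj2 (amp_equation Sd q ell s L x x3 H) Id)).
  - intros x x3 _. exact (conj (proj1 (amp_equation Sb q ell s L x x3 H) Ib)
      (proj2 (amp_equation Se q ell s L x x3 H) Ie)).
  - intros x. destruct (exponents_Re q x H) as (P1 & _ & P2 & _).
    split; apply vanishes_expansion; intros j [<- | [<- | [<- | []]]]; assumption.
  - intros x.
    destruct (amp_coef_jump_lam q L x H) as [E1 F1].
    destruct (amp_coef_jump_mu q L x H) as [E2 F2].
    rewrite !flux_minus by apply CS. unfold amp.
    rewrite !flux_expansion by assumption. unfold source. fold (unit_source q s).
    refine (conj _ (conj _ (conj _ _))).
    + apply Ceq_minus. unfold Sa, Sb. rewrite jump_at_y3 by reflexivity.
      rewrite E1. ring.
    + apply Ceq_minus. unfold Sd, Se. rewrite jump_at_y3 by reflexivity.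
      rewrite E2. ring.
    + unfold Sa, Sb. rewrite jump_at_y3 by reflexivity. rewrite F1.
      cbn [alpha_]. ring.
    + unfold Sd, Se. rewrite jump_at_y3 by reflexivity.
      cbn [alpha_].
      match goal with |- ?k * (?a * (?f * ?u)) = _ =>
        replace (k * (a * (f * u))) with (a * (k * f) * u) by ring end.
      rewrite F2. ring.
  - intros x. exact (amp_at_0 q ell s L x H).
Qed.

(** * Second order equations in x_3 *)

(** The equation is required on the open interval only; the endpoints are reached
    by continuity, so the conditions imposed there can be used. *)
Lemma constant_of_cpd3 v x t1 t2 : Csmooth v -> (t1 <= t2)%R ->
  (forall t, (t1 < t < t2)%R -> cpd 3 v x t = 0) -> v x t1 = v x t2.
Proof.
  intros [S1 S2] Ht Hd.
  assert (P : forall g : R2 -> R -> R, smooth g ->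
    (forall t, (t1 < t < t2)%R -> pd 3 g x t = 0%R) -> g x t1 = g x t2).
  { intros g Hg Hz.
    destruct (MVT_gen (g x) t1 t2 (fun _ => 0%R)) as (c & _ & E).
    - rewrite Rmin_left, Rmax_right by exact Ht. intros t Ht'.
      rewrite <- (Hz t Ht'). apply Derive_correct. apply (Hg [] x t) with (i := 3%nat).
    - intros t _. apply continuity_pt_filterlim.
      apply (@ex_derive_continuous R_AbsRing R_NormedModule).
      apply (Hg [] x t) with (i := 3%nat).
    - lra. }
  apply C_ext.
  - apply (P _ S1). intros t Hz. exact (f_equal Re (Hd t Hz)).
  - apply (P _ S2). intros t Hz. exact (f_equal Im (Hd t Hz)).
Qed.

Definition dminus (mu : C) (u : R2 -> R -> C) : R2 -> R -> C := fun x x3 =>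
  cpd 3 u x x3 - mu * u x x3.

Lemma Csmooth_dminus mu u : Csmooth u -> Csmooth (dminus mu u).
Proof.
  intros Hu. apply Csmooth_minus; [now apply Csmooth_cpd|].
  apply Csmooth_mult; [apply Csmooth_const | exact Hu].
Qed.

Definition cexp3 (c : C) : R2 -> R -> C := fun _ x3 => Cexp (c * RtoC x3).

Lemma Csmooth_cx3 c : Csmooth (fun _ x3 => c * RtoC x3).
Proof. apply (Csmooth_mult (fun _ _ => c)); [apply Csmooth_const | apply Csmooth_x3]. Qed.

Lemma cpd3_cexp3 c : cpd 3 (cexp3 c) = fun x x3 => c * cexp3 c x x3.
Proof.
  unfold cexp3. rewrite (cpd_Cexp 3 _ (Csmooth_cx3 c)).
  rewrite (cpd_scal 3 c _ Csmooth_x3), cpd3_x3.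
  extensionality x; extensionality x3. ring.
Qed.

Lemma Cexp_plus z w : Cexp (z + w) = Cexp z * Cexp w.
Proof.
  unfold Cexp. apply C_ext; simpl; unfold Re, Im.
  - rewrite exp_plus, cos_plus. ring.
  - rewrite exp_plus, sin_plus. ring.
Qed.

Lemma Cexp_0 : Cexp 0 = 1.
Proof. unfold Cexp. simpl. rewrite exp_0, cos_0, sin_0. apply C_ext; simpl; ring. Qed.

Lemma Cexp_neq0 z : Cexp z <> 0.
Proof.
  intros E. pose proof (Cmod_Cexp z) as M. rewrite E, Cmod_0 in M.
  pose proof (exp_pos (Re z)). lra.
Qed.

Definition solves2 (lam mu : C) (u : R2 -> R -> C) (x : R2) (t : R) : Prop :=
  cpd 3 (cpd 3 u) x t - (lam + mu) * cpd 3 u x t + lam * mu * u x t = 0.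

Lemma solves2_sym lam mu u x t : solves2 lam mu u x t -> solves2 mu lam u x t.
Proof.
  unfold solves2. intros E. rewrite <- E. ring.
Qed.

(** The equation is (d - lam)(d - mu) u = 0, so (u' - mu u) exp(- lam x_3) is
    constant. *)
Lemma dminus_constant lam mu u x t1 t2 : Csmooth u -> (t1 <= t2)%R ->
  (forall t, (t1 < t < t2)%R -> solves2 lam mu u x t) ->
  dminus mu u x t1 * Cexp (- lam * RtoC t1) = dminus mu u x t2 * Cexp (- lam * RtoC t2).
Proof.
  intros Hu Ht Hs.
  assert (Sd : Csmooth (dminus mu u)) by now apply Csmooth_dminus.
  assert (Se : Csmooth (cexp3 (- lam))) by now apply Csmooth_Cexp, Csmooth_cx3.
  apply (constant_of_cpd3 (fun y y3 => dminus mu u y y3 * cexp3 (- lam) y y3)).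
  - now apply Csmooth_mult.
  - exact Ht.
  - intros t Hti. rewrite (cpd_mult 3 _ _ Sd Se), cpd3_cexp3.
    unfold dminus at 1.
    rewrite (cpd_minus 3 (cpd 3 u) (fun y y3 => mu * u y y3));
      [|now apply Csmooth_cpd|now apply Csmooth_mult; [apply Csmooth_const|]].
    rewrite (cpd_scal 3 mu u Hu). unfold dminus.
    specialize (Hs t Hti). unfold solves2 in Hs.
    transitivity ((cpd 3 (cpd 3 u) x t - (lam + mu) * cpd 3 u x t
      + lam * mu * u x t) * cexp3 (- lam) x t); [ring|]. rewrite Hs. ring.
Qed.

Lemma dminus_zero lam mu u x t1 t2 : Csmooth u -> (t1 <= t2)%R ->
  (forall t, (t1 < t < t2)%R -> solves2 lam mu u x t) ->
  dminus mu u x t1 = 0 <-> dminus mu u x t2 = 0.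
Proof.
  intros Hu Ht Hs. pose proof (dminus_constant lam mu u x t1 t2 Hu Ht Hs) as E.
  split; intros Z; rewrite Z, Cmult_0_l in E.
  - symmetry in E. destruct (Ceq_dec (dminus mu u x t2) 0) as [|N]; [assumption|].
    exfalso. revert E. apply Cmult_neq_0; [exact N | apply Cexp_neq0].
  - destruct (Ceq_dec (dminus mu u x t1) 0) as [|N]; [assumption|].
    exfalso. revert E. apply Cmult_neq_0; [exact N | apply Cexp_neq0].
Qed.

Lemma both_dminus_zero lam mu u x t : lam - mu <> 0 ->
  dminus lam u x t = 0 -> dminus mu u x t = 0 -> u x t = 0.
Proof.
  unfold dminus. intros N E1 E2.
  assert (E : (lam - mu) * u x t = 0).
  { replace ((lam - mu) * u x t) with
      ((cpd 3 u x t - mu * u x t) - (cpd 3 u x t - lam * u x t)) by ring.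
    rewrite E1, E2. ring. }
  replace (u x t) with (/ (lam - mu) * ((lam - mu) * u x t)) by (field; exact N).
  rewrite E. ring.
Qed.

Lemma vanishes_mult f g : vanishes f -> vanishes g -> vanishes (fun t => f t * g t).
Proof.
  rewrite !vanishes_Cmod. intros Hf Hg eps.
  pose proof (filter_and _ _ (Hf (mkposreal 1 Rlt_0_1)) (Hg eps)) as H.
  revert H. apply filter_imp. simpl. intros t [H1 H2]. rewrite Cmod_mult.
  pose proof (Cmod_ge_0 (f t)). pose proof (Cmod_ge_0 (g t)). nra.
Qed.

Lemma vanishes_ext_below f g y : vanishes f -> (forall t, (t < y)%R -> f t = g t) ->
  vanishes g.
Proof.
  intros Hf E. apply (filterlim_ext_loc f g); [|exact Hf].
  exists y. exact E.
Qed.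

Lemma vanishes_const c : vanishes (fun _ => c) -> c = 0.
Proof.
  intros H. rewrite vanishes_Cmod in H. apply Cmod_eq_0.
  destruct (Req_dec (Cmod c) 0) as [|N]; [assumption|].
  pose proof (Cmod_ge_0 c). assert (P : (0 < Cmod c)%R) by lra.
  destruct (H (mkposreal _ P)) as [M HM]. specialize (HM (M - 1)%R ltac:(lra)).
  simpl in HM. lra.
Qed.

Lemma vanishes_Cexp c : (0 < Re c)%R -> vanishes (fun t => Cexp (c * RtoC t)).
Proof.
  intros Hc. apply (vanishes_dominated _ (fun t => Rabs t ^ 0 * exp (Re c * t))%R).
  - intros t. rewrite Cmod_Cexp, re_scal_r. right. simpl. ring.
  - now apply lim_pow_exp.
Qed.

(** If A and B are the constants of [dminus_constant] for the two roots, then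
    A = B exp((mu - lam) x_3) - (mu - lam) u exp(- lam x_3), and the right-hand side
    tends to 0 at minus infinity. *)
Lemma dminus_decay lam mu u x y : Csmooth u ->
  (forall t, (t < y)%R -> solves2 lam mu u x t) ->
  (Re lam < 0)%R -> (0 < Re mu)%R -> vanishes (u x) -> dminus mu u x y = 0.
Proof.
  intros Hu Hs Hl Hm Hv.
  set (A := dminus mu u x y * Cexp (- lam * RtoC y)).
  set (B := dminus lam u x y * Cexp (- mu * RtoC y)).
  assert (EA : forall t, (t < y)%R -> dminus mu u x t * Cexp (- lam * RtoC t) = A).
  { intros t Ht. apply dminus_constant; [exact Hu | lra |].
    intros t' Ht'. apply Hs. lra. }
  assert (EB : forall t, (t < y)%R -> dminus lam u x t * Cexp (- mu * RtoC t) = B).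
  { intros t Ht. apply dminus_constant; [exact Hu | lra |].
    intros t' Ht'. apply solves2_sym, Hs. lra. }
  assert (Z : A = 0).
  { apply vanishes_const.
    apply (vanishes_ext_below (fun t => B * Cexp ((mu - lam) * RtoC t)
      + - (mu - lam) * (u x t * Cexp (- lam * RtoC t))) _ y).
    - apply vanishes_plus; apply vanishes_scal.
      + apply vanishes_Cexp. change (0 < Re mu + - Re lam)%R. lra.
      + apply vanishes_mult; [exact Hv|]. apply vanishes_Cexp.
        change (0 < - Re lam)%R. lra.
    - intros t Ht. rewrite <- (EA t Ht), <- (EB t Ht).
      replace ((mu - lam) * RtoC t) with (mu * RtoC t + - lam * RtoC t) by ring.
      rewrite Cexp_plus.
      assert (I : Cexp (- mu * RtoC t) * Cexp (mu * RtoC t) = 1).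
      { rewrite <- Cexp_plus. replace (- mu * RtoC t + mu * RtoC t) with (RtoC 0) by ring.
        apply Cexp_0. }
      replace (dminus lam u x t * Cexp (- mu * RtoC t)
          * (Cexp (mu * RtoC t) * Cexp (- lam * RtoC t)))
        with (dminus lam u x t * Cexp (- lam * RtoC t)
          * (Cexp (- mu * RtoC t) * Cexp (mu * RtoC t))) by ring.
      rewrite I. unfold dminus. ring. }
  destruct (Ceq_dec (dminus mu u x y) 0) as [|N]; [assumption|].
  exfalso. revert Z. apply Cmult_neq_0; [exact N | apply Cexp_neq0].
Qed.

(** * The homogeneous equations of p_2 and q_2 *)

Lemma frozen_minus c q u v x x3 : Csmooth u -> Csmooth v ->
  frozen c 0 0 0 q (fun y y3 => u y y3 - v y y3) x x3
  = frozen c 0 0 0 q u x x3 - frozen c 0 0 0 q v x x3.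
Proof.
  intros Hu Hv. unfold frozen.
  assert (E : forall i, D3 i (fun y y3 => u y y3 - v y y3) x x3
    = D3 i u x x3 - D3 i v x x3).
  { intros i. rewrite !D3_cpdn.
    replace (cpdn 3 i (fun y y3 => u y y3 - v y y3)) with
      (fun y y3 => cpdn 3 i u y y3 - cpdn 3 i v y y3); [ring|].
    induction i as [|i IH]; [reflexivity|]. simpl. rewrite <- IH. symmetry.
    now apply cpd_minus; apply Csmooth_cpdn. }
  rewrite !Csum_S, !Csum_O, !E. ring.
Qed.

Lemma frozen_values op K q u x x3 : represents op K q ->
  frozen op 0 0 0 q u x x3 =
  K 0%nat 0%nat 0%nat 0%nat q x * u x x3
  - Ci * K 1%nat 0%nat 0%nat 0%nat q x * cpd 3 u x x3
  - K 2%nat 0%nat 0%nat 0%nat q x * cpd 3 (cpd 3 u) x x3.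
Proof.
  intros HK. unfold frozen. rewrite !Csum_S, Csum_O, !HK by lia. rewrite !D3_cpdn.
  simpl cpdn. assert (I2 : (- Ci) ^ 2 = -1) by (apply C_ext; simpl; ring).
  rewrite I2. simpl pow. ring.
Qed.

(** Vieta's formulas for the characteristic polynomial. *)
Lemma root_sum_product q x z1 z2 r t : good q ->
  z1 * m1 3 3 q x + Ci * R1 q x = r -> z2 * m1 3 3 q x + Ci * R1 q x = - r ->
  r * r = radicand t q x ->
  m1 3 3 q x * (z1 + z2) = - (2 * Ci * R1 q x) /\
  m1 3 3 q x * (z1 * z2) = - (quad_form q x + t).
Proof.
  intros H E1 E2 Er. pose proof (good_m1 q x H) as N.
  assert (Ch : m1 3 3 q x * (z1 * z1) + 2 * Ci * R1 q x * z1 = quad_form q x + t).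
  { apply characteristic; [exact H|]. now rewrite E1. }
  assert (S : m1 3 3 q x * (z1 + z2) = - (2 * Ci * R1 q x)).
  { replace (m1 3 3 q x * (z1 + z2)) with
      ((z1 * m1 3 3 q x + Ci * R1 q x) + (z2 * m1 3 3 q x + Ci * R1 q x)
       - 2 * Ci * R1 q x) by ring. rewrite E1, E2. ring. }
  split; [exact S|]. rewrite <- Ch.
  replace (m1 3 3 q x * (z1 * z2)) with
    (m1 3 3 q x * (z1 + z2) * z1 - m1 3 3 q x * (z1 * z1)) by ring.
  rewrite S. ring.
Qed.

Lemma solves2_frozen op K (g z1 z2 r t : C) q u x y : good q -> represents op K q ->
  g <> 0 -> K 0%nat 0%nat 0%nat 0%nat q x = g * quad_form q x + tau q ->
  K 1%nat 0%nat 0%nat 0%nat q x = g * (2 * R1 q x) ->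
  K 2%nat 0%nat 0%nat 0%nat q x = g * m1 3 3 q x ->
  z1 * m1 3 3 q x + Ci * R1 q x = r -> z2 * m1 3 3 q x + Ci * R1 q x = - r ->
  r * r = radicand t q x -> g * t = tau q ->
  frozen op 0 0 0 q u x y = 0 -> solves2 z1 z2 u x y.
Proof.
  intros H HK Ng V0 V1 V2 E1 E2 Er Et E. pose proof (good_m1 q x H) as N.
  rewrite (frozen_values _ K) in E by exact HK. rewrite V0, V1, V2, <- Et in E.
  destruct (root_sum_product q x z1 z2 r t H E1 E2 Er) as [S P].
  unfold solves2. set (m := m1 3 3 q x) in *.
  replace (cpd 3 (cpd 3 u) x y - (z1 + z2) * cpd 3 u x y + z1 * z2 * u x y) with
    (/ m * (m * cpd 3 (cpd 3 u) x y - m * (z1 + z2) * cpd 3 u x y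
            + m * (z1 * z2) * u x y)) by (field; exact N).
  rewrite S, P. transitivity (/ (m * g) * - (0 : C)); [|ring]. rewrite <- E.
  field. now split.
Qed.

Lemma solves2_p q u x t : good q ->
  frozen (p2 (med q) (tau q)) 0 0 0 q u x t = 0 -> solves2 (lamp q x) (lamm q x) u x t.
Proof.
  intros H. destruct (Kp2_values q x H) as (V0 & V1 & V2).
  apply (solves2_frozen _ Kp2 1 _ _ (root_lam q x) (tau q)); rewrite ?Cmult_1_l;
    try assumption; try reflexivity.
  - apply (symbols_represented (med q)); [apply H | reflexivity | apply H].
  - intros E. apply RtoC_inj in E. lra.
  - now apply lamp_eq.
  - now apply lamm_eq.
  - now apply root_lam_spec.
Qed.

Lemma solves2_q q u x t : good q ->
  frozen (q2 (med q) (tau q)) 0 0 0 q u x t = 0 -> solves2 (mup q x) (mum q x) u x t.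
Proof.
  intros H. destruct (Kq2_values q x H) as (V0 & V1 & V2). pose proof (good_k q H) as Nk.
  apply (solves2_frozen _ Kq2 (kk (med q)) _ _ (root_mu q x) (tau q / kk (med q)));
    try assumption.
  - apply (symbols_represented (med q)); [apply H | reflexivity | apply H].
  - now apply mup_eq.
  - now apply mum_eq.
  - now apply root_mu_spec.
  - field. exact Nk.
Qed.

Lemma flux_value t q u x x3 :
  flux t q u x x3 = Ci * Rt t q x * u x x3 + RtoC (mm (med q) 3 3 x t) * cpd 3 u x x3.
Proof.
  unfold flux. fold (Rt t q x). rewrite D3_cpdn. simpl cpdn.
  assert (I2 : Ci * (- Ci) = 1) by (apply C_ext; simpl; ring).
  transitivity (Ci * Rt t q x * u x x3
    + Ci * (- Ci) * (RtoC (mm (med q) 3 3 x t) * cpd 3 u x x3)); [ring|].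
  rewrite I2. ring.
Qed.

(** * Locality of Theta *)

Lemma CDerive_n_local P f g n t : open_set P -> (forall s, P s -> f s = g s) -> P t ->
  CDerive_n f n t = CDerive_n g n t.
Proof.
  intros HP E Ht. unfold CDerive_n. f_equal; apply Derive_n_ext_loc;
    apply (filter_imp P); [intros; now rewrite E | now apply HP | intros; now rewrite E
                          | now apply HP].
Qed.

Lemma frozen_local P c n a1 a2 q u v x x3 : open_set P ->
  (forall y t, P t -> u y t = v y t) -> P x3 ->
  frozen c n a1 a2 q (Dx a1 a2 u) x x3 = frozen c n a1 a2 q (Dx a1 a2 v) x x3.
Proof.
  intros HP E Hx. unfold frozen. apply Csum_ext. intros i _. f_equal. unfold D3.
  f_equal. apply (CDerive_n_local P); [exact HP | | exact Hx].
  intros t Ht. unfold Dx. f_equal. apply CDerive_n_ext. intros t1.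
  apply CDerive_n_ext. intros t2. now apply E.
Qed.

(** Theta differentiates in x' at fixed x_3 and then in x_3, so agreement for all
    x' and for x_3 in an open set is enough. *)
Lemma Theta_local P c2 c1 q L (m m' : series) x x3 : open_set P ->
  (forall N, (1 <= N <= L)%nat -> forall y t, P t -> m N y t = m' N y t) -> P x3 ->
  Theta c2 c1 q L m x x3 = Theta c2 c1 q L m' x x3.
Proof.
  intros HP E Hx. unfold Theta. apply (f_equal2 Cplus); apply Csum1_ext; intros N HN;
    unfold taylor; apply Csum_ext; intros a1 _; apply Csum_ext; intros a2 _;
    cbv zeta;
    apply (f_equal (fun z => _ * z)), (frozen_local P _ _ _ _ _ _ _ _ _ HP);
    [exact (E N HN) | exact Hx | exact (E N HN) | exact Hx].
Qed.

(** * Uniqueness of the solution *)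

(** Homogeneous data force the difference of two solutions to vanish: decay
    removes one exponential below y_3, the conditions at y_3 transport this to
    the layer, and there the conditions at 0 leave only Delta_0 times the value
    at 0. *)
Lemma homogeneous_zero q x a b d e : good q ->
  Csmooth a -> Csmooth b -> Csmooth d -> Csmooth e ->
  (forall t, (y3 q < t < 0)%R -> solves2 (lamp q x) (lamm q x) a x t /\
     solves2 (mup q x) (mum q x) d x t) ->
  (forall t, (t < y3 q)%R -> solves2 (lamp q x) (lamm q x) b x t /\
     solves2 (mup q x) (mum q x) e x t) ->
  vanishes (b x) -> vanishes (e x) ->
  a x (y3 q) = b x (y3 q) -> d x (y3 q) = e x (y3 q) ->
  flux (y3 q) q a x (y3 q) = flux (y3 q) q b x (y3 q) ->
  flux (y3 q) q d x (y3 q) = flux (y3 q) q e x (y3 q) ->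
  a x 0 = d x 0 -> flux 0 q a x 0 = kk (med q) * flux 0 q d x 0 ->
  (forall t, (y3 q <= t <= 0)%R -> a x t = 0 /\ d x t = 0) /\
  (forall t, (t <= y3 q)%R -> b x t = 0 /\ e x t = 0).
Proof.
  intros H Sa' Sb' Sd' Se' Had Hbe Vb Ve Eab Ede Fab Fde Ead Fad.
  pose proof (good_m1 q x H) as Nm. pose proof (good_y3 q H) as Hy.
  destruct (exponents_Re q x H) as (Plp & Plm & Pmp & Pmm).
  assert (layer : forall z1 z2 u v,
    Csmooth u -> Csmooth v -> (0 < Re z1)%R -> (Re z2 < 0)%R ->
    (forall t, (y3 q < t < 0)%R -> solves2 z1 z2 u x t) ->
    (forall t, (t < y3 q)%R -> solves2 z1 z2 v x t) -> vanishes (v x) ->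
    u x (y3 q) = v x (y3 q) -> flux (y3 q) q u x (y3 q) = flux (y3 q) q v x (y3 q) ->
    dminus z1 v x (y3 q) = 0 /\ dminus z1 u x (y3 q) = 0 /\
    cpd 3 u x (y3 q) = cpd 3 v x (y3 q)).
  { intros z1 z2 u v Su Sv P1 P2 Hu Hv Vv E F.
    assert (Z : dminus z1 v x (y3 q) = 0).
    { apply (dminus_decay z2 z1 v x (y3 q) Sv); [|exact P2|exact P1|exact Vv].
      intros t Ht. now apply solves2_sym, Hv. }
    assert (E' : cpd 3 u x (y3 q) = cpd 3 v x (y3 q)).
    { rewrite !flux_value, E in F. change (RtoC (mm (med q) 3 3 x (y3 q))) with
        (m1 3 3 q x) in F. apply Ceq_minus. apply Ceq_minus in F.
      replace (cpd 3 u x (y3 q) - cpd 3 v x (y3 q)) with (/ m1 3 3 q x *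
        (Ci * Rt (y3 q) q x * v x (y3 q) + m1 3 3 q x * cpd 3 u x (y3 q)
         - (Ci * Rt (y3 q) q x * v x (y3 q) + m1 3 3 q x * cpd 3 v x (y3 q))))
        by (field; exact Nm).
      rewrite F. ring. }
    split; [exact Z|]. split; [|exact E']. unfold dminus in *. now rewrite E', E. }
  destruct (layer (lamp q x) (lamm q x) a b Sa' Sb' Plp Plm
    (fun t Ht => proj1 (Had t Ht)) (fun t Ht => proj1 (Hbe t Ht)) Vb Eab Fab)
    as (Zb & Za & Dab).
  destruct (layer (mup q x) (mum q x) d e Sd' Se' Pmp Pmm
    (fun t Ht => proj2 (Had t Ht)) (fun t Ht => proj2 (Hbe t Ht)) Ve Ede Fde)
    as (Ze & Zd & Dde).
  clear layer.
  assert (up : forall z1 z2 u, Csmooth u ->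
    (forall t, (y3 q < t < 0)%R -> solves2 z1 z2 u x t) ->
    dminus z1 u x (y3 q) = 0 -> forall t, (y3 q <= t <= 0)%R -> dminus z1 u x t = 0).
  { intros z1 z2 u Su Hu Z t Ht. revert Z.
    apply (dminus_zero z2 z1 u x (y3 q) t Su); [apply Ht|].
    intros t' Ht'. apply solves2_sym, Hu. lra. }
  pose proof (up _ (lamm q x) a Sa' (fun t Ht => proj1 (Had t Ht)) Za) as Za'.
  pose proof (up _ (mum q x) d Sd' (fun t Ht => proj2 (Had t Ht)) Zd) as Zd'.
  clear up.
  assert (Z0 : a x 0 = 0).
  { pose proof (Za' 0%R ltac:(lra)) as A. pose proof (Zd' 0%R ltac:(lra)) as B.
    unfold dminus in A, B. apply Ceq_minus in A, B.
    rewrite !flux_value, A, B, <- Ead in Fad.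
    change (Rt 0 q x) with (R0 q x) in Fad.
    change (RtoC (mm (med q) 3 3 x 0)) with (m0 3 3 q x) in Fad.
    pose proof (good_Delta0 q H x) as N.
    replace (a x 0) with (/ Delta0 q x * (Delta0 q x * a x 0)) by (field; exact N).
    replace (Delta0 q x * a x 0) with
      (kk (med q) * (Ci * R0 q x * a x 0 + m0 3 3 q x * (mup q x * a x 0))
       - (Ci * R0 q x * a x 0 + m0 3 3 q x * (lamp q x * a x 0)))
      by (unfold Delta0; ring).
    rewrite <- Fad. ring. }
  assert (W0 : d x 0 = 0) by now rewrite <- Ead.
  assert (down : forall z1 z2 u, Csmooth u -> z1 - z2 <> 0 ->
    (forall t, (y3 q < t < 0)%R -> solves2 z1 z2 u x t) ->
    (forall t, (y3 q <= t <= 0)%R -> dminus z1 u x t = 0) -> u x 0 = 0 ->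
    forall t, (y3 q <= t <= 0)%R -> u x t = 0 /\ dminus z2 u x t = 0).
  { intros z1 z2 u Su N Hu Z Zu t Ht.
    assert (D0 : dminus z2 u x 0 = 0).
    { pose proof (Z 0%R ltac:(lra)) as D. unfold dminus in *.
      rewrite Zu in *. transitivity (cpd 3 u x 0 - z1 * 0); [ring | exact D]. }
    assert (Dt : dminus z2 u x t = 0).
    { revert D0. apply (dminus_zero z1 z2 u x t 0 Su); [apply Ht|].
      intros t' Ht'. apply Hu. lra. }
    split; [|exact Dt]. exact (both_dminus_zero z1 z2 u x t N (Z t Ht) Dt). }
  pose proof (down _ _ a Sa' (lam_distinct q x H) (fun t Ht => proj1 (Had t Ht)) Za' Z0)
    as Fa.
  pose proof (down _ _ d Sd' (mu_distinct q x H) (fun t Ht => proj2 (Had t Ht)) Zd' W0)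
    as Fd.
  clear down.
  assert (below : forall z1 z2 u v, Csmooth v -> z1 - z2 <> 0 ->
    (forall t, (t < y3 q)%R -> solves2 z1 z2 v x t) ->
    dminus z1 v x (y3 q) = 0 -> dminus z2 u x (y3 q) = 0 ->
    u x (y3 q) = v x (y3 q) -> cpd 3 u x (y3 q) = cpd 3 v x (y3 q) ->
    forall t, (t <= y3 q)%R -> v x t = 0).
  { intros z1 z2 u v Sv N Hv D1 D2 E E' t Ht.
    assert (D2' : dminus z2 v x (y3 q) = 0) by (unfold dminus in *; now rewrite <- E, <- E').
    apply (both_dminus_zero z1 z2); [exact N| |].
    - revert D1. apply (dminus_zero z2 z1 v x t (y3 q) Sv Ht).
      intros t' Ht'. apply solves2_sym, Hv. lra.
    - revert D2'. apply (dminus_zero z1 z2 v x t (y3 q) Sv Ht).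
      intros t' Ht'. apply Hv. lra. }
  split; intros t Ht; split.
  - exact (proj1 (Fa t Ht)).
  - exact (proj1 (Fd t Ht)).
  - exact (below _ _ a b Sb' (lam_distinct q x H) (fun t Ht => proj1 (Hbe t Ht)) Zb
      (proj2 (Fa (y3 q) ltac:(lra))) Eab Dab t Ht).
  - exact (below _ _ d e Se' (mu_distinct q x H) (fun t Ht => proj2 (Hbe t Ht)) Ze
      (proj2 (Fd (y3 q) ltac:(lra))) Ede Dde t Ht).
Qed.

Lemma vanishes_minus f g : vanishes f -> vanishes g -> vanishes (fun t => f t - g t).
Proof.
  intros Hf Hg. apply (vanishes_ext _ _ (vanishes_plus _ _ Hf (vanishes_scal (-1) _ Hg))).
  intros; cbv beta; ring.
Qed.

(** Equal earlier terms give equal sources, so the difference of two solutions has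
    homogeneous data. *)
Lemma hierarchy_unique q ell s a b d e a' b' d' e' : good q ->
  hierarchy q ell s a b d e -> hierarchy q ell s a' b' d' e' ->
  forall L, (1 <= L)%nat ->
  (forall x t, (y3 q <= t <= 0)%R -> a L x t = a' L x t /\ d L x t = d' L x t) /\
  (forall x t, (t <= y3 q)%R -> b L x t = b' L x t /\ e L x t = e' L x t).
Proof.
  intros H Hy Hy' L. induction L as [L IH] using lt_wf_ind. intros HL.
  destruct L as [|L]; [lia|].
  destruct (Hy L) as ((Sa1 & Sb1 & Sd1 & Se1) & Had & Hbe & V & J & B).
  destruct (Hy' L) as ((Sa2 & Sb2 & Sd2 & Se2) & Had' & Hbe' & V' & J' & B').
  clear Hy Hy'.
  assert (O1 : open_set (fun t => (y3 q < t < 0)%R)).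
  { intros t [Ht1 Ht2].
    apply filter_and; [now apply (open_gt (y3 q)) | now apply (open_lt 0)]. }
  assert (O2 : open_set (fun t => (t < y3 q)%R)).
  { intros t Ht. now apply (open_lt (y3 q)). }
  assert (Pa : forall N, (1 <= N <= L)%nat -> forall y t, (y3 q < t < 0)%R ->
    a N y t = a' N y t /\ d N y t = d' N y t).
  { intros N HN y t Ht. apply (proj1 (IH N ltac:(lia) ltac:(lia))). lra. }
  assert (Pb : forall N, (1 <= N <= L)%nat -> forall y t, (t < y3 q)%R ->
    b N y t = b' N y t /\ e N y t = e' N y t).
  { intros N HN y t Ht. apply (proj2 (IH N ltac:(lia) ltac:(lia))). lra. }
  clear IH.
  assert (Z : forall x,
    (forall t, (y3 q <= t <= 0)%R ->
       a (S L) x t - a' (S L) x t = 0 /\ d (S L) x t - d' (S L) x t = 0) /\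
    (forall t, (t <= y3 q)%R ->
       b (S L) x t - b' (S L) x t = 0 /\ e (S L) x t - e' (S L) x t = 0)).
  { intros x.
    destruct (V x) as [V1 V2]. destruct (V' x) as [V1' V2'].
    destruct (J x) as (J1 & J2 & J3 & J4). destruct (J' x) as (J1' & J2' & J3' & J4').
    destruct (B x) as (B1 & B2). destruct (B' x) as (B1' & B2').
    rewrite flux_minus in J3, J4, J3', J4' by assumption.
    apply (homogeneous_zero q x
      (fun y t => a (S L) y t - a' (S L) y t) (fun y t => b (S L) y t - b' (S L) y t)
      (fun y t => d (S L) y t - d' (S L) y t) (fun y t => e (S L) y t - e' (S L) y t) H
      (Csmooth_minus _ _ Sa1 Sa2) (Csmooth_minus _ _ Sb1 Sb2)
      (Csmooth_minus _ _ Sd1 Sd2) (Csmooth_minus _ _ Se1 Se2)).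
    - intros t Ht. destruct (Had x t Ht) as [E1 E2]. destruct (Had' x t Ht) as [E1' E2'].
      split; [apply solves2_p | apply solves2_q]; try exact H.
      + rewrite (frozen_minus _ _ _ _ _ _ Sa1 Sa2), E1, E1'.
        rewrite (Theta_local _ _ _ q L a a' x t O1
          (fun N HN y t' Ht' => proj1 (Pa N HN y t' Ht')) Ht). ring.
      + rewrite (frozen_minus _ _ _ _ _ _ Sd1 Sd2), E2, E2'.
        rewrite (Theta_local _ _ _ q L d d' x t O1
          (fun N HN y t' Ht' => proj2 (Pa N HN y t' Ht')) Ht). ring.
    - intros t Ht. destruct (Hbe x t Ht) as [E1 E2]. destruct (Hbe' x t Ht) as [E1' E2'].
      split; [apply solves2_p | apply solves2_q]; try exact H.
      + rewrite (frozen_minus _ _ _ _ _ _ Sb1 Sb2), E1, E1'.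
        rewrite (Theta_local _ _ _ q L b b' x t O2
          (fun N HN y t' Ht' => proj1 (Pb N HN y t' Ht')) Ht). ring.
      + rewrite (frozen_minus _ _ _ _ _ _ Se1 Se2), E2, E2'.
        rewrite (Theta_local _ _ _ q L e e' x t O2
          (fun N HN y t' Ht' => proj2 (Pb N HN y t' Ht')) Ht). ring.
    - exact (vanishes_minus _ _ V1 V1').
    - exact (vanishes_minus _ _ V2 V2').
    - now rewrite J1, J1'.
    - now rewrite J2, J2'.
    - rewrite (flux_minus _ _ _ _ _ _ Sa1 Sa2), (flux_minus _ _ _ _ _ _ Sb1 Sb2).
      apply Ceq_minus. rewrite <- J3' in J3. apply Ceq_minus in J3.
      etransitivity; [|exact J3]. ring.
    - rewrite (flux_minus _ _ _ _ _ _ Sd1 Sd2), (flux_minus _ _ _ _ _ _ Se1 Se2).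
      apply Ceq_minus. rewrite <- J4' in J4. apply Ceq_minus in J4.
      pose proof (good_k q H) as Nk.
      match goal with |- ?z = _ =>
        replace z with (/ kk (med q) * (kk (med q) * z)) by (field; exact Nk) end.
      match goal with |- / ?k * ?z = _ => transitivity (/ k * (0 : C)); [|ring] end.
      f_equal. etransitivity; [|exact J4]. ring.
    - now rewrite B1, B1'.
    - rewrite (flux_minus _ _ _ _ _ _ Sa1 Sa2), (flux_minus _ _ _ _ _ _ Sd1 Sd2).
      rewrite B2, B2'. ring. }
  split; intros x t Ht; destruct (Z x) as [Z1 Z2].
  - destruct (Z1 t Ht) as [E1 E2]. split; now apply Ceq_minus.
  - destruct (Z2 t Ht) as [E1 E2]. split; now apply Ceq_minus.
Qed.

Local Close Scope C_scope.
Local Open Scope nat_scope.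

Theorem theorem2p3 :
  exists f : nat -> nat -> nat -> symbol,
  (forall L l j : nat,
     1 <= L -> l <= 2 * L - 2 -> 1 <= j <= 8 ->
     of_order (f L l j) (Z.of_nat l - Z.of_nat L)) /\
  forall (D : medium) (T eps : R) (sigma th1 th2 : R2 -> R),
  admissible D ->
  (0 < T)%R -> (0 < eps)%R ->
  sector_ok D eps sigma th1 th2 ->
  forall q : par,
  med q = D ->
  (- eps < y3 q < 0)%R ->
  in_sector (sigma (xi q)) (th1 (xi q)) (th2 (xi q)) (tau q) ->
  (forall x : R2, first_coefficients q x (fun l j => f 1 l j q x)) /\
  (exists E : nat -> nat -> nat -> R2 -> C,
   forall L : nat, 1 <= L ->
   (forall (ell : nat) (s : R) (x : R2) (x3 : R),
      (ell = 1 \/ ell = 2) -> (0 < s < T)%R ->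
      Theta (p2 D (tau q)) (p1 D) q L (ansatz Sa f q ell s) x x3
        = expansion Sa (2 * L - 1) (E L) q ell s x x3 /\
      Theta (p2 D (tau q)) (p1 D) q L (ansatz Sb f q ell s) x x3
        = expansion Sb (2 * L - 1) (E L) q ell s x x3 /\
      Theta (q2 D (tau q)) (q1 D) q L (ansatz Sd f q ell s) x x3
        = expansion Sd (2 * L - 1) (E L) q ell s x x3 /\
      Theta (q2 D (tau q)) (q1 D) q L (ansatz Se f q ell s) x x3
        = expansion Se (2 * L - 1) (E L) q ell s x x3) /\
   (forall x : R2,
      next_coefficients q x L
        (fun l j => E L l j x) (fun l j => f (L + 1) l j q x))) /\
  (forall (ell : nat) (s : R),
   (ell = 1 \/ ell = 2) -> (0 < s < T)%R ->
   hierarchy q ell s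
     (ansatz Sa f q ell s) (ansatz Sb f q ell s)
     (ansatz Sd f q ell s) (ansatz Se f q ell s) /\
   forall a b d e : series,
   hierarchy q ell s a b d e ->
   forall L : nat, 1 <= L ->
   forall (x : R2) (x3 : R),
     ((y3 q <= x3 <= 0)%R ->
        a L x x3 = ansatz Sa f q ell s L x x3 /\
        d L x x3 = ansatz Sd f q ell s L x x3) /\
     ((x3 <= y3 q)%R ->
        b L x x3 = ansatz Sb f q ell s L x x3 /\
        e L x x3 = ansatz Se f q ell s L x x3)).
Proof.
  exists (fun L l j q x => amp_coef L q l j x). split.
  { intros L l j HL _ _. exact (order_amp L HL l j). }
  intros D T eps sigma th1 th2 HD _ _ Hs q <- Hy Ht.
  assert (H : good q).
  { constructor; [exact HD | apply Hy | | |]; intros x;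
      destruct (Hs q eq_refl Hy Ht x) as (H1 & H2 & H3); assumption. }
  split; [|split].
  - intros x. exact (first_coef_formulas q x).
  - exists (fun L => amp_source L q). intros L HL. split.
    + intros ell s x x3 _ _.
      refine (conj _ (conj _ (conj _ _))).
      * apply (proj1 (Theta_amp Sa q ell s L x x3 H HL)). unfold Sa; simpl; lia.
      * apply (proj1 (Theta_amp Sb q ell s L x x3 H HL)). unfold Sb; simpl; lia.
      * apply (proj2 (Theta_amp Sd q ell s L x x3 H HL)). unfold Sd; simpl; lia.
      * apply (proj2 (Theta_amp Se q ell s L x x3 H HL)). unfold Se; simpl; lia.
    + intros x. rewrite Nat.add_1_r, (amp_coef_S L q HL).
      exact (next_coef_formulas L q (amp_source L q) x HL).
  - intros ell s _ _. pose proof (amp_hierarchy q ell s H) as HA.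
    split; [exact HA|]. intros a b d e Hh L HL x x3.
    destruct (hierarchy_unique q ell s _ _ _ _ _ _ _ _ H Hh HA L HL) as [U1 U2].
    exact (conj (U1 x x3) (U2 x x3)).
Qed.
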